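(* Let $A$ be a compact connected abelian group and let $\beta:A\to A$ be a continuous endomorphism. Let $T=\widehat\beta:\widehat A\to\widehat A$ be the dual endomorphism, let $V=\widehat A\otimes_{\mathbb Z}\mathbb Q$, and let $T_{\mathbb Q}=T\otimes\mathrm{id}_{\mathbb Q}:V\to V$. Then $\beta$ has shadowing if and only if $T_{\mathbb Q}|_W$ is hyperbolic for every finite-dimensional $T_{\mathbb Q}$-invariant $\mathbb Q$-subspace $W\leq V$.
   Context: All topological groups are Hausdorff. $\widehat A$ is the Pontryagin dual of $A$ (the discrete group of continuous homomorphisms $A\to\mathbb T$, with $\mathbb T$ the circle group), and $\widehat\beta(\chi)=\chi\circ\beta$. Since $A$ is connected, $\widehat A$ is torsion-free. A subspace $W$ is $T_{\mathbb Q}$-invariant if $T_{\mathbb Q}(W)\subseteq W$. A linear endomorphism $L$ of a finite-dimensional $\mathbb Q$-vector space is hyperbolic if no eigenvalue of its complexification lies on the unit circle $\{z\in\mathbb C:|z|=1\}$ (the eigenvalue $0$ is allowed). Let $G$ be a topological group and $\alpha:G\to G$ a continuous endomorphism. For an identity neighbourhood $V$, a sequence $(x_i)_{i\in\mathbb N}$ in $G$ (with $0\in\mathbb N$) is a $V$-pseudo-orbit for $\alpha$ if $\alpha(x_i)^{-1}x_{i+1}\in V$ for all $i$. For an identity neighbourhood $U$, it is $U$-shadowed by $x\in G$ if $\alpha^i(x)^{-1}x_i\in U$ for all $i$. The endomorphism $\alpha$ has shadowing if for every identity neighbourhood $U$ there is an identity neighbourhood $V$ such that every $V$-pseudo-orbit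 indexed by $\mathbb N$ is $U$-shadowed by some point of $G$. *)

(* Defs.v *)
From HB Require Import structures.
From mathcomp Require Import all_boot all_order all_algebra.
From mathcomp Require Import all_classical all_reals topology normedtype.
From mathcomp Require Import complex ring_quotient freeg.

Set Implicit Arguments.
Unset Strict Implicit.
Unset Printing Implicit Defensive.

Import Order.TTheory GRing.Theory Num.Theory.
Import numFieldNormedType.Exports.

Local Open Scope classical_set_scope.
Local Open Scope ring_scope.
Local Open Scope quotient_scope.
Local Open Scope complex_scope.

(** Extension of scalars [M ⊗_K S] along [f : K -> S], built as the free
    abelian group on [M * S] modulo the bilinearity relations. *)
Section BaseChange.
Variables (K S : comNzRingType) (f : {rmorphism K -> S}).

Section Construction.
Variable M : lmodType K.

Inductive tensor_null : {freeg (M * S) / int} -> Prop :=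
| tensor_null0 : tensor_null 0
| tensor_nullB x y : tensor_null x -> tensor_null y -> tensor_null (x - y)
| tensor_nullDl m m' s :
    tensor_null (<< (m + m', s) >> - << (m, s) >> - << (m', s) >>)
| tensor_nullDr m s s' :
    tensor_null (<< (m, s + s') >> - << (m, s) >> - << (m, s') >>)
| tensor_nullZ k m s :
    tensor_null (<< (k *: m, s) >> - << (m, f k * s) >>).

Definition tensor_null_pred : {pred {freeg (M * S) / int}} :=
  fun x => `[< tensor_null x >].

Lemma tensor_null_zmod_closed : zmod_closed tensor_null_pred.
Proof.
split=> [|x y /asboolP hx /asboolP hy]; apply/asboolP.
  exact: tensor_null0.
exact: tensor_nullB.
Qed.
HB.instance Definition _ :=
  GRing.isZmodClosed.Build _ tensor_null_pred tensor_null_zmod_closed.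

Definition base_change : Type := Quotient.quot tensor_null_pred.
HB.instance Definition _ := Choice.on base_change.
HB.instance Definition _ := GRing.Zmodule.on base_change.

Definition tensor_class (x : {freeg (M * S) / int}) : base_change :=
  \pi_(Quotient.quot tensor_null_pred) x.

Definition tensor (m : M) (s : S) : base_change := tensor_class << (m, s) >>.

Lemma tensor_class_is_additive : zmod_morphism tensor_class.
Proof. by move=> x y; rewrite /tensor_class raddfB. Qed.
HB.instance Definition _ :=
  GRing.isZmodMorphism.Build _ _ tensor_class tensor_class_is_additive.

Lemma tensor_class_eq x y :
  (tensor_class x = tensor_class y) <-> tensor_null (x - y).
Proof.
split.
  move=> /eqP; rewrite /tensor_class -Quotient.idealrBE.
  by move=> /asboolP.
move=> h; apply/eqP; rewrite /tensor_class -Quotient.idealrBE.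
exact/asboolP.
Qed.

Lemma tensorDl m m' s : tensor (m + m') s = tensor m s + tensor m' s.
Proof.
rewrite /tensor -raddfD; apply/tensor_class_eq.
by rewrite opprD addrA; exact: tensor_nullDl.
Qed.

Lemma tensorDr m s s' : tensor m (s + s') = tensor m s + tensor m s'.
Proof.
rewrite /tensor -raddfD; apply/tensor_class_eq.
by rewrite opprD addrA; exact: tensor_nullDr.
Qed.

Lemma tensorZl k m s : tensor (k *: m) s = tensor m (f k * s).
Proof. by apply/tensor_class_eq; exact: tensor_nullZ. Qed.

Section Lift.
Variables (N : zmodType) (phi : M -> S -> N).
Hypothesis phiDl : forall m m' s, phi (m + m') s = phi m s + phi m' s.
Hypothesis phiDr : forall m s s', phi m (s + s') = phi m s + phi m s'.
Hypothesis phiZ : forall k m s, phi (k *: m) s = phi m (f k * s).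

Definition free_lift : {freeg (M * S) / int} -> N :=
  fglift (fun p => phi p.1 p.2 : zmodule N).

Lemma free_lift_is_additive : zmod_morphism free_lift.
Proof. exact: (@lift_is_additive int (M * S)%type (zmodule N)). Qed.
HB.instance Definition _ :=
  GRing.isZmodMorphism.Build _ _ free_lift free_lift_is_additive.

Definition tensor_lift (x : base_change) : N :=
  free_lift (repr (x : Quotient.quot tensor_null_pred)).

Let free_liftU p : free_lift << p >> = phi p.1 p.2.
Proof. by rewrite /free_lift liftU scale1r. Qed.

Let free_lift_null x : tensor_null x -> free_lift x = 0.
Proof.
elim=> [|{}x y _ hx _ hy|m m' s|m s s'|k m s].
- by rewrite raddf0.
- by rewrite raddfB /= hx hy subr0.
- by rewrite 2!raddfB /= !free_liftU /= phiDl addrAC addrK subrr.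
- by rewrite 2!raddfB /= !free_liftU /= phiDr addrAC addrK subrr.
- by rewrite raddfB /= !free_liftU /= phiZ subrr.
Qed.

Lemma tensor_lift_class x : tensor_lift (tensor_class x) = free_lift x.
Proof.
apply/eqP; rewrite -subr_eq0 /tensor_lift -raddfB; apply/eqP.
apply: free_lift_null; apply/tensor_class_eq.
by rewrite /tensor_class reprK.
Qed.

Lemma tensor_liftE m s : tensor_lift (tensor m s) = phi m s.
Proof. by rewrite tensor_lift_class free_liftU. Qed.

Lemma tensor_lift_is_additive : zmod_morphism tensor_lift.
Proof.
move=> x y; rewrite -[x]reprK -[y]reprK -/(tensor_class _) -/(tensor_class _).
by rewrite -raddfB !tensor_lift_class raddfB.
Qed.
End Lift.

Lemma tensor_ind (P : base_change -> Prop) :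
  P 0 -> (forall x y, P x -> P y -> P (x - y)) ->
  (forall m s, P (tensor m s)) -> forall x, P x.
Proof.
move=> P0 PB Pt x; have PN y : P y -> P (- y).
  by move=> Py; rewrite -sub0r; exact: PB.
have PD y z : P y -> P z -> P (y + z).
  by move=> Py Pz; rewrite -[z]opprK; apply: PB => //; exact: PN.
rewrite -[x]reprK -/(tensor_class _) -[repr _]freeg_sumE raddf_sum.
apply: (big_ind P P0 PD) => -[m s] _; move: (coeff _ _) => c.
have -> : << c *g (m, s) >> = << (m, s) >> *~ c :> {freeg (M * S) / int}.
  by rewrite freegU_mulz intz.
rewrite raddfMz -/(tensor m s).
have Pn n : P (tensor m s *+ n).
  by elim: n => [|n IHn]; rewrite ?mulr0n// mulrS; exact: PD.
by case: c => n; rewrite ?NegzE ?mulrNz -pmulrn; [exact: Pn|exact/PN/Pn].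
Qed.

Lemma tensor_additive_ext (N : zmodType) (g h : base_change -> N) :
  zmod_morphism g -> zmod_morphism h ->
  (forall m s, g (tensor m s) = h (tensor m s)) -> g =1 h.
Proof.
move=> gB hB gh; elim/tensor_ind => [|x y gx gy|//].
  by rewrite -[0](subrr 0) gB hB !subrr.
by rewrite gB hB gx gy.
Qed.

Definition base_change_scale (t : S) : base_change -> base_change :=
  tensor_lift (fun m s => tensor m (t * s)).

Let scale_spec t :
  (forall m s, base_change_scale t (tensor m s) = tensor m (t * s)) /\
  zmod_morphism (base_change_scale t).
Proof.
have h1 m m' s : tensor (m + m') (t * s) = tensor m (t * s) + tensor m' (t * s).
  exact: tensorDl.
have h2 m s s' : tensor m (t * (s + s')) = tensor m (t * s) + tensor m (t * s').
  by rewrite mulrDr tensorDr.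
have h3 k m s : tensor (k *: m) (t * s) = tensor m (t * (f k * s)).
  by rewrite tensorZl mulrCA.
split=> [m s|]; first exact: tensor_liftE.
exact: tensor_lift_is_additive.
Qed.

Let scaleE t m s : base_change_scale t (tensor m s) = tensor m (t * s).
Proof. by have [] := scale_spec t. Qed.

Let scaleB t : zmod_morphism (base_change_scale t).
Proof. by have [] := scale_spec t. Qed.

Let scaleA a b v :
  base_change_scale a (base_change_scale b v) = base_change_scale (a * b) v.
Proof.
move: v; apply: tensor_additive_ext => [x y||m s]; first by rewrite !scaleB.
  exact: scaleB.
by rewrite !scaleE mulrA.
Qed.

Let scale1 : left_id 1 base_change_scale.
Proof.
by apply: tensor_additive_ext => [|//|m s]; [exact: scaleB|rewrite scaleE mul1r].
Qed.

Let scaleDr : right_distributive base_change_scale +%R.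
Proof.
move=> a x y; have N z : base_change_scale a (- z) = - base_change_scale a z.
  by rewrite -sub0r scaleB -{1}(subrr 0) scaleB subrr sub0r.
by rewrite -[y]opprK scaleB [in RHS]N.
Qed.

Let scaleDl v : {morph base_change_scale^~ v : a b / a + b}.
Proof.
move=> a b; move: v; apply: tensor_additive_ext => [|x y|m s].
- exact: scaleB.
- by rewrite !scaleB opprD addrACA.
- by rewrite !scaleE mulrDl tensorDr.
Qed.

HB.instance Definition _ := GRing.Zmodule_isLmodule.Build S base_change
  scaleA scale1 scaleDr scaleDl.

Lemma tensorZr t m s : t *: tensor m s = tensor m (t * s).
Proof. exact: scaleE. Qed.

End Construction.

Section Map.
Variables (M N : lmodType K) (L : {linear M -> N}).

Definition base_change_map : base_change M -> base_change N :=
  tensor_lift (fun m s => tensor (L m) s).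

Let map_spec :
  (forall m s, base_change_map (tensor m s) = tensor (L m) s) /\
  zmod_morphism base_change_map.
Proof.
have h1 m m' s : tensor (L (m + m')) s = tensor (L m) s + tensor (L m') s.
  by rewrite linearD tensorDl.
have h2 m s s' : tensor (L m) (s + s') = tensor (L m) s + tensor (L m) s'.
  exact: tensorDr.
have h3 k m s : tensor (L (k *: m)) s = tensor (L m) (f k * s).
  by rewrite linearZ tensorZl.
split=> [m s|]; first exact: tensor_liftE.
exact: tensor_lift_is_additive.
Qed.

Lemma base_change_mapE m s : base_change_map (tensor m s) = tensor (L m) s.
Proof. exact: map_spec.1. Qed.

HB.instance Definition _ :=
  GRing.isZmodMorphism.Build _ _ base_change_map map_spec.2.

Lemma base_change_map_is_scalable : scalable base_change_map.
Proof.
move=> t; apply: tensor_additive_ext => [x y|x y|m s].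
- by rewrite scalerBr raddfB.
- by rewrite raddfB scalerBr.
- by rewrite tensorZr !base_change_mapE tensorZr.
Qed.
HB.instance Definition _ :=
  GRing.isScalable.Build _ _ _ _ base_change_map base_change_map_is_scalable.
End Map.

End BaseChange.

Arguments tensor {K S} f {M} m s.
Arguments base_change_map {K S} f {M N} L.

Section LinearAlgebra.

Definition finite_dimensional (K : fieldType) (W : lmodType K) :=
  exists s : seq W, forall w : W,
    exists c : 'I_(size s) -> K, w = \sum_i c i *: s`_i.

Definition is_eigenvalue (K : fieldType) (W : lmodType K) (L : {linear W -> W})
    (a : K) :=
  exists2 w : W, w != 0 & L w = a *: w.

(** The complexification of [W] is its extension of scalars along [ratr]. *)
Definition hyperbolic (R : realType) (W : lmodType rat)
    (L : {linear W -> W}) :=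
  forall z : R[i],
    is_eigenvalue (base_change_map (ratr : {rmorphism rat -> R[i]}) L) z ->
    `|z| != 1.

Section Subspaces.
Variables (K : fieldType) (V : lmodType K) (W : submodClosed V).

(** The members of [W] as a vector space in its own right. *)
Record linear_subspace := LinearSubspace {
  linear_subspace_val :> V;
  linear_subspace_valP : linear_subspace_val \in W
}.
HB.instance Definition _ := [isSub for linear_subspace_val].
HB.instance Definition _ := [Choice of linear_subspace by <:].
HB.instance Definition _ := [SubChoice_isSubLmodule of linear_subspace by <:].

Variable L : {linear V -> V}.

Definition invariant_subspace := forall v : V, v \in W -> L v \in W.

Hypothesis LW : invariant_subspace.

Definition restriction (w : linear_subspace) : linear_subspace :=
  LinearSubspace (LW (linear_subspace_valP w)).

Lemma restriction_is_linear : linear restriction.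
Proof. by move=> a x y; apply: val_inj; rewrite /= linearP. Qed.
HB.instance Definition _ :=
  GRing.isLinear.Build _ _ _ _ restriction restriction_is_linear.
End Subspaces.

End LinearAlgebra.

Section Dual.
Variable R : realType.

(** [R[i]^o] is [R[i]] with the topology of its norm, so that the circle group
    is [[set z | `|z| = 1]]. *)
Section Characters.
Variable A : topologicalZmodType.

Definition is_character (chi : A -> R[i]^o) : Prop :=
  [/\ continuous chi, (forall a, `|chi a| = 1) &
      forall a b, chi (a + b) = chi a * chi b].

Record pontryagin_dual := Character {
  character_fun :> A -> R[i]^o;
  character_funP : `[< is_character character_fun >]
}.
HB.instance Definition _ := [isSub for character_fun].
HB.instance Definition _ := [Choice of pontryagin_dual by <:].

Lemma characterP (chi : pontryagin_dual) : is_character chi.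
Proof. exact/asboolP/character_funP. Qed.

Lemma pontryagin_dualP (chi psi : pontryagin_dual) : chi =1 psi -> chi = psi.
Proof. by move=> h; apply: val_inj; exact/funext. Qed.

Let mkchar (chi : A -> R[i]^o) (h : is_character chi) : pontryagin_dual :=
  Character (introT (asboolP _) h).

Let is_character1 : is_character (fun=> 1).
Proof.
by split=> [|a|a b]; rewrite ?normr1 ?mulr1//; move=> x; exact: cvg_cst.
Qed.

Let is_characterM (chi psi : pontryagin_dual) :
  is_character (fun a => chi a * psi a).
Proof.
have [cc c1 cM] := characterP chi; have [pc p1 pM] := characterP psi.
split=> [x|a|a b]; last by rewrite cM pM mulrACA.
  by apply: cvgM; [exact: cc|exact: pc].
by rewrite normrM c1 p1 mulr1.
Qed.

Let char_neq0 (chi : pontryagin_dual) a : chi a != 0.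
Proof. by have [_ c1 _] := characterP chi; rewrite -normr_eq0 c1 oner_eq0. Qed.

Let is_characterV (chi : pontryagin_dual) : is_character (fun a => (chi a)^-1).
Proof.
have [cc c1 cM] := characterP chi.
split=> [x|a|a b]; last by rewrite cM invfM.
  by apply: cvgV; [exact: char_neq0|exact: cc].
by rewrite normfV c1 invr1.
Qed.

Let dual0 := mkchar is_character1.
Let dualD chi psi := mkchar (is_characterM chi psi).
Let dualN chi := mkchar (is_characterV chi).

Let dualDA : associative dualD.
Proof. by move=> x y z; apply: pontryagin_dualP => a /=; rewrite mulrA. Qed.

Let dualDC : commutative dualD.
Proof. by move=> x y; apply: pontryagin_dualP => a /=; rewrite mulrC. Qed.

Let dual0D : left_id dual0 dualD.
Proof. by move=> x; apply: pontryagin_dualP => a /=; rewrite mul1r. Qed.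

Let dualND : left_inverse dual0 dualN dualD.
Proof. by move=> x; apply: pontryagin_dualP => a /=; rewrite mulVf. Qed.

(** The pointwise product of characters is written additively. *)
HB.instance Definition _ :=
  GRing.isZmodule.Build pontryagin_dual dualDA dualDC dual0D dualND.
HB.instance Definition _ :=
  GRing.Lmodule.copy pontryagin_dual (zmodule pontryagin_dual).

Lemma pontryagin_dual0E a : (0 : pontryagin_dual) a = 1. Proof. by []. Qed.

Lemma pontryagin_dualDE (chi psi : pontryagin_dual) a :
  (chi + psi) a = chi a * psi a.
Proof. by []. Qed.

Lemma pontryagin_dualNE (chi : pontryagin_dual) a : (- chi) a = (chi a)^-1.
Proof. by []. Qed.

End Characters.

Section DualMap.
Variables (A B : topologicalZmodType) (beta : {additive A -> B}).
Hypothesis cbeta : continuous beta.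

Let is_character_comp (chi : pontryagin_dual B) : is_character (chi \o beta).
Proof.
have [cc c1 cM] := characterP chi.
split=> [x|a|a b] /=; last by rewrite raddfD cM.
  by apply: continuous_comp; [exact: cbeta|exact: cc].
exact: c1.
Qed.

Definition dual_map (chi : pontryagin_dual B) : pontryagin_dual A :=
  Character (introT (asboolP _) (is_character_comp chi)).

Lemma dual_mapE chi a : dual_map chi a = chi (beta a). Proof. by []. Qed.

Lemma dual_map_is_zmod_morphism : zmod_morphism dual_map.
Proof. by move=> chi psi; exact: pontryagin_dualP. Qed.
HB.instance Definition _ :=
  GRing.isZmodMorphism.Build _ _ dual_map dual_map_is_zmod_morphism.

Lemma dual_map_is_scalable : scalable dual_map.
Proof. by move=> k chi; exact: (raddfMz dual_map k chi). Qed.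
HB.instance Definition _ :=
  GRing.isScalable.Build _ _ _ _ dual_map dual_map_is_scalable.
End DualMap.

End Dual.

Section Shadowing.
Variables (A : topologicalZmodType) (alpha : A -> A).

(** In multiplicative notation [- a + b] is [a^-1 * b]. *)
Definition pseudo_orbit (V : set A) (x : nat -> A) :=
  forall i, V (- alpha (x i) + x i.+1).

Definition shadowed (U : set A) (x : nat -> A) (a : A) :=
  forall i, U (- iter i alpha a + x i).

Definition has_shadowing :=
  forall U : set A, nbhs 0 U ->
    exists2 V : set A, nbhs 0 V &
      forall x, pseudo_orbit V x -> exists a, shadowed U x a.
End Shadowing.

(* Main.v *)
(** Shadowing for [beta] is dual to a shadowing statement for sequences [e n] of
    homomorphisms from the dual group [X] to the circle: whenever the [e n] are small on
    a suitable finite set, the orbit [z (n+1) = z n \o T + e n] of some [z] is small on a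
    given finite set.  In this form the property passes to unions and extensions of
    [T]-invariant subgroups, and from [X (x) Q] to [X].  A rational filtration reduces it
    to cyclic modules [Z[t] / (p)], where it says that the recurrence [p(S) a = g] (with
    [S] the shift of sequences) has a bounded solution for each bounded [g]; this holds
    when [p] has no root on the unit circle.  Conversely, if the minimal polynomial [p] of
    some [z] with [|z| = 1] annihilates [x != 0], errors proportional to [z ^ n] resonate
    with [p(S)] and rule out shadowing at [x].

    The duality needed (characters define the topology of a compact group, and all
    homomorphisms from [X] to the circle are evaluations) is obtained from an invariant
    mean on all bounded functions instead of Haar measure.  A function maximizing
    [M (phi ^ 2)] among the normalized positive definite eigenfunctions of a convolution
    operator satisfies d'Alembert's equation, hence is the real part of a character. *)
From HB Require Import structures.
Require Import Defs.
From mathcomp Require Import all_boot all_order all_algebra.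
From mathcomp Require Import all_classical all_reals interval_inference topology normedtype.
From mathcomp Require Import sequences trigo.
From mathcomp Require Import complex ring_quotient freeg ring lra.

Set Implicit Arguments.
Unset Strict Implicit.
Unset Printing Implicit Defensive.

Import Order.TTheory GRing.Theory Num.Theory.
Import numFieldNormedType.Exports.

Local Open Scope classical_set_scope.
Local Open Scope ring_scope.

(** * Invariant means *)

Section BoundedFunctions.
Variables (R : realType) (I : Type).
Implicit Types f g : I -> R.

(** Homomorphisms take values in the circle, whereas the recurrences are solved over the reals and
    the complex numbers. Smallness therefore means having a small real lift. As 1 < pi, a relation
    between small lifts that holds in the circle holds in the reals; this fixes the constants of the
    resonance argument.

    [A] is not assumed metrizable and the mean is only finitely additive. Ultralimits, which are
    multiplicative on bounded functions, replace convergent subsequences, and limits or iterated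
    means are exchanged only along equicontinuous families, where a single finite quadrature formula
    approximates all means at once.

    The rational filtration has two kinds of steps. Inside the torsion part, the annihilator of a
    new element modulo the previous stage divides its annihilator in [V], hence has no root on the
    unit circle. Above it, pure closures have torsion-free quotients of rank at most one, whose
    finitely generated submodules are free: with [p = 0] there is no equation to solve.
    Hyperbolicity thus enters through torsion alone. *)

Definition bounded_fct f := exists B, forall i, `|f i| <= B.

Lemma bounded_cst c : bounded_fct (fun=> c).
Proof. by exists `|c|. Qed.

Lemma boundedD f g : bounded_fct f -> bounded_fct g ->
  bounded_fct (fun i => f i + g i).
Proof.
move=> [B fB] [C gC]; exists (B + C) => i.
by rewrite (le_trans (ler_normD _ _))// lerD.
Qed.

Lemma boundedM f g : bounded_fct f -> bounded_fct g ->
  bounded_fct (fun i => f i * g i).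
Proof.
move=> [B fB] [C gC]; exists (B * C) => i.
by rewrite normrM ler_pM.
Qed.

Lemma boundedN f : bounded_fct f -> bounded_fct (fun i => - f i).
Proof. by move=> [B fB]; exists B => i; rewrite normrN. Qed.

Lemma boundedB f g : bounded_fct f -> bounded_fct g ->
  bounded_fct (fun i => f i - g i).
Proof. by move=> bf bg; apply: boundedD => //; exact: boundedN. Qed.

Lemma boundedX f n : bounded_fct f -> bounded_fct (fun i => f i ^+ n).
Proof.
move=> bf; elim: n => [|n ih]; first exact: (bounded_cst 1).
by under eq_fun do rewrite exprS; exact: boundedM.
Qed.

Lemma bounded_sum (J : Type) (s : seq J) (P : pred J) (F : J -> I -> R) :
  (forall j, bounded_fct (F j)) -> bounded_fct (fun i => \sum_(j <- s | P j) F j i).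
Proof.
move=> bF; elim: s => [|j s ih].
  by exists 0 => i; rewrite big_nil normr0.
have [B hB] := bF j; have [C hC] := ih; exists (`|B| + C) => i.
rewrite big_cons; case: ifP => _.
  by rewrite (le_trans (ler_normD _ _))// lerD// (le_trans (hB i))// ler_norm.
by rewrite (le_trans (hC i))// lerDr.
Qed.

End BoundedFunctions.
Arguments bounded_fct {R I} f.

Record positive_functional (R : realType) (I : Type) (P : (I -> R) -> R) : Prop :=
  PositiveFunctional {
  pfD : forall f g, bounded_fct f -> bounded_fct g ->
    P (fun x => f x + g x) = P f + P g;
  pfZ : forall c f, bounded_fct f -> P (fun x => c * f x) = c * P f;
  pf_cst : forall c, P (fun=> c) = c;
  pf_le : forall f g, bounded_fct f -> bounded_fct g ->
    (forall x, f x <= g x) -> P f <= P g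
}.

Section PositiveFunctional.
Variables (R : realType) (I : Type) (P : (I -> R) -> R).
Hypothesis PP : positive_functional P.

Lemma pfN f : bounded_fct f -> P (fun x => - f x) = - P f.
Proof.
move=> bf; rewrite -mulN1r -(pfZ PP)//.
by congr P; apply/funext => x; rewrite mulN1r.
Qed.

Lemma pfB f g : bounded_fct f -> bounded_fct g ->
  P (fun x => f x - g x) = P f - P g.
Proof. by move=> bf bg; rewrite (pfD PP)// ?pfN//; exact: boundedN. Qed.

Lemma pf_sum (J : Type) (s : seq J) (F : J -> I -> R) :
  (forall j, bounded_fct (F j)) ->
  P (fun x => \sum_(j <- s) F j x) = \sum_(j <- s) P (F j).
Proof.
move=> bF; elim: s => [|j s ih].
  by rewrite big_nil -[RHS](pf_cst PP); congr P; apply/funext => x; rewrite big_nil.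
rewrite big_cons -ih -(pfD PP)//; last exact: bounded_sum.
by congr P; apply/funext => x; rewrite big_cons.
Qed.

Lemma pf_ge0 f : bounded_fct f -> (forall x, 0 <= f x) -> 0 <= P f.
Proof. by move=> bf f0; rewrite -(pf_cst PP 0) (pf_le PP)//; exact: bounded_cst. Qed.

Lemma pf_norm f e : (forall x, `|f x| <= e) -> `|P f| <= e.
Proof.
move=> fe; have bf : bounded_fct f by exists e.
rewrite ler_norml -{1}(pf_cst PP (- e)) -{2}(pf_cst PP e).
by rewrite !(pf_le PP)//; try exact: bounded_cst;
  move=> x; have := fe x; rewrite ler_norml => /andP[].
Qed.

Lemma pf_sqr_lin f g t : bounded_fct f -> bounded_fct g ->
  P (fun x => (f x - t * g x) ^+ 2) =
  P (fun x => f x ^+ 2) - 2 * t * P (fun x => f x * g x)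
  + t ^+ 2 * P (fun x => g x ^+ 2).
Proof.
move=> bf bg; have bfg := boundedM bf bg.
have bz c h : bounded_fct h -> bounded_fct (fun x : I => c * h x).
  by move=> bh; apply: boundedM => //; exact: bounded_cst.
have b1 := boundedX 2 bf; have b2 := boundedX 2 bg.
rewrite -!(pfZ PP)// -pfB//; last exact: bz.
rewrite -(pfD PP)//; [|by apply: boundedB => //; exact: bz|exact: bz].
by congr P; apply/funext => x; ring.
Qed.

Lemma cauchy_schwarz f g : bounded_fct f -> bounded_fct g ->
  P (fun x => f x * g x) ^+ 2 <= P (fun x => f x ^+ 2) * P (fun x => g x ^+ 2).
Proof.
move=> bf bg.
have pos t : 0 <= P (fun x => f x ^+ 2) - 2 * t * P (fun x => f x * g x)
    + t ^+ 2 * P (fun x => g x ^+ 2).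
  rewrite -pf_sqr_lin//; apply: pf_ge0 => [|x]; last exact: sqr_ge0.
  by apply: boundedX; apply: boundedB => //; apply: boundedM => //; exact: bounded_cst.
have g0 : 0 <= P (fun x => g x ^+ 2).
  by apply: pf_ge0 => [|x]; [exact: boundedX|exact: sqr_ge0].
move: pos g0; set a := P _; set b := P _; set c := P _ => pos g0.
have [c0|c0] := eqVneq c 0.
  rewrite c0 mulr0; have := pos ((a + 1) / 2 / b); rewrite c0 mulr0 addr0.
  have [->|b0] := eqVneq b 0; first by rewrite expr0n.
  have -> : 2 * ((a + 1) / 2 / b) * b = a + 1 by field.
  by rewrite opprD addrA subrr add0r oppr_ge0 leNgt ltr01.
have cp : 0 < c by rewrite lt_def c0.
have := pos (b / c).
have -> : a - 2 * (b / c) * b + (b / c) ^+ 2 * c = (a * c - b ^+ 2) / c by field.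
by rewrite pmulr_lge0 ?invr_gt0// subr_ge0.
Qed.

End PositiveFunctional.

(** * Limits of bounded functions along ultrafilters *)

Section Ultralimit.
Variables (R : realType) (I : Type).

(** Along an ultrafilter refining [F], a bounded function has a cluster value in a compact segment,
    and an ultrafilter converges to its cluster points. Multiplicativity is what lets mean squares
    pass to the limit. *)
Lemma ultralimit_exists (F : set_system I) : ProperFilter F ->
  exists L : (I -> R) -> R,
  [/\ positive_functional L,
      forall f g, bounded_fct f -> bounded_fct g ->
        L (fun i => f i * g i) = L f * L g &
      forall f g, bounded_fct f -> bounded_fct g ->
        F [set i | f i <= g i] -> L f <= L g].
Proof.
move=> PF; have [G [UG FG]] := ultraFilterLemma PF.
pose L (f : I -> R) : R := lim (f @ G).
have PG : ProperFilter G := @ultra_proper _ _ UG.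
have cvL (f : I -> R) : bounded_fct f -> f @ G --> L f.
  move=> [B fB]; apply/cvg_ex.
  have fG : (f @ G) [set` `[- B, B]].
    apply: (@filterS _ G _ setT); last exact: filterT.
    by move=> i _ /=; rewrite in_itv/= -ler_norml; exact: fB.
  have [l [_ cl]] := @segment_compact R (- B) B (f @ G) _ fG.
  exists l; move=> U Ul.
  have [//|GU] := in_ultra_setVsetC (f @^-1` U) UG.
  have [y [/=]] := cl (~` U) U GU Ul.
  by [].
have LM f g : bounded_fct f -> bounded_fct g ->
    L (fun i => f i * g i) = L f * L g.
  by move=> bf bg; apply/cvg_lim => //; apply: cvgM; exact: cvL.
have Lc c : L (fun=> c) = c by exact: lim_cst.
have Lle f g : bounded_fct f -> bounded_fct g ->
    F [set i | f i <= g i] -> L f <= L g.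
  move=> bf bg /FG fg; rewrite -subr_ge0.
  apply: (cvgr_to_ge (cvgB (cvL _ bg) (cvL _ bf))).
  by apply: filterS fg => i /=; rewrite subr_ge0.
exists L; split=> //; split=> //.
- by move=> f g bf bg; apply/cvg_lim => //; apply: cvgD; exact: cvL.
- by move=> c f bf; rewrite LM ?Lc//; exact: bounded_cst.
- by move=> f g bf bg fg; apply: Lle => //; apply: filterS filterT => i _; exact: fg.
Qed.

End Ultralimit.

Section ListFilter.
Variable I : eqType.

(** Finite lists directed by inclusion. A limit along this filter sees every element eventually, and
    as parameter filter in near-covering compactness it collects finite subcovers. *)
Definition list_filter : set_system (seq I) :=
  [set S : set (seq I) | exists s0 : seq I, forall s : seq I, {subset s0 <= s} -> S s].

Lemma list_filter_proper : ProperFilter list_filter.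
Proof.
split; first by case=> s0 /(_ s0); exact.
split.
- by exists [::].
- move=> S T [s hs] [t ht]; exists (s ++ t) => u stu; split.
    by apply: hs => x xs; apply: stu; rewrite mem_cat xs.
  by apply: ht => x xs; apply: stu; rewrite mem_cat xs orbT.
- by move=> S T ST [s hs]; exists s => u /hs/ST.
Qed.

Lemma list_filter_mem x : list_filter [set s : seq I | x \in s].
Proof. by exists [:: x] => s; apply; rewrite inE. Qed.

End ListFilter.
#[global] Hint Extern 0 (ProperFilter (@list_filter _)) =>
  solve[apply: list_filter_proper] : typeclass_instances.

(** * Invariant mean as a limit of box averages *)

Section Mean.
Variables (R : realType) (A : zmodType).

Record is_mean (M : (A -> R) -> R) : Prop := IsMean {
  mean_pf : positive_functional M;
  mean_shift : forall f a, bounded_fct f -> M (fun x => f (x + a)) = M f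
}.

(** Iterating these averages over a list gives averages over boxes of integer combinations, which
    are asymptotically invariant in an abelian group. *)
Definition progression_avg N (a : A) (f : A -> R) : A -> R :=
  fun x => N.+1%:R^-1 * \sum_(n < N.+1) f (x + a *+ n).

Definition box_avg N (s : seq A) (f : A -> R) : R :=
  foldr (progression_avg N) f s 0.

Let avgD N a f g x : progression_avg N a (fun x => f x + g x) x =
  progression_avg N a f x + progression_avg N a g x.
Proof. by rewrite /progression_avg big_split mulrDr. Qed.

Let avgZ N a c f x : progression_avg N a (fun x => c * f x) x =
  c * progression_avg N a f x.
Proof. by rewrite /progression_avg -mulr_sumr mulrCA. Qed.

Let avg_shift N a b f x : progression_avg N a (fun x => f (x + b)) x =
  progression_avg N a f (x + b).
Proof. by rewrite /progression_avg; under eq_bigr do rewrite addrAC. Qed.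

Let avg_le N a f g B C : (forall x, B * f x <= C * g x) ->
  forall x, B * progression_avg N a f x <= C * progression_avg N a g x.
Proof.
move=> fg x; rewrite /progression_avg mulrCA [leRHS]mulrCA ler_pM2l ?invr_gt0//.
by rewrite !mulr_sumr ler_sum.
Qed.

Let avg_cst N a c x : progression_avg N a (fun=> c) x = c.
Proof.
rewrite /progression_avg sumr_const card_ord -[c *+ _]mulr_natl mulrA.
by rewrite mulVf ?mul1r ?pnatr_eq0.
Qed.

Lemma box_avgD N s f g :
  box_avg N s (fun x => f x + g x) = box_avg N s f + box_avg N s g.
Proof.
rewrite /box_avg; move: 0; elim: s => //= a s ih x.
by rewrite -avgD; congr (progression_avg _ _ _ _); apply/funext.
Qed.

Lemma box_avgZ N s c f : box_avg N s (fun x => c * f x) = c * box_avg N s f.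
Proof.
rewrite /box_avg; move: 0; elim: s => //= a s ih x.
by rewrite -avgZ; congr (progression_avg _ _ _ _); apply/funext.
Qed.

Lemma box_avg_cst N s c : box_avg N s (fun=> c) = c.
Proof.
rewrite /box_avg; move: 0; elim: s => //= a s ih x.
by rewrite -[RHS](avg_cst N a c x); congr (progression_avg _ _ _ _); apply/funext.
Qed.

Lemma box_avg_le N s f g : (forall x, f x <= g x) -> box_avg N s f <= box_avg N s g.
Proof.
move=> fg; rewrite /box_avg; move: 0; elim: s => //= a s ih x.
rewrite -[leLHS]mul1r -[leRHS]mul1r; apply: avg_le => y.
by rewrite !mul1r.
Qed.

Lemma box_avg_norm N s f B : (forall x, `|f x| <= B) -> `|box_avg N s f| <= B.
Proof.
move=> fB; rewrite ler_norml -{1}(box_avg_cst N s (- B)) -{2}(box_avg_cst N s B).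
by rewrite !box_avg_le// => x; have := fB x; rewrite ler_norml => /andP[].
Qed.

(** In the direction [a] the difference telescopes to two boundary terms out of [N.+1]; averaging in
    the other directions commutes with translation and does not enlarge it. *)
Lemma box_avg_shift N s f a B : a \in s -> (forall x, `|f x| <= B) ->
  `|box_avg N s (fun x => f (x + a)) - box_avg N s f| <= 2 * B / N.+1%:R.
Proof.
move=> ainS fB.
have shiftE t b : foldr (progression_avg N) (fun x => f (x + b)) t =
    (fun x => foldr (progression_avg N) f t (x + b)).
  by elim: t => //= c t ->; apply/funext => x; rewrite avg_shift.
have bnd t x : `|foldr (progression_avg N) f t x| <= B.
  elim: t x => //= b t ih x.
  rewrite /progression_avg normrM ger0_norm ?invr_ge0// mulrC ler_pdivrMr//.
  rewrite (le_trans (ler_norm_sum _ _ _))//.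
  rewrite (le_trans (ler_sum _ (fun i _ => ih _)))//.
  by rewrite sumr_const card_ord mulr_natr.
rewrite /box_avg shiftE; move: 0; elim: s ainS => //= b s ih.
rewrite inE => /orP[/eqP <-|ains] x.
  rewrite /progression_avg -mulrBr -sumrB normrM ger0_norm ?invr_ge0//.
  rewrite mulrC ler_pM2r ?invr_gt0//.
  set g := foldr _ _ _.
  rewrite (eq_bigr (fun n : 'I_N.+1 => g (x + a *+ n.+1) - g (x + a *+ n))); last first.
    by move=> n _; rewrite -addrA -mulrS.
  rewrite -(big_mkord xpredT (fun n => g (x + a *+ n.+1) - g (x + a *+ n))).
  rewrite telescope_sumr// (le_trans (ler_normB _ _))//.
  rewrite mulr2n mulrDl mul1r; apply: lerD; exact: bnd.
rewrite /progression_avg -mulrBr -sumrB normrM ger0_norm ?invr_ge0//.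
rewrite mulrC ler_pdivrMr// (le_trans (ler_norm_sum _ _ _))//.
rewrite (eq_bigr (fun n : 'I_N.+1 => `|foldr (progression_avg N) f s (x + b *+ n + a)
   - foldr (progression_avg N) f s (x + b *+ n)|)); last first.
  by move=> n _; rewrite addrAC.
rewrite (le_trans (ler_sum _ (fun i _ => ih ains _)))//.
by rewrite sumr_const card_ord mulr_natr.
Qed.

Lemma mean_exists : exists M, is_mean M.
Proof.
(* Boxes whose list of directions absorbs every element while the side length tends to infinity. *)
pose F : set_system (seq A * nat) :=
  filter_prod (@list_filter A) (nbhs (\oo : set_system nat)).
have PF : ProperFilter F by exact: filter_prod_proper.
have [L [PL LM Lle]] := ultralimit_exists R PF.
exists (fun f => L (fun i => box_avg i.2 i.1 f)).
have bnd f : bounded_fct f -> bounded_fct (fun i : seq A * nat => box_avg i.2 i.1 f).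
  by move=> [B fB]; exists B => i; exact: box_avg_norm.
split; first split.
- move=> f g bf bg; rewrite -(pfD PL); [|exact: bnd..].
  by congr L; apply/funext => i; exact: box_avgD.
- move=> c f bf; rewrite -(pfZ PL); last exact: bnd.
  by congr L; apply/funext => i; exact: box_avgZ.
- move=> c; rewrite -[RHS](pf_cst PL); congr L; apply/funext => i; exact: box_avg_cst.
- move=> f g bf bg fg; apply: (pf_le PL); [exact: bnd..|].
  by move=> i; exact: box_avg_le.
move=> f a bf; have [B fB] := bf.
have bfa : bounded_fct (fun x => f (x + a)) by exists B.
apply/eqP; rewrite -subr_eq0 -normr_le0; apply/ler_addgt0Pr => e e0.
rewrite add0r.
have Fe : F [set i | `|box_avg i.2 i.1 (fun x => f (x + a)) - box_avg i.2 i.1 f| <= e].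
  exists ([set s : seq A | a \in s], [set n | 2 * B / n.+1%:R <= e]).
    split; first exact: list_filter_mem.
    near=> n => /=; rewrite ler_pdivrMr// [leRHS]mulrC -ler_pdivrMr//.
    have nn : n%:R <= n.+1%:R :> R by rewrite ler_nat.
    rewrite (le_trans _ nn)//.
    by near: n; exact: nbhs_infty_ger.
  move=> [s n] [/= sa nB]; exact: le_trans (box_avg_shift n sa fB) nB.
rewrite -(pfB PL); [|exact: bnd..].
rewrite ler_norml -{1}(pf_cst PL (- e)) -{2}(pf_cst PL e).
have bb : bounded_fct (fun i : seq A * nat =>
    box_avg i.2 i.1 (fun x => f (x + a)) - box_avg i.2 i.1 f).
  by apply: boundedB; exact: bnd.
apply/andP; split; apply: Lle => //; try exact: bounded_cst.
- by apply: filterS Fe => i /=; rewrite ler_norml => /andP[].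
- by apply: filterS Fe => i /=; rewrite ler_norml => /andP[].
Unshelve. all: by end_near.
Qed.

End Mean.

(** * Equicontinuous families and exchange of limits with the mean *)

Section Equicontinuity.
Variables (R : realType) (A : topologicalZmodType).

(** Uniformity is over the index and over the base point, so that one neighbourhood of 0 serves the
    whole family. *)
Definition equicont (I : Type) (g : I -> A -> R) :=
  (exists B, forall i x, `|g i x| <= B) /\
  forall e, 0 < e -> \forall u \near (0 : A), forall i x, `|g i (x + u) - g i x| <= e.

Definition ucont (f : A -> R) := equicont (fun _ : unit => f).

Lemma equicont_bounded I (g : I -> A -> R) i : equicont g -> bounded_fct (g i).
Proof. by move=> [[B gB] _]; exists B. Qed.

Lemma ucont_bounded f : ucont f -> bounded_fct f.
Proof. exact: (equicont_bounded tt). Qed.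

Lemma equicont_boundedl I (g : I -> A -> R) x : equicont g -> bounded_fct (g ^~ x).
Proof. by move=> [[B gB] _]; exists B. Qed.

Lemma equicont_comp I J (g : I -> A -> R) (h : J -> I) :
  equicont g -> equicont (fun j => g (h j)).
Proof.
move=> [[B gB] gc]; split; first by exists B.
by move=> e e0; apply: filterS (gc e e0) => u hu j x.
Qed.

Lemma ucont_equicont I (f : A -> R) : ucont f -> equicont (fun _ : I => f).
Proof. exact: (@equicont_comp _ I (fun _ : unit => f) (fun=> tt)). Qed.

Lemma equicont_cst I (h : I -> R) : bounded_fct h -> equicont (fun i _ => h i).
Proof.
move=> [B hB]; split; first by exists B.
by move=> e e0; near=> u => i x; rewrite subrr normr0 ltW.
Unshelve. all: by end_near. Qed.

Lemma equicontD I (f g : I -> A -> R) :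
  equicont f -> equicont g -> equicont (fun i x => f i x + g i x).
Proof.
move=> [[B fB] fc] [[C gC] gc]; split.
  by exists (B + C) => i x; rewrite (le_trans (ler_normD _ _))// lerD.
move=> e e0; have e2 : 0 < e / 2 by rewrite divr_gt0.
apply: filterS2 (fc _ e2) (gc _ e2) => u fu gu i x.
rewrite opprD addrACA (le_trans (ler_normD _ _))//.
by rewrite [leRHS]splitr lerD.
Qed.

Lemma equicontM I (f g : I -> A -> R) :
  equicont f -> equicont g -> equicont (fun i x => f i x * g i x).
Proof.
move=> [[B fB] fc] [[C gC] gc]; split.
  by exists (B * C) => i x; rewrite normrM ler_pM.
move=> e e0; pose D := `|B| + `|C| + 1.
have D0 : 0 < D by rewrite ltr_wpDl// addr_ge0.
have eD : 0 < e / 2 / D by rewrite !divr_gt0.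
apply: filterS2 (fc _ eD) (gc _ eD) => u fu gu i x.
have -> : f i (x + u) * g i (x + u) - f i x * g i x =
  f i (x + u) * (g i (x + u) - g i x) + (f i (x + u) - f i x) * g i x by ring.
rewrite (le_trans (ler_normD _ _))// !normrM [leRHS]splitr.
have eE : e / 2 = D * (e / 2 / D) by rewrite [RHS]mulrC divfK// gt_eqF.
apply: lerD; rewrite eE; last rewrite mulrC.
  apply: ler_pM => //; rewrite (le_trans (fB _ _))// /D (le_trans (ler_norm _))//.
  by rewrite -addrA lerDl addr_ge0.
apply: ler_pM => //; rewrite (le_trans (gC _ _))// /D (le_trans (ler_norm _))//.
by rewrite addrAC lerDr addr_ge0.
Qed.

Lemma equicontN I (f : I -> A -> R) : equicont f -> equicont (fun i x => - f i x).
Proof.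
move=> [[B fB] fc]; split; first by exists B => i x; rewrite normrN.
by move=> e e0; apply: filterS (fc e e0) => u fu i x; rewrite -opprD normrN.
Qed.

Lemma equicontB I (f g : I -> A -> R) :
  equicont f -> equicont g -> equicont (fun i x => f i x - g i x).
Proof. by move=> ef eg; apply: equicontD => //; exact: equicontN. Qed.

Lemma equicontZ I c (f : I -> A -> R) :
  equicont f -> equicont (fun i x => c * f i x).
Proof. by move=> ef; apply: equicontM => //; apply: equicont_cst; exact: bounded_cst. Qed.

Lemma equicontX I n (f : I -> A -> R) :
  equicont f -> equicont (fun i x => f i x ^+ n).
Proof.
move=> ef; elim: n => [|n ih].
  have := @equicont_cst I (fun=> 1) (@bounded_cst R I 1).
  by congr equicont; apply/funext => i; apply/funext => x; rewrite expr0.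
have := equicontM ef ih; congr equicont; apply/funext => i; apply/funext => x.
by rewrite exprS.
Qed.

Lemma equicont_shift I (f : I -> A -> R) :
  equicont f -> equicont (fun (p : I * A) x => f p.1 (x + p.2)).
Proof.
move=> [[B fB] fc]; split; first by exists B.
move=> e e0; apply: filterS (fc e e0) => u fu [i a] x /=.
by rewrite addrAC; exact: fu.
Qed.

Lemma near0N (P : A -> Prop) :
  (\forall u \near (0 : A), P u) -> \forall u \near (0 : A), P (- u).
Proof.
move=> nP; have /(_ P) := @opp_continuous A 0; rewrite /= oppr0; exact.
Qed.

Lemma equicont_opp I (f : I -> A -> R) :
  equicont f -> equicont (fun i x => f i (- x)).
Proof.
move=> [[B fB] fc]; split; first by exists B.
move=> e e0; apply: filterS (near0N (fc e e0)) => u fu i x /=.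
by rewrite opprD; exact: fu.
Qed.

Lemma ucont_shift f a : ucont f -> ucont (fun x => f (x + a)).
Proof.
move=> /equicont_shift cf; exact: (@equicont_comp _ unit _ (fun=> (tt, a)) cf).
Qed.

Lemma addl_continuous (a : A) : continuous (fun x => a + x).
Proof.
move=> x; apply: (@continuous_comp _ _ _ (fun x => (a, x)) (fun x : A * A => x.1 + x.2)).
  by apply: cvg_pair => /=; [exact: cvg_cst|exact: cvg_id].
exact: add_continuous.
Qed.

Lemma near_subr (P : A -> Prop) x : (\forall u \near (0 : A), P u) ->
  \forall y \near x, P (y - x).
Proof.
move=> nP; have h : nbhs x (fun y => P (- x + y)).
  by apply: (@addl_continuous (- x) x); rewrite /= addNr.
by apply: filterS h => y /=; rewrite addrC.
Qed.

Lemma ucont_continuous f : ucont f -> continuous f.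
Proof.
move=> [_ fc] x; apply/cvgrPdist_le => e e0.
have := near_subr x (fc e e0); apply: filterS => y /= /(_ tt x).
by rewrite [x + _]addrC subrK distrC.
Qed.

Hypothesis compactA : compact [set: A].

(** Compactness in near-covering form is used with two parameter filters: at infinity for
    boundedness, and at 0 in [A] for uniform continuity. *)
Lemma continuous_ucont f : continuous f -> ucont f.
Proof.
move=> fc.
have nc := (compact_near_coveringP [set: A]).1 compactA.
split.
  have := nc nat \oo (fun n x => `|f x| <= n%:R) _ _; case=> [x _|N _ /(_ N (leqnn N)) hN].
    pose B := `|f x| + 1.
    exists ([set y | `|f y| <= B], [set n | B <= n%:R]).
      split; last exact: nbhs_infty_ger.
      have := fc x => /cvgrPdist_le /(_ 1 ltr01); apply: filterS => y /= h.
      rewrite /B -lerBlDl (le_trans _ h)// distrC (le_trans _ (lerB_dist _ _))//.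
    by move=> [y n] [/= yB nB]; exact: le_trans nB.
  by exists N%:R => _ x; exact: hN.
move=> e e0.
have : forall x, [set: A] x -> \forall y \near x & u \near (0 : A),
    `|f (y + u) - f y| <= e.
  move=> x _.
  have e2 : 0 < e / 2 by rewrite divr_gt0.
  pose W := [set y | `|f x - f y| <= e / 2].
  have xW : nbhs x W by have := fc x => /cvgrPdist_le /(_ _ e2).
  have addW : \forall p \near (x, 0 : A), W (p.1 + p.2).
    by apply: (@add_continuous A (x, 0)); rewrite /= addr0.
  have fstW : \forall p \near (x, 0 : A), W p.1.
    by exists (W, setT) => [|[y u] []//]; split => //; exact: filterT.
  apply: filterS2 addW fstW => -[y u] /= h1 h2.
  have -> : f (y + u) - f y = (f x - f y) - (f x - f (y + u)) by ring.
  by rewrite (le_trans (ler_normB _ _))// [leRHS]splitr lerD.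
move=> /(nc A (nbhs (0 : A)) (fun u x => `|f (x + u) - f x| <= e) _).
by apply: filterS => u hu _ x; exact: hu.
Qed.

Lemma nbhs_cover (U : set A) : nbhs 0 U ->
  exists s : seq A, forall x, exists2 y, y \in s & U (x - y).
Proof.
move=> U0.
have nc := (compact_near_coveringP [set: A]).1 compactA.
have := nc (seq A) (@list_filter A) (fun s x => exists2 y, y \in s & U (x - y)) _ _.
case=> [x _|s /(_ s) hs]; last by exists s => x; exact: hs.
exists ([set y | U (y - x)], [set s : seq A | x \in s]).
  by split; [exact: near_subr|exact: list_filter_mem].
by move=> [y s] [/= Uyx xs]; exists x.
Qed.

Variable M : (A -> R) -> R.
Hypothesis MM : is_mean M.
Let PM := mean_pf MM.

(** Nodes and weights depend on [U] only, so the formula applies to a whole equicontinuous family.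
    The weights are the means of the pieces of a finite partition subordinate to translates of
    [U]. *)
Lemma mean_quadrature (U : set A) : nbhs 0 U ->
  exists s : seq (R * A), forall g e, bounded_fct g ->
    (forall x u, U u -> `|g (x + u) - g x| <= e) ->
    `|M g - \sum_(p <- s) p.1 * g p.2| <= e.
Proof.
move=> /nbhs_cover[s hs].
(* Taking the first suitable translate turns the cover into a partition. *)
pose idx (x : A) := find (fun y => `[< U (x - y) >]) s.
have idxP x : (idx x < size s)%N /\ U (x - nth 0 s (idx x)).
  have hx : has (fun y => `[< U (x - y) >]) s.
    by apply/hasP; have [y ys Uxy] := hs x; exists y => //; exact/asboolP.
  by split; [rewrite -has_find|exact/asboolP/(nth_find 0 hx)].
exists [seq (M (fun x => (idx x == j)%:R), nth 0 s j) | j <- iota 0 (size s)].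
move=> g e bg ge; rewrite big_map /=.
have b1 j : bounded_fct (fun x => (idx x == j)%:R : R).
  by exists 1 => x; case: (_ == _); rewrite ?normr1 ?normr0.
have -> : \sum_(j <- iota 0 (size s)) M (fun x => (idx x == j)%:R) * g (nth 0 s j) =
    M (fun x => g (nth 0 s (idx x))).
  under eq_bigr do rewrite mulrC -(pfZ PM)//.
  rewrite -(pf_sum PM)//; last by move=> j; apply: boundedM => //; exact: bounded_cst.
  congr M; apply/funext => x.
  have [lt_idx _] := idxP x.
  rewrite (bigD1_seq (idx x)) ?mem_iota ?iota_uniq//= eqxx mulr1 big1 ?addr0//.
  by move=> j jx; rewrite eq_sym (negbTE jx) mulr0.
have bg' : bounded_fct (fun x => g (nth 0 s (idx x))).
  by have [B gB] := bg; exists B.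
rewrite -(pfB PM)//; apply: (pf_norm PM) => x.
have [_ Ux] := idxP x.
by have := ge (nth 0 s (idx x)) _ Ux; rewrite [nth 0 s _ + _]addrC subrK.
Qed.

(** Finitely many translates of [f] add up to at least [c] everywhere, and all of them have the mean
    of [f]. *)
Lemma mean_gt0 (f : A -> R) x0 c : bounded_fct f -> (forall x, 0 <= f x) -> 0 < c ->
  (\forall u \near (0 : A), c <= f (x0 + u)) -> 0 < M f.
Proof.
move=> bf f0 c0 /nbhs_cover[s hs].
have bs a : bounded_fct (fun x => f (x + a)) by have [B fB] := bf; exists B.
have : c <= \sum_(y <- s) M (fun x => f (x + (x0 - y))).
  rewrite -(pf_sum PM)// -{1}(pf_cst PM c); apply: (pf_le PM).
  - exact: bounded_cst.
  - exact: bounded_sum.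
  - move=> x; have [y ys cxy] := hs x.
    rewrite (le_trans cxy)// (_ : x0 + (x - y) = x + (x0 - y)); last by rewrite addrCA.
    by rewrite (big_rem y ys)/= lerDl sumr_ge0.
under eq_bigr do rewrite (mean_shift MM)//.
move=> h; rewrite lt_def (pf_ge0 PM)// andbT; apply/eqP => Mf0.
by move: h; rewrite Mf0 big1// leNgt c0.
Qed.

Lemma mean_sqr_eq0 (f : A -> R) : ucont f -> M (fun x => f x ^+ 2) = 0 ->
  forall x, f x = 0.
Proof.
move=> uf Mf0 x; apply/eqP; apply: contra_eqT Mf0 => fx.
rewrite gt_eqF//; have := equicontX 2 uf => uf2.
have fx2 : 0 < f x ^+ 2 / 2 by rewrite divr_gt0// exprn_even_gt0.
apply: (@mean_gt0 _ x _ _ _ fx2).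
- exact: (ucont_bounded uf2).
- by move=> y; exact: sqr_ge0.
- have [_ /(_ _ fx2)] := uf2; apply: filterS => u /(_ tt x).
  rewrite ler_norml => /andP[h _]; lra.
Qed.

Lemma equicont_mean (I : Type) (F : I * A -> A -> R) : equicont F ->
  equicont (fun i x => M (fun y => F (i, y) x)).
Proof.
move=> [[B FB] Fc]; split; first by exists B => i x; exact: (pf_norm PM).
have bF i x : bounded_fct (fun y => F (i, y) x) by exists B.
move=> e e0; apply: filterS (Fc e e0) => u hu i x.
by rewrite -(pfB PM)//; exact: (pf_norm PM).
Qed.

(** Equicontinuity in the second variable, uniform in the first, lets one quadrature sum approximate
    both iterated means. *)
Lemma mean_fubini (F : A -> A -> R) : equicont F ->
  M (fun x => M (fun y => F x y)) = M (fun y => M (fun x => F x y)).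
Proof.
move=> eF; have [[B FB] Fc] := eF; apply/eqP; rewrite -subr_eq0 -normr_le0.
apply/ler_addgt0Pr => e e0; rewrite add0r.
have e2 : 0 < e / 2 by rewrite divr_gt0.
have [s hs] := mean_quadrature (Fc _ e2).
have bl y : bounded_fct (F ^~ y) by exists B.
have br x : bounded_fct (F x) by exists B.
have bM : bounded_fct (fun x => M (F x)) by exists B => x; exact: (pf_norm PM).
have bMl : bounded_fct (fun y => M (F ^~ y)) by exists B => y; exact: (pf_norm PM).
have bsum : bounded_fct (fun x => \sum_(p <- s) p.1 * F x p.2).
  by apply: bounded_sum => p; apply: boundedM => //; exact: bounded_cst.
pose S := \sum_(p <- s) p.1 * M (F ^~ p.2).
have h1 : `|M (fun x => M (F x)) - S| <= e / 2.
  have -> : S = M (fun x => \sum_(p <- s) p.1 * F x p.2).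
    rewrite (pf_sum PM); last by move=> p; apply: boundedM => //; exact: bounded_cst.
    by apply: eq_bigr => p _; rewrite (pfZ PM).
  rewrite -(pfB PM)//; apply: (pf_norm PM) => x.
  by apply: hs => // y u; exact.
have h2 : `|M (fun y => M (F ^~ y)) - S| <= e / 2.
  apply: (hs (fun y => M (F ^~ y))) => // y u Uu.
  by rewrite -(pfB PM)//; apply: (pf_norm PM) => x; exact: Uu.
have -> : M (fun x => M (F x)) - M (fun y => M (F ^~ y)) =
  (M (fun x => M (F x)) - S) - (M (fun y => M (F ^~ y)) - S) by ring.
by rewrite (le_trans (ler_normB _ _))// [leRHS]splitr lerD.
Qed.

Section Limits.
Variable L : (nat -> R) -> R.
Hypothesis PL : positive_functional L.

Lemma equicont_limit (I : Type) (g : I * nat -> A -> R) : equicont g ->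
  equicont (fun i x => L (fun n => g (i, n) x)).
Proof.
move=> [[B gB] gc]; split; first by exists B => i x; exact: (pf_norm PL).
have bF i x : bounded_fct (fun n => g (i, n) x) by exists B.
move=> e e0; apply: filterS (gc e e0) => u hu i x.
by rewrite -(pfB PL)//; exact: (pf_norm PL).
Qed.

Lemma ucont_limit (g : nat -> A -> R) : equicont g -> ucont (fun x => L (g ^~ x)).
Proof. by move=> eg; exact: (@equicont_limit unit (fun p => g p.2) (equicont_comp _ eg)). Qed.

Lemma mean_limit (g : nat -> A -> R) : equicont g ->
  M (fun x => L (g ^~ x)) = L (fun n => M (g n)).
Proof.
move=> eg; have [[B gB] gc] := eg; apply/eqP; rewrite -subr_eq0 -normr_le0.
apply/ler_addgt0Pr => e e0; rewrite add0r.
have e2 : 0 < e / 2 by rewrite divr_gt0.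
have [s hs] := mean_quadrature (gc _ e2).
have bl x : bounded_fct (g ^~ x) by exists B.
have br n : bounded_fct (g n) by exists B.
have bM : bounded_fct (fun n => M (g n)) by exists B => n; exact: (pf_norm PM).
have bL : bounded_fct (fun x => L (g ^~ x)) by exists B => x; exact: (pf_norm PL).
have bsum : bounded_fct (fun n => \sum_(p <- s) p.1 * g n p.2).
  by apply: bounded_sum => p; apply: boundedM => //; exact: bounded_cst.
pose S := \sum_(p <- s) p.1 * L (g ^~ p.2).
have h1 : `|L (fun n => M (g n)) - S| <= e / 2.
  have -> : S = L (fun n => \sum_(p <- s) p.1 * g n p.2).
    rewrite (pf_sum PL); last by move=> p; apply: boundedM => //; exact: bounded_cst.
    by apply: eq_bigr => p _; rewrite (pfZ PL).
  rewrite -(pfB PL)//; apply: (pf_norm PL) => n.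
  by apply: hs => // y u; exact.
have h2 : `|M (fun x => L (g ^~ x)) - S| <= e / 2.
  apply: (hs (fun x => L (g ^~ x))) => // y u Uu.
  by rewrite -(pfB PL)//; apply: (pf_norm PL) => n; exact: Uu.
have -> : M (fun x => L (g ^~ x)) - L (fun n => M (g n)) =
  (M (fun x => L (g ^~ x)) - S) - (L (fun n => M (g n)) - S) by ring.
by rewrite (le_trans (ler_normB _ _))// [leRHS]splitr lerD.
Qed.

End Limits.

End Equicontinuity.

(** * D'Alembert functions *)

Section Convolution.
Variables (R : realType) (A : topologicalZmodType).
Hypothesis compactA : compact [set: A].
Variable M : (A -> R) -> R.
Hypothesis MM : is_mean M.
Let PM := mean_pf MM.
Variable k : A -> R.
Hypothesis (uk : ucont k) (k_even : forall x, k (- x) = k x).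

Definition conv (g : A -> R) (x : A) : R := M (fun y => k (x - y) * g y).

Let bk x : bounded_fct (fun y => k (x - y)).
Proof. by have [[B kB] _] := uk; exists B => y; exact: (kB tt). Qed.

Let bkg x g : bounded_fct g -> bounded_fct (fun y => k (x - y) * g y).
Proof. by move=> bg; exact: boundedM. Qed.

Lemma conv_equicont (I : Type) (g : I -> A -> R) :
  (exists B, forall i x, `|g i x| <= B) -> equicont (fun i => conv (g i)).
Proof.
move=> [B gB].
apply: (@equicont_mean _ _ _ MM I (fun p x => k (x - p.2) * g p.1 p.2)).
apply: equicontM.
  exact: (@equicont_comp _ _ _ _ _ (fun p : I * A => (tt, - p.2)) (equicont_shift uk)).
by apply: equicont_cst; exists B.
Qed.

Lemma conv_ucont g : bounded_fct g -> ucont (conv g).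
Proof. by move=> [B gB]; apply: (@conv_equicont unit (fun=> g)); exists B. Qed.

Lemma conv_bounded g : bounded_fct g -> bounded_fct (conv g).
Proof. by move=> bg; apply/ucont_bounded/conv_ucont. Qed.

Lemma convZ c g x : bounded_fct g -> conv (fun y => c * g y) x = c * conv g x.
Proof.
move=> bg; rewrite /conv -(pfZ PM); last exact: bkg.
by congr M; apply/funext => y; rewrite mulrCA.
Qed.

Lemma convD f g x : bounded_fct f -> bounded_fct g ->
  conv (fun y => f y + g y) x = conv f x + conv g x.
Proof.
move=> bf bg; rewrite /conv -(pfD PM); [|exact: bkg..].
by congr M; apply/funext => y; rewrite mulrDr.
Qed.

Lemma convB f g x : bounded_fct f -> bounded_fct g ->
  conv (fun y => f y - g y) x = conv f x - conv g x.
Proof.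
move=> bf bg; rewrite /conv -(pfB PM); [|exact: bkg..].
by congr M; apply/funext => y; rewrite mulrBr.
Qed.

Lemma conv_shift g a x : bounded_fct g -> conv (fun y => g (y + a)) x = conv g (x + a).
Proof.
move=> bg; rewrite /conv -[RHS](mean_shift MM a); last exact: bkg.
by congr M; apply/funext => y; rewrite opprD addrACA subrr addr0.
Qed.

(** Self-adjointness for the inner product of the mean, from evenness of [k] and exchange of
    means. *)
Lemma conv_sym f g : ucont f -> ucont g ->
  M (fun x => conv f x * g x) = M (fun x => f x * conv g x).
Proof.
move=> uf ug; have bf := ucont_bounded uf; have bg := ucont_bounded ug.
transitivity (M (fun x => M (fun y => k (y - x) * f y * g x))).
  congr M; apply/funext => x; rewrite mulrC -(pfZ PM); last exact: bkg.
  by congr M; apply/funext => y; rewrite -[k (y - x)]k_even opprB mulrC.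
rewrite (mean_fubini compactA MM).
  congr M; apply/funext => x; rewrite -(pfZ PM); last exact: bkg.
  by congr M; apply/funext => y; rewrite mulrAC mulrC.
apply: equicontM; last exact: equicont_cst.
apply: equicontM; last exact: ucont_equicont.
exact: (@equicont_comp _ _ _ _ _ (fun x : A => (tt, - x)) (equicont_shift uk)).
Qed.

Lemma conv_limit L (g : nat -> A -> R) x : positive_functional L -> equicont g ->
  conv (fun y => L (g ^~ y)) x = L (fun n => conv (g n) x).
Proof.
move=> PL eg; rewrite /conv -(mean_limit compactA MM PL).
  congr M; apply/funext => y; rewrite -(pfZ PL)//.
  exact: equicont_boundedl eg.
apply: equicontM => //; apply: ucont_equicont.
have := equicont_opp (ucont_shift x uk); congr equicont.
by apply/funext => _; apply/funext => y; rewrite addrC.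
Qed.

Definition corr (g h : A -> R) (x : A) := M (fun y => g (y + x) * h y).

(** Convolution commutes with translations, so the autocorrelation of an eigenfunction is again an
    eigenfunction, and it is positive definite. *)
Lemma conv_corr g h : ucont g -> ucont h -> conv (corr g h) = corr (conv g) h.
Proof.
move=> ug uh; have bg := ucont_bounded ug; have bh := ucont_bounded uh.
have bs y : bounded_fct (fun z => g (z + y)) by have [B gB] := bg; exists B.
apply/funext => x; rewrite /conv /corr.
transitivity (M (fun z => M (fun y => k (x - z) * (g (y + z) * h y)))).
  by congr M; apply/funext => z; rewrite (pfZ PM)//; exact: boundedM.
rewrite (mean_fubini compactA MM).
  congr M; apply/funext => y.
  have := conv_shift y x bg; rewrite [x + y]addrC -/(conv g (y + x)) => <-.
  rewrite mulrC /conv -(pfZ PM); last exact: bkg.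
  by congr M; apply/funext => z; rewrite [z + y]addrC; ring.
apply: equicontM.
  by apply: equicont_cst; exact: bk.
apply: equicontM; last exact: ucont_equicont.
exact: (@equicont_comp _ _ _ _ _ (fun x : A => (tt, x)) (equicont_shift ug)).
Qed.

Let Q (f : A -> R) := M (fun x => f x ^+ 2).

Let Q_ge0 f : bounded_fct f -> 0 <= Q f.
Proof. by move=> bf; apply: (pf_ge0 PM) => [|x]; [exact: boundedX|exact: sqr_ge0]. Qed.

Let QZ c f : bounded_fct f -> Q (fun x => c * f x) = c ^+ 2 * Q f.
Proof.
move=> bf; rewrite /Q -(pfZ PM); last exact: boundedX.
by congr M; apply/funext => x; rewrite exprMn.
Qed.

Let conv_sqr_le : exists B, forall g, bounded_fct g -> forall x, conv g x ^+ 2 <= B * Q g.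
Proof.
have [[B kB] _] := uk; exists (B ^+ 2) => g bg x.
rewrite (le_trans (cauchy_schwarz PM (bk x) bg))//.
rewrite ler_wpM2r ?Q_ge0// -(pf_cst PM (B ^+ 2)) (pf_le PM)//.
- exact: boundedX.
- exact: bounded_cst.
- by move=> y; rewrite -real_normK ?num_real// lerXn2r ?nnegrE ?(kB tt)// (le_trans _ (kB tt 0)).
Qed.

Lemma ler_normsqr (a b : R) : 0 <= b -> (`|a| <= b) = (a ^+ 2 <= b ^+ 2).
Proof. by move=> b0; rewrite -[a ^+ 2]real_normK ?num_real// ler_sqr ?nnegrE. Qed.

(** This stands in for compactness of the operator: by Cauchy-Schwarz, normalization in mean square
    already makes the images equicontinuous. *)
Let conv_equicont_sqr (I : Type) (g : I -> A -> R) :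
  (forall i, bounded_fct (g i)) -> (forall i, Q (g i) = 1) ->
  equicont (fun i => conv (g i)).
Proof.
move=> bg Qg; split.
  have [B KB] := conv_sqr_le; exists (`|B| + 1) => i x.
  rewrite ler_normsqr ?addr_ge0// (le_trans (KB _ (bg i) x))// Qg mulr1.
  by rewrite (le_trans (ler_norm _))//; have := normr_ge0 B; nra.
move=> e e0; have [_ /(_ _ e0)] := uk; apply: filterS => u hu i x.
have bd : bounded_fct (fun y => k (x + u - y) - k (x - y)) by exact: boundedB.
rewrite /conv -(pfB PM); [|exact: bkg..].
under eq_fun do rewrite -mulrBl.
rewrite (ler_normsqr _ (ltW e0)) (le_trans (cauchy_schwarz PM bd (bg i)))// -/(Q (g i)) Qg mulr1.
rewrite -(pf_cst PM (e ^+ 2)) (pf_le PM)//.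
- exact: boundedX.
- exact: bounded_cst.
- by move=> y; rewrite -(ler_normsqr _ (ltW e0)) addrAC; exact: (hu tt).
Qed.

Hypothesis k0 : k 0 != 0.

(** [lam] is the squared operator norm of [conv], and [h] is an ultralimit of the images of a
    maximizing sequence. The operator is applied twice because the norm of a self-adjoint operator
    may be attained at a negative eigenvalue. *)
Lemma conv_eigenfunction : exists lam h,
  [/\ 0 < lam, ucont h, 0 < Q h & forall x, conv (conv h) x = lam * h x].
Proof.
have [B KB] := conv_sqr_le.
pose S := [set r | exists g, [/\ ucont g, Q g = 1 & r = Q (conv g)]].
have QKB g : bounded_fct g -> Q (conv g) <= B * Q g.
  move=> bg; rewrite -(pf_cst PM (B * Q g)); apply: (pf_le PM).
  - by apply/boundedX/conv_bounded.
  - exact: bounded_cst.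
  - by move=> x; exact: KB.
have Sub r : S r -> r <= B.
  by move=> [g [ug Qg ->]]; rewrite -[B]mulr1 -Qg QKB//; exact: ucont_bounded.
pose lam := sup S.
have Q0 f : ucont f -> Q f = 0 -> forall x, f x = 0 by exact: (mean_sqr_eq0 compactA MM).
have normalise g : ucont g -> 0 < Q g ->
    exists2 g', ucont g' & Q g' = 1 /\ Q (conv g) = Q (conv g') * Q g.
  move=> ug Qg; exists (fun x => (Num.sqrt (Q g))^-1 * g x); first exact: equicontZ.
  have s2 : (Num.sqrt (Q g))^-1 ^+ 2 = (Q g)^-1 by rewrite exprVn sqr_sqrtr ?ltW.
  have bg := ucont_bounded ug.
  have -> : conv (fun x => (Num.sqrt (Q g))^-1 * g x) =
      (fun x => (Num.sqrt (Q g))^-1 * conv g x) by apply/funext => x; exact: convZ.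
  by rewrite !QZ ?s2//; [split; [|rewrite mulrC mulrA]; field; exact: lt0r_neq0|exact: conv_bounded].
have Qk : 0 < Q k.
  rewrite lt_def (Q_ge0 (ucont_bounded uk)) andbT; apply: contra k0 => /eqP Qk0.
  by apply/eqP; exact: Q0.
have S0 : S !=set0.
  by have [g ug [Qg _]] := normalise _ uk Qk; exists (Q (conv g)), g.
have hS : has_sup S by split=> //; exists B.
have lamP g : ucont g -> Q (conv g) <= lam * Q g.
  move=> ug; have bg := ucont_bounded ug.
  have [Qg0|Qg0] := eqVneq (Q g) 0.
    by rewrite Qg0 mulr0 (le_trans (QKB _ bg))// Qg0 mulr0.
  have Qg1 : 0 < Q g by rewrite lt_def Qg0 Q_ge0.
  have [g' ug' [Qg' ->]] := normalise _ ug Qg1.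
  rewrite ler_wpM2r ?Q_ge0//; apply: sup_upper_bound => //.
  by exists g'.
have lam0 : 0 < lam.
  have Kk : conv k 0 = Q k.
    by congr M; apply/funext => y; rewrite sub0r k_even.
  have uKk := conv_ucont (ucont_bounded uk).
  have QKk : 0 < Q (conv k).
    rewrite lt_def (Q_ge0 (ucont_bounded uKk)) andbT.
    apply/eqP => QKk0; have := Q0 _ uKk QKk0 0; rewrite Kk => Qk0.
    by rewrite Qk0 ltxx in Qk.
  have := lt_le_trans QKk (lamP _ uk); by rewrite pmulr_lgt0.
have /choice[g gP] : forall n : nat, exists f : A -> R,
    [/\ ucont f, Q f = 1 & lam - n.+1%:R^-1 <= Q (conv f)].
  move=> n.
  have n0 : 0 < (n.+1%:R^-1 : R) by rewrite invr_gt0.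
  have [r [f [uf Qf ->]] hr] := sup_adherent n0 hS.
  by exists f; split=> //; exact: ltW.
pose h n := conv (g n).
have ug n : ucont (g n) by have [] := gP n.
have bg n := ucont_bounded (ug n).
have uh n : ucont (h n) by exact: conv_ucont.
have bh n := ucont_bounded (uh n).
have eh : equicont h by apply: conv_equicont_sqr => // n; have [] := gP n.
have eKh : equicont (fun n => conv (h n)).
  by apply: conv_equicont; have [] := eh.
have eKKh : equicont (fun n => conv (conv (h n))).
  by apply: conv_equicont; have [] := eKh.
pose D n x := conv (conv (h n)) x - lam * h n x.
have eD : equicont D by apply: equicontB => //; exact: equicontZ.
have Qh n : lam - n.+1%:R^-1 <= Q (h n) by have [] := gP n.
(* [D n] is [conv d]. Expanding [Q d] by self-adjointness and using
   [Q (conv (h n)) <= lam * Q (h n)] bounds it by [lam * (lam - Q (h n))]; applying [conv] costs one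
   more factor [lam]. *)
have QD n : Q (D n) <= lam ^+ 2 / n.+1%:R.
  pose d x := conv (h n) x - lam * g n x.
  have uKh : ucont (conv (h n)) by exact: conv_ucont.
  have ud : ucont d by apply: equicontB => //; exact: (equicontZ lam (ug n)).
  have -> : D n = conv d.
    apply/funext => x; rewrite /D /d convB ?convZ//; first exact: conv_bounded.
    by apply: boundedM => //; exact: bounded_cst.
  rewrite (le_trans (lamP _ ud))// expr2 -mulrA ler_pM2l//.
  rewrite /Q /d (pf_sqr_lin PM)//; last exact: conv_bounded.
  rewrite (conv_sym (uh n) (ug n)) -/(h n) -/(Q (conv (h n))) -/(Q (g n)).
  have [_ -> _] := gP n; rewrite mulr1.
  have -> : M (fun x => h n x * h n x) = Q (h n).
    by congr M; apply/funext => x; rewrite expr2.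
  have := lamP _ (uh n); have := Qh n; rewrite -/(h n).
  move: (Q (h n)) (Q (conv (h n))) (n.+1%:R^-1 : R) => q1 q2 r h1 h2.
  have : 0 <= lam * (r - (lam - q1)) by apply: mulr_ge0; [exact: ltW|lra].
  nra.
have [L [PL LM Lle]] := ultralimit_exists R (@eventually_filter : ProperFilter \oo).
have LX f : bounded_fct f -> L (fun n => f n ^+ 2) = L f ^+ 2.
  by move=> bf; rewrite expr2 -LM.
pose hh x := L (h ^~ x).
have uhh : ucont hh by exact: (ucont_limit PL).
have bD n : bounded_fct (D n) := equicont_bounded n eD.
exists lam, hh; split=> //.
  have -> : Q hh = L (fun n => Q (h n)).
    rewrite -(mean_limit compactA MM PL (g := fun n x => h n x ^+ 2)); last exact: equicontX.
    by congr M; apply/funext => x; rewrite LX//; exact: (equicont_boundedl x eh).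
  (* The [Q (h n)] approach [lam] from below at worst, so the ultralimit does not vanish; [lam / 2]
     is a convenient lower bound. *)
  apply: (@lt_le_trans _ _ (lam / 2)); first by rewrite divr_gt0.
  rewrite -(pf_cst PL (lam / 2)); apply: Lle; first exact: bounded_cst.
    have := @equicont_mean _ _ _ MM nat (fun p x => h p.1 p.2 ^+ 2).
    have [[C hC] _] := equicontX 2 eh; exists C => n; exact: (pf_norm PM).
  near=> n => /=; apply: le_trans (Qh n).
  rewrite lerBrDr -lerBrDl (_ : lam - lam / 2 = lam / 2); last by field.
  near: n; have l2 : 0 < lam / 2 by rewrite divr_gt0.
  by apply: filterS (near_infty_natSinv_lt (PosNum l2)) => n /ltW.
move=> x; apply/eqP; rewrite -subr_eq0; apply/eqP.
have bKh y : bounded_fct (fun n => conv (h n) y) := equicont_boundedl y eKh.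
have bKKh y : bounded_fct (fun n => conv (conv (h n)) y) := equicont_boundedl y eKKh.
have bhl y : bounded_fct (fun n => h n y) := equicont_boundedl y eh.
have hhE y : conv (conv hh) y - lam * hh y = L (fun n => D n y).
  rewrite /D (pfB PL)//; last by apply: boundedM => //; exact: bounded_cst.
  rewrite (pfZ PL)// -/(hh y); congr (_ - _).
  rewrite -(conv_limit y PL)//; congr conv; apply/funext => z.
  exact: conv_limit.
have uE : ucont (fun y => conv (conv hh) y - lam * hh y).
  apply: equicontB; last exact: equicontZ.
  by apply/conv_ucont/conv_bounded/ucont_bounded.
apply: (Q0 _ uE); apply/eqP; rewrite eq_le Q_ge0 ?andbT; last exact: ucont_bounded.
have -> : Q (fun y => conv (conv hh) y - lam * hh y) = L (fun n => Q (D n)).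
  rewrite -(mean_limit compactA MM PL (g := fun n x => D n x ^+ 2)); last exact: equicontX.
  by congr M; apply/funext => y; rewrite hhE LX//; exact: (equicont_boundedl y eD).
apply/ler_addgt0Pr => e e0; rewrite add0r -(pf_cst PL e).
apply: Lle.
- have [[C hC] _] := equicontX 2 eD; exists C => n; exact: (pf_norm PM).
- exact: bounded_cst.
- have l2 : 0 < lam ^+ 2 by rewrite exprn_gt0.
  have l3 : 0 < e / lam ^+ 2 by rewrite divr_gt0.
  near=> n => /=; apply: le_trans (QD n) _.
  rewrite mulrC -ler_pdivlMr//.
  near: n; by apply: filterS (near_infty_natSinv_lt (PosNum l3)) => n /ltW.
Unshelve. all: by end_near.
Qed.

Definition positive_definite (phi : A -> R) := forall s : seq (R * A),
  0 <= \sum_(p <- s) \sum_(q <- s) p.1 * q.1 * phi (p.2 - q.2).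

Lemma positive_definite_le1 phi x : (forall x, phi (- x) = phi x) -> phi 0 = 1 ->
  positive_definite phi -> `|phi x| <= 1.
Proof.
move=> ev phi0 pd; have h1 := pd [:: (1, x); (1, 0)]; have h2 := pd [:: (1, x); (-1, 0)].
move: h1 h2; rewrite !big_cons !big_nil/= !subrr !subr0 !sub0r ev phi0.
by rewrite ler_norml => h1 h2; apply/andP; split; lra.
Qed.

(** After translation by [q.2] in each term, the quadratic form is the mean of a square. *)
Lemma positive_definite_corr h : ucont h -> positive_definite (corr h h).
Proof.
move=> uh s; have bh := ucont_bounded uh.
have bs y : bounded_fct (fun z => h (z + y)) by have [B hB] := bh; exists B.
have bp (p : R * A) : bounded_fct (fun y => p.1 * h (y + p.2)).
  by apply: boundedM => //; exact: bounded_cst.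
suff -> : \sum_(p <- s) \sum_(q <- s) p.1 * q.1 * corr h h (p.2 - q.2) =
    M (fun y => (\sum_(p <- s) p.1 * h (y + p.2)) ^+ 2).
  by apply: (pf_ge0 PM) => [|y]; [apply/boundedX/bounded_sum|exact: sqr_ge0].
transitivity (\sum_(p <- s) \sum_(q <- s) M (fun y => p.1 * h (y + p.2) * (q.1 * h (y + q.2)))).
  apply: eq_bigr => p _; apply: eq_bigr => q _; rewrite /corr.
  rewrite -(mean_shift MM q.2); last by apply: boundedM.
  rewrite -(pfZ PM); last by apply: boundedM; [have [B hB] := bh; exists B|].
  by congr M; apply/funext => y; rewrite -addrA [q.2 + _]addrC subrK; ring.
under eq_bigr => p _.
  rewrite -(pf_sum PM); last by move=> q; exact: boundedM.
  over.
rewrite -(pf_sum PM); last by move=> p; apply: bounded_sum => q; exact: boundedM.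
congr M; apply/funext => y; rewrite expr2 mulr_suml.
by apply: eq_bigr => p _; rewrite mulr_sumr.
Qed.

Lemma corr_even h x : ucont h -> corr h h (- x) = corr h h x.
Proof.
move=> uh; have bh := ucont_bounded uh.
rewrite /corr -(mean_shift MM x); last by apply: boundedM => //; have [B hB] := bh; exists B.
by congr M; apply/funext => y; rewrite addrK mulrC.
Qed.

Lemma corr_ucont h : ucont h -> ucont (corr h h).
Proof.
move=> uh; have bh := ucont_bounded uh.
apply: (@equicont_mean _ _ _ MM unit (fun p x => h (p.2 + x) * h p.2)).
apply: equicontM; last by apply: equicont_cst; have [B hB] := bh; exists B.
have := @equicont_comp _ _ _ _ _ (fun p : unit * A => (tt, p.2)) (equicont_shift uh).
by congr equicont; apply/funext => p; apply/funext => x /=; rewrite addrC.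
Qed.

(** For fixed positive [lam] this set is equicontinuous, closed under ultralimits and closed under
    the twists below: [Q] attains its maximum on it, and the maximizer can be perturbed inside
    it. *)
Definition spherical lam (phi : A -> R) :=
  [/\ ucont phi, phi 0 = 1, forall x, phi (- x) = phi x, positive_definite phi &
      forall x, conv (conv phi) x = lam * phi x].

Lemma spherical_exists : exists lam phi, 0 < lam /\ spherical lam phi.
Proof.
have [lam [h [lam0 uh Qh hE]]] := conv_eigenfunction.
have c0 : corr h h 0 = Q h.
  by congr M; apply/funext => y; rewrite addr0 expr2.
have ucor := corr_ucont uh; have bcor := ucont_bounded ucor.
exists lam, (fun x => (Q h)^-1 * corr h h x); split=> //; split.
- exact: equicontZ.
- by rewrite c0 mulVf// gt_eqF.
- by move=> x; rewrite corr_even.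
- move=> s; under eq_bigr do under eq_bigr do rewrite mulrCA.
  under eq_bigr do rewrite -mulr_sumr.
  rewrite -mulr_sumr mulr_ge0 ?invr_ge0 ?Q_ge0//; [exact: ucont_bounded|].
  exact: positive_definite_corr.
- move=> x; have -> : conv (fun x => (Q h)^-1 * corr h h x) = (fun x => (Q h)^-1 * conv (corr h h) x).
    by apply/funext => y; exact: convZ.
  rewrite convZ; last exact: conv_bounded.
  have ucKh := conv_ucont (ucont_bounded uh).
  rewrite mulrCA; congr (_ * _).
  rewrite (conv_corr uh uh) (conv_corr ucKh uh) /corr -(pfZ PM).
    by congr M; apply/funext => y; rewrite hE mulrA.
  by apply: boundedM; [have [B hB] := ucont_bounded uh; exists B|exact: ucont_bounded].
Qed.

(** The eigenvalue equation exhibits each [phi i] as [lam^-1] times an image of a uniformly bounded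
    family under [conv]. *)
Lemma spherical_equicont lam (I : Type) (phi : I -> A -> R) : 0 < lam ->
  (forall i, spherical lam (phi i)) -> equicont phi.
Proof.
move=> lam0 sphi.
have phi1 : exists B, forall i x, `|phi i x| <= B.
  exists 1 => i x; have [_ p0 pe pd _] := sphi i; exact: positive_definite_le1.
have e2 : equicont (fun i => conv (conv (phi i))).
  by apply: conv_equicont; have [] := conv_equicont phi1.
have := equicontZ lam^-1 e2; congr equicont.
apply/funext => i; apply/funext => x; have [_ _ _ _ ->] := sphi i.
by rewrite mulrA mulVf ?mul1r// gt_eqF.
Qed.

Lemma spherical_limit lam (phi : nat -> A -> R) L : 0 < lam -> positive_functional L ->
  (forall n, spherical lam (phi n)) -> spherical lam (fun x => L (phi ^~ x)).
Proof.
move=> lam0 PL sphi; have ephi := spherical_equicont lam0 sphi.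
have bphi x := equicont_boundedl x ephi.
split.
- exact: (ucont_limit PL).
- rewrite -[RHS](pf_cst PL); congr L; apply/funext => n; by have [] := sphi n.
- by move=> x; congr L; apply/funext => n; have [] := sphi n.
- move=> s.
  suff -> : \sum_(p <- s) \sum_(q <- s) p.1 * q.1 * L (phi^~ (p.2 - q.2)) =
    L (fun n => \sum_(p <- s) \sum_(q <- s) p.1 * q.1 * phi n (p.2 - q.2)).
    apply: (pf_ge0 PL) => [|n]; last by have [_ _ _ pd _] := sphi n; exact: pd.
    by do 2 apply: bounded_sum => ?; apply: boundedM => //; exact: bounded_cst.
  rewrite (pf_sum PL); last first.
    by move=> p; apply: bounded_sum => ?; apply: boundedM => //; exact: bounded_cst.
  apply: eq_bigr => p _; rewrite (pf_sum PL); last first.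
    by move=> q; apply: boundedM => //; exact: bounded_cst.
  by apply: eq_bigr => q _; rewrite (pfZ PL).
- move=> x.
  have eK : equicont (fun n => conv (phi n)) by apply: conv_equicont; have [] := ephi.
  have -> : conv (fun x => L (phi^~ x)) = (fun x => L (fun n => conv (phi n) x)).
    by apply/funext => y; exact: conv_limit.
  rewrite (conv_limit x PL eK) -(pfZ PL)//.
  by congr L; apply/funext => n; have [] := sphi n.
Qed.

Lemma spherical_maximum : exists lam phi, [/\ 0 < lam, spherical lam phi &
  forall psi, spherical lam psi -> Q psi <= Q phi].
Proof.
have [lam [phi0 [lam0 sphi0]]] := spherical_exists.
pose S := [set r | exists2 phi, spherical lam phi & r = Q phi].
have S0 : S !=set0 by exists (Q phi0), phi0.
have Q1 phi : spherical lam phi -> Q phi <= 1.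
  move=> [uphi p0 pe pd _]; rewrite -(pf_cst PM 1) (pf_le PM)//.
  - by apply/boundedX/ucont_bounded.
  - exact: bounded_cst.
  - move=> x; have := positive_definite_le1 x pe p0 pd.
    by rewrite ler_normsqr// expr1n.
have hS : has_sup S by split=> //; exists 1 => _ [phi sphi ->]; exact: Q1.
have /choice[phi phiP] : forall n : nat, exists f : A -> R,
    spherical lam f /\ sup S - n.+1%:R^-1 <= Q f.
  move=> n; have n0 : 0 < (n.+1%:R^-1 : R) by rewrite invr_gt0.
  have [r [f sf ->] hr] := sup_adherent n0 hS.
  by exists f; split=> //; exact: ltW.
have [L [PL LM Lle]] := ultralimit_exists R (@eventually_filter : ProperFilter \oo).
have sphi n : spherical lam (phi n) by have [] := phiP n.
have ephi := spherical_equicont lam0 sphi.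
exists lam, (fun x => L (phi ^~ x)); split=> //; first exact: spherical_limit.
move=> psi spsi; apply: (@le_trans _ _ (sup S)).
  by apply: sup_upper_bound => //; exists psi.
have -> : Q (fun x => L (phi ^~ x)) = L (fun n => Q (phi n)).
  rewrite -(mean_limit compactA MM PL (g := fun n x => phi n x ^+ 2)); last exact: equicontX.
  congr M; apply/funext => x; have bx := equicont_boundedl x ephi.
  by rewrite expr2 -LM.
apply/ler_addgt0Pr => e e0; rewrite -lerBlDr -(pf_cst PL (sup S - e)).
apply: Lle.
- exact: bounded_cst.
- have [[C hC] _] := equicontX 2 ephi; exists C => n; exact: (pf_norm PM).
- near=> n => /=; have [_] := phiP n; apply: le_trans.
  rewrite lerB//; near: n.
  by apply: filterS (near_infty_natSinv_lt (PosNum e0)) => n /ltW.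
Unshelve. all: by end_near.
Qed.

(* With [t] the translation by [a], this is [(2 + b t) (2 + b t^-1)] applied to [phi] and
   normalized, whence the positive definiteness. *)
Lemma spherical_twist lam phi a b : 0 < lam -> b ^+ 2 = 1 -> spherical lam phi ->
  spherical lam (fun x => (5 + 4 * b * phi a)^-1 *
    (5 * phi x + 2 * b * (phi (x + a) + phi (x - a)))).
Proof.
move=> lam0 b1 [uphi p0 pe pd pE].
have bphi := ucont_bounded uphi.
(* This value is at least 1. With coefficient 1 in place of 2 in the factors of the twist it would
   be [2 + 2 * b * phi a], which may vanish. *)
have d0 : 0 < 5 + 4 * b * phi a.
  have := positive_definite_le1 a pe p0 pd; rewrite ler_normsqr// expr1n => h; nra.
have usum : ucont (fun x => phi (x + a) + phi (x - a)).
  by apply: equicontD; exact: ucont_shift.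
have unum : ucont (fun x => 5 * phi x + 2 * b * (phi (x + a) + phi (x - a))).
  by apply: equicontD; exact: equicontZ.
split.
- exact: equicontZ.
- rewrite add0r sub0r pe p0; field; exact: lt0r_neq0.
- by move=> x; rewrite (pe x) -[phi (- x + a)]pe -[phi (- x - a)]pe !opprD !opprK; ring.
(* The factorization of the twist on test lists: each point is doubled into itself with weight 2 and
   its translate by [a] with weight [b]. *)
- move=> s; pose s' := [seq (2 * p.1, p.2) | p <- s] ++ [seq (b * p.1, p.2 + a) | p <- s].
  suff -> : \sum_(p <- s) \sum_(q <- s) p.1 * q.1 * ((5 + 4 * b * phi a)^-1 *
      (5 * phi (p.2 - q.2) + 2 * b * (phi (p.2 - q.2 + a) + phi (p.2 - q.2 - a)))) =
    (5 + 4 * b * phi a)^-1 * \sum_(p <- s') \sum_(q <- s') p.1 * q.1 * phi (p.2 - q.2).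
    by apply: mulr_ge0; [rewrite invr_ge0 ltW|exact: pd].
  rewrite big_cat !big_map/= -big_split mulr_sumr; apply: eq_bigr => p _ /=.
  rewrite !big_cat !big_map/= -!big_split mulr_sumr; apply: eq_bigr => q _ /=.
  have -> : p.2 + a - (q.2 + a) = p.2 - q.2 by rewrite opprD addrACA subrr addr0.
  have -> : p.2 + a - q.2 = p.2 - q.2 + a by rewrite addrAC.
  have -> : p.2 - (q.2 + a) = p.2 - q.2 - a by rewrite opprD addrA.
  have -> : (b * p.1) * (b * q.1) = p.1 * q.1 by rewrite mulrACA -expr2 b1 mul1r.
  ring.
- have bs c : bounded_fct (fun x => phi (x + c)) by have [B hB] := bphi; exists B.
  have bz c f : bounded_fct f -> bounded_fct (fun x : A => c * f x).
    by move=> bf; apply: boundedM => //; exact: bounded_cst.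
  have convE f : bounded_fct f -> conv (fun x => (5 + 4 * b * phi a)^-1 *
      (5 * f x + 2 * b * (f (x + a) + f (x - a)))) = (fun x => (5 + 4 * b * phi a)^-1 *
      (5 * conv f x + 2 * b * (conv f (x + a) + conv f (x - a)))).
    move=> bf; have bfs c : bounded_fct (fun x => f (x + c)) by have [B hB] := bf; exists B.
    have bf2 : bounded_fct (fun x => f (x + a) + f (x - a)) by exact: boundedD.
    apply/funext => x; rewrite convZ; last by apply: boundedD; exact: bz.
    by rewrite convD ?convZ ?convD ?conv_shift//; exact: bz.
  move=> x; rewrite convE// convE; last exact: conv_bounded.
  by rewrite !pE; ring.
Qed.

(** The last clause, a consequence of [0 < lam] at 0, ties [phi] to the kernel: a kernel chosen for
    a point [a] then forces a character that is nontrivial at [a]. *)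
Lemma dalembert_exists : exists phi,
  [/\ ucont phi, phi 0 = 1, forall x, `|phi x| <= 1,
      forall x b, phi (x + b) + phi (x - b) = 2 * phi b * phi x &
      exists x, conv phi x != 0].
Proof.
have [lam [phi [lam0 sphi maxphi]]] := spherical_maximum.
have [uphi p0 pe pd pE] := sphi.
have p1 x : `|phi x| <= 1 by exact: positive_definite_le1.
exists phi; split=> //; last first.
  apply: contrapT => /forallNP h; have Kp : conv phi = fun=> 0.
    by apply/funext => x; have /negP := h x; rewrite negbK => /eqP.
  have := pE 0; rewrite p0 mulr1 Kp /conv.
  under eq_fun do rewrite mulr0.
  by rewrite (pf_cst PM) => lamE; rewrite -lamE ltxx in lam0.
move=> x a.
(* [phi] is a convex combination of its twists [f 1] and [f (-1)], where [Q] is not larger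
   than at [phi]; strict convexity of [Q] forces [f 1 = f (-1)]. *)
pose f b x := (5 + 4 * b * phi a)^-1 * (5 * phi x + 2 * b * (phi (x + a) + phi (x - a))).
have fS b : b ^+ 2 = 1 -> spherical lam (f b) by move=> b1; exact: spherical_twist.
pose dp := 5 + 4 * phi a; pose dm := 5 - 4 * phi a.
have := p1 a; rewrite ler_norml => /andP[pa1 pa2].
have dp0 : 0 < dp by rewrite /dp; lra.
have dm0 : 0 < dm by rewrite /dm; lra.
have m1 : (-1 : R) ^+ 2 = 1 by ring.
have s1 := fS 1 (expr1n _ _); have s2 := fS (-1) m1.
have [u1 _ _ _ _] := s1; have [u2 _ _ _ _] := s2.
have b1 := ucont_bounded u1; have b2 := ucont_bounded u2; have bp := ucont_bounded uphi.
have mid y : 10 * phi y = dp * f 1 y + dm * f (-1) y.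
  rewrite /f /dp /dm mulr1; field; apply/andP; split; apply: lt0r_neq0.
    by move: dm0; rewrite /dm; lra.
  by move: dp0; rewrite /dp; lra.
have ud : ucont (fun y => f 1 y - f (-1) y) by exact: equicontB.
(* The variance identity for the weights [dp / 10] and [dm / 10], whose sum is 1. *)
have QdE : dp * dm / 10 * Q (fun y => f 1 y - f (-1) y) =
    dp * Q (f 1) + dm * Q (f (-1)) - 10 * Q phi.
  have q1 := boundedX 2 b1; have q2 := boundedX 2 b2.
  have q3 := boundedX 2 bp; have q4 := boundedX 2 (ucont_bounded ud).
  rewrite /Q -(pfZ PM _ q1) -(pfZ PM _ q2) -(pfZ PM _ q3) -(pfZ PM _ q4).
  have bz c g : bounded_fct g -> bounded_fct (fun x : A => c * g x ^+ 2).
    by move=> bg; apply: boundedM; [exact: bounded_cst|exact: boundedX].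
  rewrite -(pfD PM); [|exact: bz..].
  rewrite -(pfB PM); [|by apply: boundedD; exact: bz|exact: bz].
  congr M; apply/funext => y.
  have -> : phi y = (dp * f 1 y + dm * f (-1) y) / 10 by rewrite -mid; field.
  have -> : dm = 10 - dp by rewrite /dm /dp; ring.
  by field.
have Qd : Q (fun y => f 1 y - f (-1) y) = 0.
  apply/eqP; rewrite eq_le Q_ge0 ?andbT; last exact: ucont_bounded.
  have h1 := maxphi _ s1; have h2 := maxphi _ s2.
  have c0 : 0 < dp * dm / 10 by rewrite divr_gt0// mulr_gt0.
  rewrite -(pmulr_rle0 _ c0) QdE.
  have -> : 10 = dp + dm :> R by rewrite /dm /dp; ring.
  have : 0 <= dp * (Q phi - Q (f 1)) by apply: mulr_ge0; [exact: ltW|rewrite subr_ge0].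
  have : 0 <= dm * (Q phi - Q (f (-1))) by apply: mulr_ge0; [exact: ltW|rewrite subr_ge0].
  by rewrite !mulrBr; lra.
have eqf := mean_sqr_eq0 compactA MM ud Qd.
have eqp : phi x = f 1 x.
  have := mid x; have /eqP := eqf x; rewrite subr_eq0 => /eqP <-.
  by rewrite /dp /dm => h; lra.
move: eqp; rewrite /f !mulr1 => /(congr1 (fun z => (5 + 4 * phi a) * z)).
rewrite mulrA divff ?gt_eqF// mul1r => h; lra.
Qed.

End Convolution.

(** * The circle group *)

Local Open Scope complex_scope.

Section Circle.
Variable R : realType.

(** The group is written additively, so that characters become additive maps. Membership is a
    polynomial condition on the two coordinates, which suits [ring]. *)
Record circle := Circle {
  circle_val :> R[i];
  circle_valP : complex.Re circle_val ^+ 2 + complex.Im circle_val ^+ 2 == 1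
}.
HB.instance Definition _ := [isSub for circle_val].
HB.instance Definition _ := [Choice of circle by <:].

Implicit Types u v w : circle.

Let mulP u v : complex.Re (circle_val u * circle_val v) ^+ 2 +
  complex.Im (circle_val u * circle_val v) ^+ 2 == 1.
Proof.
case: u v => [[a b] /= /eqP ab] [[c d] /= /eqP cd]; apply/eqP.
transitivity ((a ^+ 2 + b ^+ 2) * (c ^+ 2 + d ^+ 2)); first by ring.
by rewrite ab cd mulr1.
Qed.

Let conjP u : complex.Re (conjc (circle_val u)) ^+ 2 + complex.Im (conjc (circle_val u)) ^+ 2 == 1.
Proof. by case: u => [[a b] /=]; rewrite sqrrN. Qed.

Let oneP : complex.Re (1 : R[i]) ^+ 2 + complex.Im (1 : R[i]) ^+ 2 == 1.
Proof. by rewrite /= expr1n expr0n addr0. Qed.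

Let circle0 := Circle oneP.
Let circleD u v := Circle (mulP u v).
Let circleN u := Circle (conjP u).

Let circleDA : associative circleD.
Proof. by move=> u v w; apply: val_inj; rewrite /= mulrA. Qed.
Let circleDC : commutative circleD.
Proof. by move=> u v; apply: val_inj; rewrite /= mulrC. Qed.
Let circle0D : left_id circle0 circleD.
Proof. by move=> u; apply: val_inj; rewrite /= mul1r. Qed.
Let circleND : left_inverse circle0 circleN circleD.
Proof.
case=> -[a b] hab; apply: val_inj => /=; apply/eqP; move/eqP: hab => /= ab.
rewrite eq_complex/=; apply/andP; split; apply/eqP; last by ring.
by rewrite -ab; ring.
Qed.
HB.instance Definition _ := GRing.isZmodule.Build circle circleDA circleDC circle0D circleND.

Definition cosc u := complex.Re (circle_val u).
Definition sinc u := complex.Im (circle_val u).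

Lemma circle_eq u v : cosc u = cosc v -> sinc u = sinc v -> u = v.
Proof.
move=> uv1 uv2; apply: val_inj; apply/eqP; rewrite eq_complex/=.
by apply/andP; split; apply/eqP.
Qed.

Lemma cosc2Dsinc2 u : cosc u ^+ 2 + sinc u ^+ 2 = 1.
Proof. by apply/eqP; exact: circle_valP. Qed.

Lemma coscD u v : cosc (u + v) = cosc u * cosc v - sinc u * sinc v.
Proof. by rewrite /cosc /sinc; case: u v => [[a b] ?] [[c d] ?]. Qed.

Lemma sincD u v : sinc (u + v) = cosc u * sinc v + sinc u * cosc v.
Proof. by rewrite /cosc /sinc; case: u v => [[a b] ?] [[c d] ?]. Qed.

Lemma cosc0 : cosc 0 = 1. Proof. by []. Qed.
Lemma sinc0 : sinc 0 = 0. Proof. by []. Qed.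
Lemma coscN u : cosc (- u) = cosc u.
Proof. by rewrite /cosc; case: u => [[a b] ?]. Qed.
Lemma sincN u : sinc (- u) = - sinc u.
Proof. by rewrite /sinc; case: u => [[a b] ?]. Qed.

Lemma cosc_eq1 u : cosc u = 1 -> u = 0.
Proof.
move=> u1; apply: circle_eq => //; rewrite sinc0; apply/eqP; rewrite -sqrf_eq0.
by have := cosc2Dsinc2 u; rewrite u1 expr1n => h; apply/eqP; lra.
Qed.

Lemma cosc_le1 u : cosc u <= 1.
Proof. by have := cosc2Dsinc2 u; have := sqr_ge0 (sinc u); nra. Qed.

Let expiP (t : R) : complex.Re (cos t +i* sin t) ^+ 2 + complex.Im (cos t +i* sin t) ^+ 2 == 1.
Proof. by rewrite /= cos2Dsin2. Qed.

Definition expi (t : R) : circle := Circle (expiP t).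

Lemma cosc_expi t : cosc (expi t) = cos t. Proof. by []. Qed.
Lemma sinc_expi t : sinc (expi t) = sin t. Proof. by []. Qed.

Lemma expi_is_additive : zmod_morphism expi.
Proof.
move=> s t; apply: circle_eq; rewrite ?coscD ?sincD ?coscN ?sincN !cosc_expi !sinc_expi.
  by rewrite cosB; ring.
by rewrite sinB; ring.
Qed.
HB.instance Definition _ := GRing.isZmodMorphism.Build R circle expi expi_is_additive.

Lemma expi_surj u : exists t, u = expi t.
Proof.
have h := cosc2Dsinc2 u.
have c1 : -1 <= cosc u <= 1.
  by rewrite -ler_norml ler_normsqr// expr1n -h lerDl sqr_ge0.
have ck : cos (acos (cosc u)) = cosc u by rewrite acosK// in_itv.
have sk : sin (acos (cosc u)) = `|sinc u|.
  by rewrite sin_acos// -h addrAC subrr add0r sqrtr_sqr.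
have [s0|s0] := leP 0 (sinc u).
  by exists (acos (cosc u)); apply: circle_eq; rewrite ?cosc_expi ?sinc_expi ?ck ?sk ?ger0_norm.
exists (- acos (cosc u)); apply: circle_eq; rewrite ?cosc_expi ?sinc_expi ?cosN ?sinN ?ck ?sk//.
by rewrite ltr0_norm ?opprK.
Qed.

(** Since 1 < pi, no other period is in reach. Equations between small elements of the circle are
    lifted to the reals by this. *)
Lemma expi_eq0 t : `|t| <= 1 -> expi t = 0 -> t = 0.
Proof.
move=> t1 et0; have st0 : sin t = 0 by rewrite -sinc_expi et0.
have pi1 : 1 < pi :> R by exact: lt_le_trans (ltr1n _ 2) (pi_ge2 _).
move: t1; rewrite ler_norml => /andP[t1 t2].
have [t0|t0|//] := ltgtP t 0.
  have : 0 < sin (- t) by apply: sin_gt0_pi; apply/andP; split; lra.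
  by rewrite sinN st0 oppr0 ltxx.
have : 0 < sin t by apply: sin_gt0_pi; apply/andP; split; lra.
by rewrite st0 ltxx.
Qed.

(** A bound on a real lift rather than on the distance to the identity: bounds then add without
    loss, and the lift is available for the recurrences. *)
Definition small (e : R) u := exists2 t, `|t| <= e & u = expi t.

Lemma small_le e e' u : e <= e' -> small e u -> small e' u.
Proof. by move=> ee [t te ->]; exists t => //; exact: le_trans ee. Qed.

Lemma small0 e : 0 <= e -> small e 0.
Proof. by move=> e0; exists 0; rewrite ?normr0// raddf0. Qed.

Lemma smallD e f u v : small e u -> small f v -> small (e + f) (u + v).
Proof.
move=> [s se ->] [t tf ->]; exists (s + t); last by rewrite raddfD.
by rewrite (le_trans (ler_normD _ _))// lerD.
Qed.

Lemma smallN e u : small e u -> small e (- u).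
Proof. by move=> [t te ->]; exists (- t); rewrite ?normrN ?raddfN. Qed.

Lemma smallB e f u v : small e u -> small f v -> small (e + f) (u - v).
Proof. by move=> su sv; apply: smallD => //; exact: smallN. Qed.

Lemma small_sum (I : Type) (s : seq I) (e : I -> R) (u : I -> circle) :
  (forall i, small (e i) (u i)) -> small (\sum_(i <- s) e i) (\sum_(i <- s) u i).
Proof.
move=> su; elim: s => [|i s ih]; rewrite ?big_nil ?big_cons; first exact: small0.
exact: smallD.
Qed.

Lemma smallMz e u (z : int) : small e u -> small (`|z|%:~R * e) (u *~ z).
Proof.
move=> [t te ->]; exists (t *~ z); last by rewrite raddfMz.
by rewrite -mulrzl normrM ler_pM// intr_norm.
Qed.

Lemma small_cos (e : R) : 0 < e -> exists2 d, 0 < d & forall u, small d u -> 1 - cosc u < e.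
Proof.
move=> e0; have := @continuous_cos R 0 => /cvgrPdist_lt/(_ e e0); rewrite cos0.
move=> /nbhs_ballP[d /= d0 hd]; exists (d / 2); first by rewrite divr_gt0.
move=> _ [t td ->]; rewrite cosc_expi; apply: le_lt_trans (hd t _); first exact: ler_norm.
by rewrite /ball/= sub0r normrN (le_lt_trans td)//; lra.
Qed.

Lemma small_sin (e : R) : 0 < e -> exists2 d, 0 < d &
  forall u, 0 < cosc u -> `|sinc u| < d -> small e u.
Proof.
have asin0 : asin 0 = 0 :> R.
  by rewrite -[0 in LHS]sin0 sinK// in_itv/= oppr_le0 divr_ge0 ?pi_ge0.
move=> e0; have := @continuous_asin R 0; rewrite ltr01 oppr_lt0 ltr01 => /(_ isT).
move=> /cvgrPdist_lt/(_ e e0); rewrite asin0 => /nbhs_ballP[d /= d0 hd].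
exists (Num.min d 1); first by rewrite lt_min d0 ltr01.
move=> u u0; rewrite lt_min => /andP[ud u1].
have s1 : -1 <= sinc u <= 1 by rewrite -ler_norml ltW.
exists (asin (sinc u)).
  have := hd (sinc u); rewrite /ball/= !sub0r !normrN => /(_ ud); exact: ltW.
apply: circle_eq; rewrite ?cosc_expi ?sinc_expi; last by rewrite asinK// in_itv.
rewrite cos_asin// -(cosc2Dsinc2 u) addrK sqrtr_sqr ger0_norm//; exact: ltW.
Qed.

End Circle.

(** * Pontryagin duality *)

Section Evaluation.
Variables (R : realType) (A : topologicalZmodType).
Implicit Types chi : pontryagin_dual R A.

Let evP chi a : complex.Re (chi a : R[i]) ^+ 2 + complex.Im (chi a : R[i]) ^+ 2 == 1.
Proof.
have [_ /(_ a) h _] := characterP chi; move: h; rewrite normc_def.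
move: (_ + _) => x; case=> h; apply/eqP.
have x0 : 0 <= x.
  by case: (leP 0 x) => // /ltW/ler0_sqrtr h0; move: h; rewrite h0 => /esym/eqP; rewrite oner_eq0.
by rewrite -(sqr_sqrtr x0) h expr1n.
Qed.

Definition ev chi a : circle R := Circle (evP chi a).

Lemma evDl chi psi a : ev (chi + psi) a = ev chi a + ev psi a.
Proof. exact: val_inj. Qed.

Lemma evDr chi a b : ev chi (a + b) = ev chi a + ev chi b.
Proof. by apply: val_inj => /=; have [_ _ ->] := characterP chi. Qed.

Lemma ev0l a : ev 0 a = 0. Proof. exact: val_inj. Qed.

Lemma ev_zmod_morphism chi : zmod_morphism (ev chi).
Proof.
have e0 : ev chi 0 = 0 by apply: (addrI (ev chi 0)); rewrite -evDr !addr0.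
move=> a b; rewrite evDr; congr (_ + _).
by apply: (addrI (ev chi b)); rewrite -evDr !subrr.
Qed.
HB.instance Definition _ chi :=
  GRing.isZmodMorphism.Build A (circle R) (ev chi) (ev_zmod_morphism chi).

Lemma ev_eq0 chi : (forall a, ev chi a = 0) -> chi = 0.
Proof. by move=> h; apply: pontryagin_dualP => a; have := congr1 (@circle_val R) (h a). Qed.

Definition eval a chi := ev chi a.

Lemma eval_zmod_morphism a : zmod_morphism (eval a).
Proof.
have e0 : eval a 0 = 0 by exact: ev0l.
move=> chi psi; rewrite /eval evDl; congr (_ + _).
by apply: (addrI (eval a psi)); rewrite -evDl !subrr.
Qed.
HB.instance Definition _ a :=
  GRing.isZmodMorphism.Build (pontryagin_dual R A) (circle R) (eval a) (eval_zmod_morphism a).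

Lemma ler_ReIm_norm (z : R[i]) (e : R) : `|z| < e%:C ->
  `|complex.Re z| < e /\ `|complex.Im z| < e.
Proof.
rewrite normc_def ltcR => h; split; apply: le_lt_trans h.
  by rewrite -sqrtr_sqr ler_wsqrtr// lerDl sqr_ge0.
by rewrite -sqrtr_sqr ler_wsqrtr// lerDr sqr_ge0.
Qed.

Lemma cosc_ev_continuous chi : continuous (fun a => cosc (ev chi a)).
Proof.
move=> a; apply/cvgrPdist_lt => e e0; have [cc _ _] := characterP chi.
have eC : 0 < e%:C :> R[i] by rewrite ltcR.
have /cvgrPdist_lt/(_ _ eC) := cc a.
by apply: filterS => b /ler_ReIm_norm[+ _]; rewrite /cosc/= raddfB.
Qed.

Lemma sinc_ev_continuous chi : continuous (fun a => sinc (ev chi a)).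
Proof.
move=> a; apply/cvgrPdist_lt => e e0; have [cc _ _] := characterP chi.
have eC : 0 < e%:C :> R[i] by rewrite ltcR.
have /cvgrPdist_lt/(_ _ eC) := cc a.
by apply: filterS => b /ler_ReIm_norm[_]; rewrite /sinc/= raddfB.
Qed.

Lemma small_ev_near chi e : 0 < e -> \forall a \near (0 : A), small e (ev chi a).
Proof.
move=> /(@small_sin R)[d d0 hd].
have /cvgrPdist_lt/(_ _ ltr01) := @cosc_ev_continuous chi 0.
have /cvgrPdist_lt/(_ _ d0) := @sinc_ev_continuous chi 0.
apply: filterS2 => a; rewrite /= raddf0 cosc0 sinc0 sub0r normrN => h1 h2.
by apply: hd => //; move: h2; rewrite ltr_norml => /andP[_ h2]; lra.
Qed.

Lemma character_of_pair (c s : A -> R) : continuous c -> continuous s ->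
  (forall x, c x ^+ 2 + s x ^+ 2 = 1) ->
  (forall x y, c (x + y) = c x * c y - s x * s y) ->
  (forall x y, s (x + y) = c x * s y + s x * c y) ->
  exists chi, forall a, cosc (ev chi a) = c a.
Proof.
move=> cc cs cs1 cD sD.
have hchi : is_character (fun a => (c a +i* s a : R[i]^o)).
  split.
  - move=> a; apply/cvgrPdist_lt => e e0.
    have e0' := e0; move: e0'; rewrite ltcE/= => /andP[/eqP ime ree].
    have e2 : 0 < complex.Re e / 2 by rewrite divr_gt0.
    have /cvgrPdist_lt/(_ _ e2) := cc a; have /cvgrPdist_lt/(_ _ e2) := cs a.
    apply: filterS2 => b h1 h2.
    have -> : e = (complex.Re e)%:C by apply/eqP; rewrite eq_complex/= ime !eqxx.
    rewrite -[X in `|X|]/((c a - c b) +i* (s a - s b)).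
    have -> : (c a - c b) +i* (s a - s b) = (c a - c b)%:C + 'i%C * (s a - s b)%:C :> R[i].
      by rewrite [LHS]complexE.
    rewrite (le_lt_trans (ler_normD _ _))//.
    rewrite !normc_def/= !mul0r !mul1r !sub0r !expr0n/= !addr0 oppr0 expr0n !add0r !sqrtr_sqr.
    by rewrite -rmorphD ltcR [ltRHS]splitr ltrD.
  - by move=> a; rewrite normc_def/= cs1 sqrtr1.
  - by move=> a b; apply/eqP; rewrite eq_complex/= cD sD; apply/andP; split; apply/eqP; ring.
exists (Character (introT (asboolP _) hchi)) => a.
by [].
Qed.

Hypothesis compactA : compact [set: A].
Hypothesis hausdorffA : hausdorff_space A.

(** A separating function times its reflection; evenness will make the convolution self-adjoint. *)
Lemma even_bump (a : A) : a != 0 -> exists f : A -> R,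
  [/\ ucont f, forall x, f (- x) = f x, f 0 = 1 & f a = 0].
Proof.
move=> a0.
have acc := hausdorff_accessible hausdorffA.
have cr := normal_completely_regular (compact_normal hausdorffA compactA) acc.
have ca : closed [set a] by exact: accessible_closed_set1.
have n0 : ~ [set a] 0 by move=> /= h; rewrite h eqxx in a0.
have /(uniform_separatorP (R := R))[g [gc _ g0 ga]] := cr R 0 [set a] ca n0.
have g00 : g 0 = 0 by apply: g0; exists 0.
have gaa : g a = 1 by apply: ga; exists a.
have ug := continuous_ucont compactA gc.
have u1 : ucont (fun x => 1 - g x).
  by apply: equicontB => //; apply: equicont_cst; exact: bounded_cst.
exists (fun x => (1 - g x) * (1 - g (- x))); split.
- by apply: equicontM => //; exact: (equicont_opp u1).
- by move=> x; rewrite opprK mulrC.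
- by rewrite oppr0 g00 subr0 mulr1.
- by rewrite gaa subrr mul0r.
Qed.

(** The identity cos(x - b) - cos(x + b) = 2 sin x sin b recovers the sine, up to a global sign,
    from any [b] with sin b nonzero. If there is no such [b], then [phi] is a homomorphism to 1 and
    -1, and [s = 0]. *)
Lemma dalembert_pair (phi : A -> R) : phi 0 = 1 -> (forall x, `|phi x| <= 1) ->
  (forall x b, phi (x + b) + phi (x - b) = 2 * phi b * phi x) -> ucont phi ->
  exists s, [/\ ucont s, forall x, phi x ^+ 2 + s x ^+ 2 = 1,
  forall x y, phi (x + y) = phi x * phi y - s x * s y &
  forall x y, s (x + y) = phi x * s y + s x * phi y].
Proof.
move=> p0 p1 dal uphi.
have pe x : phi (- x) = phi x.
  by have := dal 0 x; rewrite add0r sub0r p0; lra.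
have [all1|] := pselect (forall x, phi x ^+ 2 = 1).
  exists (fun=> 0); split.
  - by apply: equicont_cst; exact: bounded_cst.
  - by move=> x; rewrite all1 expr0n addr0.
  - move=> x y; rewrite mulr0 subr0.
    have := dal x y; have := p1 (x + y); have := p1 (x - y).
    have : (phi x * phi y) ^+ 2 = 1 by rewrite exprMn !all1 mulr1.
    rewrite !ler_norml => /eqP; rewrite sqrf_eq1.
    by move=> /orP[] /eqP h /andP[h1 h2] /andP[h3 h4] h5; nra.
  - by move=> x y; rewrite mulr0 mul0r addr0.
move=> /existsNP[b /eqP b1].
have bp : 0 < 1 - phi b ^+ 2.
  by rewrite lt_def subr_eq0 eq_sym b1 subr_ge0 -(expr1n R 2) -ler_normsqr ?p1.
pose sg := Num.sqrt (1 - phi b ^+ 2).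
have sg2 : sg ^+ 2 = 1 - phi b ^+ 2 by rewrite sqr_sqrtr// ltW.
have sg0 : sg != 0 by rewrite gt_eqF// sqrtr_gt0.
pose s x := (phi (x - b) - phi (x + b)) / (2 * sg).
have p2b : phi (b + b) = 2 * phi b ^+ 2 - 1.
  by have := dal b b; rewrite subrr p0 expr2; lra.
have prod x y : phi (x + y) = 2 * phi x * phi y - phi (x - y) by have := dal x y; lra.
(* The product formula for sines: d'Alembert's equation expands the four products in the numerator,
   and the resulting shifts by [b + b] are removed with the value of [phi (b + b)]. *)
have ss x y : s x * s y = (phi (x - y) - phi (x + y)) / 2.
  have -> : s x * s y = (phi (x - b) - phi (x + b)) * (phi (y - b) - phi (y + b)) / (4 * sg ^+ 2).
    by rewrite /s; field.
  have e1 : 2 * phi (x - b) * phi (y - b) = phi (x + y - (b + b)) + phi (x - y).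
    have := dal (x - b) (y - b).
    have -> : x - b + (y - b) = x + y - (b + b) by rewrite addrACA -opprD.
    have -> : x - b - (y - b) = x - y by rewrite opprB addrA subrK.
    lra.
  have e2 : 2 * phi (x - b) * phi (y + b) = phi (x + y) + phi (x - y - (b + b)).
    have := dal (x - b) (y + b).
    have -> : x - b + (y + b) = x + y by rewrite addrACA addNr addr0.
    have -> : x - b - (y + b) = x - y - (b + b) by rewrite !opprD addrACA.
    lra.
  have e3 : 2 * phi (x + b) * phi (y - b) = phi (x + y) + phi (x - y + (b + b)).
    have := dal (x + b) (y - b).
    have -> : x + b + (y - b) = x + y by rewrite addrACA subrr addr0.
    have -> : x + b - (y - b) = x - y + (b + b) by rewrite opprB addrACA [b + - y]addrC -addrACA.
    lra.
  have e4 : 2 * phi (x + b) * phi (y + b) = phi (x + y + (b + b)) + phi (x - y).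
    have := dal (x + b) (y + b).
    have -> : x + b + (y + b) = x + y + (b + b) by rewrite addrACA.
    have -> : x + b - (y + b) = x - y by rewrite opprD addrACA subrr addr0.
    lra.
  have f1 := dal (x + y) (b + b); have f2 := dal (x - y) (b + b).
  have num : (phi (x - b) - phi (x + b)) * (phi (y - b) - phi (y + b)) =
    2 * sg ^+ 2 * (phi (x - y) - phi (x + y)).
    rewrite p2b in f1 f2; rewrite sg2; nra.
  by rewrite num; field.
have us : ucont s.
  have u1 : ucont (fun x => phi (x - b) - phi (x + b)) by apply: equicontB; exact: ucont_shift.
  have := equicontZ (2 * sg)^-1 u1; congr equicont; apply/funext => _; apply/funext => x.
  by rewrite mulrC.
exists s; split=> //.
- move=> x; rewrite expr2 (expr2 (s x)) ss subrr p0.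
  by have := dal x x; rewrite subrr p0; lra.
- by move=> x y; rewrite ss; have := dal x y; lra.
- move=> x y; rewrite /s.
  have g1 := dal (x - b) y; have g2 := dal (x + b) y.
  have g3 := dal (y - b) x; have g4 := dal (y + b) x.
  have r1 : x - b + y = x + y - b by rewrite addrAC.
  have r2 : x + b + y = x + y + b by rewrite addrAC.
  have r3 : y - b + x = x + y - b by rewrite addrAC [y + x]addrC.
  have r4 : y + b + x = x + y + b by rewrite addrAC [y + x]addrC.
  have r5 : phi (y - b - x) = phi (x + b - y).
    by rewrite -pe; congr phi; rewrite !opprD !opprK addrAC [- y + x]addrC addrAC.
  have r6 : phi (y + b - x) = phi (x - b - y).
    by rewrite -pe; congr phi; rewrite !opprD !opprK addrAC [- y + x]addrC addrAC.
  rewrite r1 in g1; rewrite r2 in g2; rewrite r3 r5 in g3; rewrite r4 r6 in g4.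
  have sg20 : 2 * sg != 0 by rewrite mulf_neq0.
  rewrite mulrA [_ / _ * phi y]mulrAC -mulrDl; congr (_ / _); lra.
Qed.

Variable M : (A -> R) -> R.
Hypothesis MM : is_mean M.
Let PM := mean_pf MM.

(** The kernel is minus the second difference of a bump in the direction [a]. If [ev chi a = 0],
    then [phi a = 1] and d'Alembert's equation kills the second difference of [phi]; moving the
    difference from the kernel to [phi] gives [conv phi = 0], which is excluded. *)
Lemma characters_separate (a : A) : a != 0 -> exists chi, ev chi a != 0.
Proof.
move=> a0; have [f [uf fe f0 fa]] := even_bump a0.
pose k x := 2 * f x - f (x + a) - f (x - a).
have uk : ucont k.
  by apply: equicontB; [apply: equicontB; [exact: (equicontZ 2 uf)|exact: ucont_shift]|exact: ucont_shift].
have ke x : k (- x) = k x.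
  rewrite /k fe -[f (- x + a)]fe -[f (- x - a)]fe !opprD !opprK; ring.
have k0 : k 0 != 0 by rewrite /k add0r sub0r fe f0 fa !subr0 mulr1.
have [phi [uphi p0 p1 dal [x Kx]]] := dalembert_exists compactA MM uk ke k0.
have [s [us cs1 cD sD]] := dalembert_pair p0 p1 dal uphi.
have [chi chiE] := character_of_pair (ucont_continuous uphi) (ucont_continuous us) cs1 cD sD.
exists chi; apply: contra Kx => /eqP h.
have pa : phi a = 1 by rewrite -chiE h.
have bphi := ucont_bounded uphi; have bf := ucont_bounded uf.
have bfs c : bounded_fct (fun y => f (c - y)) by have [B hB] := bf; exists B.
have bps c : bounded_fct (fun y => phi (y + c)) by have [B hB] := bphi; exists B.
have bfp c d : bounded_fct (fun y => f (c - y) * phi (y + d)) by exact: boundedM.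
have sh c : M (fun y => f (x + c - y) * phi y) = M (fun y => f (x - y) * phi (y + c)).
  rewrite -(mean_shift MM c); last by exact: boundedM.
  by congr M; apply/funext => y; rewrite opprD addrACA subrr addr0.
have b1 : bounded_fct (fun y => 2 * (f (x - y) * phi y)).
  by apply: boundedM; [exact: bounded_cst|exact: boundedM].
have b2 : bounded_fct (fun y => f (x + a - y) * phi y) by exact: boundedM.
have b3 : bounded_fct (fun y => f (x - a - y) * phi y) by exact: boundedM.
apply/eqP; rewrite /conv.
transitivity (M (fun y => 2 * (f (x - y) * phi y)) - M (fun y => f (x + a - y) * phi y)
   - M (fun y => f (x - a - y) * phi y)).
  rewrite -(pfB PM b1 b2) -(pfB PM (boundedB b1 b2) b3).
  by congr M; apply/funext => y; rewrite /k [x - y + a]addrAC [x - y - a]addrAC; ring.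
rewrite !sh -(pfB PM b1 (bfp x a)) -(pfB PM (boundedB b1 (bfp x a)) (bfp x (- a))).
rewrite -(pf_cst PM 0); congr M; apply/funext => y.
have := dal y a; rewrite pa; nra.
Qed.

(** By invariance the vector of the means of cosine and sine is fixed by the rotation through
    [ev chi b], which is nontrivial for some [b]. The phase [w] allows for a twist. *)
Lemma mean_cosc_ev chi w : chi != 0 -> M (fun a => cosc (ev chi a + w)) = 0.
Proof.
move=> chi0.
have uc := continuous_ucont compactA (@cosc_ev_continuous chi).
have us := continuous_ucont compactA (@sinc_ev_continuous chi).
have bc := ucont_bounded uc; have bs := ucont_bounded us.
have [b b0] : exists b, ev chi b != 0.
  apply: contrapT => /forallNP h; move/eqP: chi0; apply; apply: ev_eq0 => a.
  by have /negP := h a; rewrite negbK => /eqP.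
set P := M (fun a => cosc (ev chi a)); set Q := M (fun a => sinc (ev chi a)).
have bz c f : bounded_fct f -> bounded_fct (fun x : A => f x * c).
  by move=> bf; apply: boundedM => //; exact: bounded_cst.
have zr c f : bounded_fct f -> M (fun x => f x * c) = M f * c.
  by move=> bf; rewrite mulrC -(pfZ PM)//; congr M; apply/funext => x; rewrite mulrC.
have EP v : M (fun a => cosc (ev chi a + v)) = P * cosc v - Q * sinc v.
  rewrite -!zr// -(pfB PM); [|exact: bz..].
  by congr M; apply/funext => a; rewrite coscD.
have EQ v : M (fun a => sinc (ev chi a + v)) = P * sinc v + Q * cosc v.
  rewrite -!zr// -(pfD PM); [|exact: bz..].
  by congr M; apply/funext => a; rewrite sincD.
have e1 : P = P * cosc (ev chi b) - Q * sinc (ev chi b).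
  rewrite -EP /P -(mean_shift MM b)//.
  by congr M; apply/funext => a; rewrite raddfD.
have e2 : Q = P * sinc (ev chi b) + Q * cosc (ev chi b).
  rewrite -EQ /Q -(mean_shift MM b)//.
  by congr M; apply/funext => a; rewrite raddfD.
have c1 : cosc (ev chi b) < 1.
  by rewrite lt_neqAle cosc_le1 andbT; apply: contra b0 => /eqP/cosc_eq1 ->.
have cs := cosc2Dsinc2 (ev chi b).
move: e1 e2 c1 cs; rewrite EP.
move: (cosc (ev chi b)) (sinc (ev chi b)) => c s e1 e2 c1 cs.
have P0 : P * (1 - c) = 0 by nra.
have Q0 : Q * (1 - c) = 0 by nra.
have c10 : 1 - c != 0 by rewrite subr_eq0 eq_sym lt_eqF.
move/eqP: P0; rewrite mulf_eq0 (negbTE c10) orbF => /eqP ->.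
move/eqP: Q0; rewrite mulf_eq0 (negbTE c10) orbF => /eqP ->.
by rewrite !mul0r subrr.
Qed.

(* A list of characters encodes the sum of its members, so [sumset] is the product. *)
Definition sumset (X : zmodType) (s t : seq X) : seq X := [seq x + y | x <- s, y <- t].
Definition difference_list (X : zmodType) (s : seq X) : seq X := [seq x - y | x <- s, y <- s].
Definition sumset_iter (X : zmodType) (s : seq X) n := iter n (sumset s) [:: 0].

Section TrigSums.
Variables (X : zmodType) (theta : {additive X -> circle R}).

Let Sc (s : seq X) := \sum_(x <- s) cosc (theta x).
Let Ss (s : seq X) := \sum_(x <- s) sinc (theta x).

Lemma sumsetE s t : Sc (sumset s t) = Sc s * Sc t - Ss s * Ss t /\
  Ss (sumset s t) = Sc s * Ss t + Ss s * Sc t.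
Proof.
rewrite /Sc /Ss /sumset !big_allpairs_dep; split.
  rewrite !mulr_suml -sumrB; apply: eq_bigr => x _.
  by rewrite !mulr_sumr -sumrB; apply: eq_bigr => y _; rewrite raddfD coscD.
rewrite !mulr_suml -big_split; apply: eq_bigr => x _ /=.
by rewrite !mulr_sumr -big_split; apply: eq_bigr => y _; rewrite raddfD sincD.
Qed.

(** Summing over differences gives the squared modulus of the exponential sum. It is real, so its
    powers are again cosine sums. *)
Lemma difference_listE s : Sc (difference_list s) = Sc s ^+ 2 + Ss s ^+ 2 /\
  Ss (difference_list s) = 0.
Proof.
rewrite /Sc /Ss /difference_list !big_allpairs_dep; split.
  rewrite !expr2 !mulr_suml -big_split; apply: eq_bigr => x _ /=.
  rewrite !mulr_sumr -big_split; apply: eq_bigr => y _ /=.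
  by rewrite raddfB coscD coscN sincN mulrN opprK.
transitivity (Ss s * Sc s - Sc s * Ss s); last by rewrite mulrC subrr.
rewrite /Sc /Ss !mulr_suml -sumrB; apply: eq_bigr => x _.
rewrite !mulr_sumr -sumrB; apply: eq_bigr => y _.
by rewrite raddfB sincD coscN sincN mulrN addrC.
Qed.

Lemma sumset_iterE s n : Ss s = 0 -> Sc (sumset_iter s n) = Sc s ^+ n /\ Ss (sumset_iter s n) = 0.
Proof.
move=> Ss0; elim: n => [|n [ih1 ih2]].
  by rewrite /Sc /Ss /= !big_seq1 raddf0 cosc0 sinc0.
rewrite /sumset_iter iterS -/(sumset_iter s n); have [-> ->] := sumsetE s (sumset_iter s n).
by rewrite Ss0 ih1 ih2 !mul0r mulr0 subr0 addr0 exprS.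
Qed.

End TrigSums.

(** The deviation of evaluation at [a] from the prescribed [h]; for fixed [a] it is a homomorphism
    in [chi], so the identities for trigonometric sums apply. *)
Definition twisted (h : {additive pontryagin_dual R A -> circle R}) (a : A)
    (chi : pontryagin_dual R A) := ev chi a - h chi.

Lemma twisted_is_additive h a : zmod_morphism (twisted h a).
Proof.
move=> chi psi; have e1 : ev (chi - psi) a = ev chi a - ev psi a := raddfB (eval a) chi psi.
rewrite /twisted e1 (raddfB h) !opprB.
by rewrite addrACA [RHS]addrACA; congr (_ + _); exact: addrC.
Qed.
HB.instance Definition _ h a := GRing.isZmodMorphism.Build _ _ (twisted h a) (twisted_is_additive h a).

Lemma mean_twisted (h : {additive pontryagin_dual R A -> circle R}) s :
  M (fun a => \sum_(chi <- s) cosc (twisted h a chi)) = (count_mem 0 s)%:R.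
Proof.
rewrite (pf_sum PM); last first.
  move=> chi; exists 1 => a; rewrite ler_normsqr// expr1n -(cosc2Dsinc2 (twisted h a chi)).
  by rewrite lerDl sqr_ge0.
rewrite -sum1_count natr_sum [RHS]big_mkcond/=; apply: eq_bigr => chi _.
case: eqVneq => [->|chi0]; last by rewrite mean_cosc_ev.
by rewrite -[RHS](pf_cst PM); congr M; apply/funext => a; rewrite raddf0 cosc0.
Qed.

Lemma geometric_contradiction (m p q : R) : 0 < m -> 0 <= p -> p < q ->
  (forall n, m * q ^+ n <= p ^+ n) -> False.
Proof.
move=> m0 p0 pq h; have q0 : 0 < q by exact: le_lt_trans pq.
have r1 : `|p / q| < 1 by rewrite ger0_norm ?divr_ge0 ?(ltW q0)// ltr_pdivrMr// mul1r.
have /cvgrPdist_lt/(_ _ m0)[N _ /(_ N (leqnn N))] := cvg_expr r1.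
rewrite /= sub0r normrN ger0_norm ?exprn_ge0 ?divr_ge0 ?(ltW q0)//.
rewrite expr_div_n ltr_pdivrMr ?exprn_gt0// => h1.
by have := h N; rewrite leNgt h1.
Qed.

(* The mean of [H g ^+ n] counts the words of length [n] over [D] with sum zero, so it does
   not depend on the twist [g]; without a good [a] it would grow at a smaller rate for
   [g = h] than for [g = 0]. *)
Lemma kronecker_approx (h : {additive pontryagin_dual R A -> circle R})
    (s : seq (pontryagin_dual R A)) eta : 0 < eta ->
  exists a, forall chi, chi \in s -> 1 - eta <= cosc (ev chi a - h chi).
Proof.
move=> eta0; apply: contrapT => /forallNP noa.
have far a : exists2 chi, chi \in s & cosc (twisted h a chi) < 1 - eta.
  apply: contrapT => nochi; apply: (noa a) => chi chis.
  by rewrite leNgt; apply/negP => lt; apply: nochi; exists chi.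
(* Adjoining 0 puts each [chi] of [s] into [D] as [chi - 0]; a bad cosine at [chi] then lowers [H h]
   by [eta] below the trivial bound. *)
pose s0 := 0 :: s; pose D := difference_list s0.
pose H (g : {additive pontryagin_dual R A -> circle R}) a :=
  \sum_(chi <- D) cosc (twisted g a chi).
have Hsq g a : H g a = (\sum_(chi <- s0) cosc (twisted g a chi)) ^+ 2 +
    (\sum_(chi <- s0) sinc (twisted g a chi)) ^+ 2.
  by have [] := difference_listE (twisted g a) s0.
have MH g n : M (fun a => H g a ^+ n) = (count_mem 0 (sumset_iter D n))%:R.
  rewrite -(mean_twisted g); congr M; apply/funext => a.
  have [_ z] := difference_listE (twisted g a) s0.
  by have [-> _] := sumset_iterE n z.
pose N : R := (size D)%:R.
have H0 g a : 0 <= H g a by rewrite Hsq addr_ge0 ?sqr_ge0.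
have sumle1 (t : seq (pontryagin_dual R A)) g a :
    \sum_(chi <- t) cosc (twisted g a chi) <= (size t)%:R.
  rewrite (le_trans (ler_sum _ (fun i _ => cosc_le1 _)))//.
  by rewrite big_const_seq count_predT iter_addr_0.
have HN a : H h a <= N - eta.
  have [chi chis lt] := far a.
  have chiD : chi \in D.
    by apply/allpairsP; exists (chi, 0); rewrite /= !inE chis orbT eqxx subr0.
  rewrite /H (big_rem chi chiD)/= /N (perm_size (perm_to_rem chiD))/= -natr1.
  have := sumle1 (rem chi D) h a; lra.
have bH g n : bounded_fct (fun a => H g a ^+ n).
  by apply: boundedX; exists N => a; rewrite ger0_norm//; exact: sumle1.
pose z : {additive pontryagin_dual R A -> circle R} := \0.
have uH : ucont (H z).
  suff hu t : ucont (fun a => \sum_(chi <- t) cosc (twisted z a chi)) by exact: hu.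
  elim: t => [|chi D' ih].
    under eq_fun do rewrite big_nil.
    by apply: equicont_cst; exact: bounded_cst.
  under eq_fun do rewrite big_cons.
  apply: equicontD => //.
  have := continuous_ucont compactA (@cosc_ev_continuous chi); congr equicont.
  by apply/funext => _; apply/funext => a; rewrite /twisted subr0.
have HzN : H z 0 = N.
  rewrite /H /N (eq_bigr (fun=> 1)).
    by rewrite big_const_seq count_predT iter_addr_0.
  by move=> chi _; rewrite /twisted subr0 raddf0 cosc0.
have e2 : 0 < eta / 2 by rewrite divr_gt0.
(* The indicator of a set containing a neighbourhood of 0, where the untwisted sum attains its
   maximal value [N]. Its mean is positive and bounds the growth of the means from below. *)
pose b a : R := (N - eta / 2 <= H z a)%R%:R.
have bb : bounded_fct b by exists 1 => a; rewrite /b; case: (N - _ <= _); rewrite ?normr1 ?normr0.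
have Mb : 0 < M b.
  apply: (@mean_gt0 _ _ compactA _ MM b 0 1) => //.
  have [_ /(_ _ e2)] := uH; apply: filterS => u /(_ tt 0).
  rewrite add0r HzN ler_norml => /andP[hu _]; rewrite /b.
  by have -> : N - eta / 2 <= H z u by lra.
have NE : 0 <= N - eta by exact: le_trans (H0 h 0) (HN 0).
apply: (@geometric_contradiction (M b) (N - eta) (N - eta / 2)) => //; first by lra.
move=> n; apply: (@le_trans _ _ (M (fun a => H z a ^+ n))).
  rewrite mulrC -(pfZ PM)//; apply: (pf_le PM) => //.
    by apply: boundedM => //; exact: bounded_cst.
  move=> a; rewrite /b; case: (leP (N - eta / 2) (H z a)) => hN.
    by rewrite mulr1 lerXn2r// nnegrE; lra.
  by rewrite mulr0 exprn_ge0.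
rewrite MH -(MH h) -(pf_cst PM ((N - eta) ^+ n)); apply: (pf_le PM) => //.
  exact: bounded_cst.
by move=> a; rewrite lerXn2r// nnegrE.
Qed.

(** If every point misses [h] at some character, compactness provides finitely many characters and
    one tolerance witnessing this everywhere, against [kronecker_approx]. *)
Lemma eval_surjective (h : {additive pontryagin_dual R A -> circle R}) :
  exists a, forall chi, ev chi a = h chi.
Proof.
apply: contrapT => /forallNP noa.
have nc := (compact_near_coveringP [set: A]).1 compactA.
have : forall x, [set: A] x -> \forall y \near x & i \near
    filter_prod (@list_filter (pontryagin_dual R A)) (nbhs (\oo : set_system nat)),
    exists2 chi, chi \in i.1 & cosc (ev chi y - h chi) < 1 - i.2.+1%:R^-1.
  move=> a _; have /existsNP[chi /eqP chiP] := noa a.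
  pose ca := cosc (ev chi a - h chi); have c1 : 0 < 1 - ca.
    rewrite subr_gt0 lt_neqAle cosc_le1 andbT; apply: contra chiP.
    by move=> /eqP/cosc_eq1/eqP; rewrite subr_eq0.
  have e2 : 0 < (1 - ca) / 2 by rewrite divr_gt0.
  have cont : continuous (fun y => cosc (ev chi y - h chi)).
    have -> : (fun y => cosc (ev chi y - h chi)) = (fun y => cosc (ev chi y) * cosc (h chi)
        + sinc (ev chi y) * sinc (h chi)).
      by apply/funext => y; rewrite coscD coscN sincN mulrN opprK.
    move=> y; apply: cvgD; apply: cvgM; try exact: cvg_cst.
      exact: cosc_ev_continuous.
    exact: sinc_ev_continuous.
  have /cvgrPdist_lt/(_ _ e2) := cont a.
  move=> near_a; exists ([set y | `|ca - cosc (ev chi y - h chi)| < (1 - ca) / 2],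
    [set i : seq (pontryagin_dual R A) * nat | chi \in i.1 /\ i.2.+1%:R^-1 < (1 - ca) / 2]).
    split=> //; exists ([set t : seq (pontryagin_dual R A) | chi \in t], [set n | n.+1%:R^-1 < (1 - ca) / 2]).
      split; first exact: list_filter_mem.
      exact: (near_infty_natSinv_lt (PosNum e2)).
    by move=> [t n] [].
  move=> [y i] [/= hy [chi_i ni]]; exists chi => //.
  move: hy; rewrite ltr_norml => /andP[hy _].
  by move: hy ni; move: (cosc _) (i.2.+1%:R^-1) => u v; lra.
move=> /(nc _ _ (fun (i : seq (pontryagin_dual R A) * nat) y =>
  exists2 chi, chi \in i.1 & cosc (ev chi y - h chi) < 1 - i.2.+1%:R^-1) _).
move=> [[S T] [[s0 hs0] [n _ hn]] hST].
have n0 : 0 < (n.+1%:R^-1 : R) by rewrite invr_gt0.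
have [a ha] := @kronecker_approx h s0 _ n0.
have [] := hST (s0, n) _ a I; first by split; [exact: hs0|exact: (hn n (leqnn n))].
by move=> chi chis; rewrite ltNge ha.
Qed.

(** The complement of the interior of [U] is compact and avoids 0; finitely many characters and one
    tolerance separate all of it from 0. *)
Lemma nbhs0_characters (U : set A) : nbhs 0 U -> exists (s : seq (pontryagin_dual R A)) (d : R),
  0 < d /\ forall a, (forall chi, chi \in s -> small d (ev chi a)) -> U a.
Proof.
move=> U0; pose K := ~` (U^°%classic).
have cK : compact K.
  apply: (@subclosed_compact _ _ [set: A]) => //.
  by apply: open_closedC; exact: open_interior.
have nc := (compact_near_coveringP K).1 cK.
have : forall x, K x -> \forall y \near x & i \near
    filter_prod (@list_filter (pontryagin_dual R A)) (nbhs (\oo : set_system nat)),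
    ~ (forall chi, chi \in i.1 -> small i.2.+1%:R^-1 (ev chi y)).
  move=> a Ka.
  have a0 : a != 0 by apply/eqP => a0; apply: Ka; rewrite a0.
  have [chi chia] := characters_separate a0.
  pose ca := cosc (ev chi a); have c1 : 0 < 1 - ca.
    by rewrite subr_gt0 lt_neqAle cosc_le1 andbT; apply: contra chia => /eqP/cosc_eq1 ->.
  have e2 : 0 < (1 - ca) / 2 by rewrite divr_gt0.
  have [d d0 hd] := small_cos e2.
  have /cvgrPdist_lt/(_ _ e2) := @cosc_ev_continuous chi a.
  move=> near_a; exists ([set y | `|ca - cosc (ev chi y)| < (1 - ca) / 2],
    [set i : seq (pontryagin_dual R A) * nat | chi \in i.1 /\ i.2.+1%:R^-1 < d]).
    split=> //; exists ([set t : seq (pontryagin_dual R A) | chi \in t], [set n | n.+1%:R^-1 < d]).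
      split; first exact: list_filter_mem.
      exact: (near_infty_natSinv_lt (PosNum d0)).
    by move=> [t n] [].
  move=> [y i] [/= hy [chi_i ni]] sm.
  have := hd _ (small_le (ltW ni) (sm _ chi_i)).
  move: hy; rewrite ltr_norml => /andP[hy hy'].
  by move: hy hy'; move: (cosc (ev chi y)) => u; lra.
move=> /(nc _ _ (fun (i : seq (pontryagin_dual R A) * nat) y =>
  ~ (forall chi, chi \in i.1 -> small i.2.+1%:R^-1 (ev chi y))) _).
move=> [[S T] [[s0 hs0] [n _ hn]] hST].
exists s0, n.+1%:R^-1; split; first by rewrite invr_gt0.
move=> a ha; apply: contrapT => nUa.
apply: (hST (s0, n) _ a) => //; first by split; [exact: hs0|exact: (hn n (leqnn n))].
by move=> /interior_subset.
Qed.

End Evaluation.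

(** * Shadowing for sequences of homomorphisms *)

Definition subgroup (X : zmodType) (P : set X) :=
  P 0 /\ forall x y, P x -> P y -> P (x - y).

Section Subgroups.
Variables (X : zmodType) (P : set X).
Hypothesis sP : subgroup P.

Lemma subgroupN x : P x -> P (- x).
Proof. by move=> Px; rewrite -sub0r; apply: sP.2 => //; exact: sP.1. Qed.

Lemma subgroupD x y : P x -> P y -> P (x + y).
Proof. by move=> Px Py; rewrite -[y]opprK; apply: sP.2 => //; exact: subgroupN. Qed.

Lemma subgroupMn x n : P x -> P (x *+ n).
Proof.
by move=> Px; elim: n => [|n ih]; [exact: sP.1|rewrite mulrS; exact: subgroupD].
Qed.

Lemma subgroupMz x z : P x -> P (x *~ z).
Proof.
by move=> Px; case: z => n; [|rewrite NegzE mulrNz; apply: subgroupN]; exact: subgroupMn.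
Qed.

(** [n] generates the ideal of integers taking [x] into [P]; [n = 0] encodes infinite order modulo
    [P]. *)
Lemma subgroup_order x : exists n : nat, P (x *+ n) /\
  forall k : int, P (x *~ k) -> exists q : int, k = n%:Z * q.
Proof.
have [[n [n0 Pn]]|nex] := pselect (exists n : nat, (0 < n)%N /\ P (x *+ n)).
  have ex : exists n, (0 < n)%N && `[< P (x *+ n) >].
    by exists n; rewrite n0; exact/asboolP.
  case: (ex_minnP ex) => m /andP[m0 /asboolP Pm] minm; exists m; split=> // k Pk.
  exists (k %/ m)%Z; rewrite mulrC; move: (divz_eq k m) => kE.
  have Pr : P (x *~ (k %% m)%Z).
    have -> : (k %% m)%Z = k - m%:Z * (k %/ m)%Z by rewrite {2}kE mulrC addrAC subrr add0r.
    by rewrite mulrzBr mulrzA; apply: sP.2 => //; exact: subgroupMz.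
  have r0 : 0 <= (k %% m)%Z by rewrite modz_ge0// -lt0n.
  have rm : (k %% m)%Z < m by rewrite ltz_pmod.
  move: kE r0 rm Pr; case: (k %% m)%Z => // r kE _ rm Pr.
  case: (posnP r) => [r00|r0]; first by move: kE; rewrite r00 addr0.
  have : (0 < r)%N && `[< P (x *+ r) >] by rewrite r0; exact/asboolP.
  by move=> /minm; rewrite leqNgt; move: rm; rewrite ltz_nat => ->.
exists 0%N; split; first exact: sP.1.
move=> k Pk; exists 0; rewrite mulr0; apply/eqP; apply: contrapT => /negP k0.
apply: nex; exists `|k|%N; split; first by rewrite absz_gt0.
have [kp|kn] := leP 0 k; first by move: Pk; rewrite -{1}(gez0_abs kp).
by have := subgroupN Pk; rewrite -mulrNz -(ltz0_abs kn).
Qed.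

End Subgroups.

(** * Homomorphisms into divisible groups *)

Section Extension.
Variables (X D : zmodType).
Hypothesis divisibleD : forall (d : D) n, (0 < n)%N -> exists d', d' *+ n = d.

(** Partial homomorphisms as graphs: unions of chains and one-step extensions become operations on
    sets. *)
Definition hom_graph (G : set (X * D)) := subgroup G /\ forall d, G (0, d) -> d = 0.

Lemma hom_graph_fun G x d d' : hom_graph G -> G (x, d) -> G (x, d') -> d = d'.
Proof.
move=> [[_ GB] G0] xd xd'; have := GB _ _ xd xd'.
by rewrite -[(x, d) - (x, d')]/(x - x, d - d') subrr => /G0/eqP; rewrite subr_eq0 => /eqP.
Qed.

(** [d] is a value at [x0] compatible with [G]: an [n]-th part of the value at [x0 *+ n], where [n]
    is the order of [x0] modulo the domain. For infinite order it is free and taken to be 0. *)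
Lemma hom_graph_step G x0 : hom_graph G -> exists d, forall k y, G (x0 *~ k, y) -> y = d *~ k.
Proof.
move=> hG; have [sG G0] := hG.
pose dom := [set x | exists y, G (x, y)].
have sdom : subgroup dom.
  split; first by exists 0; exact: sG.1.
  by move=> x x' [y xy] [y' xy']; exists (y - y'); exact: (sG.2 _ _ xy xy').
have [n [[g ng] hn]] := subgroup_order sdom x0.
have [d dn] : exists d, d *+ n = g.
  case: n ng {hn} => [|n] ng; last exact: divisibleD.
  by exists 0; rewrite mulr0n (G0 g).
exists d => k y ky; have [|q kq] := hn k; first by exists y.
have mz (p : X * D) z : p *~ z = (p.1 *~ z, p.2 *~ z).
  have mn m : p *+ m = (p.1 *+ m, p.2 *+ m).
    by elim: m => // m ih; rewrite !mulrS ih.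
  by case: z => m; rewrite ?NegzE ?mulrNz -!pmulrn mn.
have := subgroupMz sG q ng; rewrite mz/= => h.
apply: hom_graph_fun hG ky _; move: h.
by rewrite -dn kq !mulrzA -!pmulrn.
Qed.

(** Divisible groups are injective: Zorn's lemma on graphs, as in Baer's argument. *)
Lemma hom_extension (G : set (X * D)) : hom_graph G ->
  exists h : {additive X -> D}, forall x d, G (x, d) -> h x = d.
Proof.
move=> hG; have [sG G0] := hG.
pose good (H : set (X * D)) := H = set0 \/ (hom_graph H /\ G `<=` H).
have [H [goodH maxH]] : exists H, good H /\ forall H', H `<` H' -> ~ good H'.
  apply: Zorn_bigcup => F FP tF.
  have [[H FH HN0]|allN] := pselect (exists2 H, F H & H !=set0); last first.
    left; rewrite -subset0 => p [H FH Hp]; apply: allN; exists H => //; by exists p.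
  have goodF H' p : F H' -> H' p -> hom_graph H' /\ G `<=` H'.
    by move=> /FP[->|].
  have [p Hp] := HN0.
  right; split; last first.
    by move=> q Gq; exists H => //; exact: (goodF H p FH Hp).2.
  split; first split.
  - by exists H => //; exact: (goodF H p FH Hp).1.1.1.
  - move=> x y [H1 F1 H1x] [H2 F2 H2y].
    have [H12|H21] := tF _ _ F1 F2.
      by exists H2 => //; apply: (goodF H2 y F2 H2y).1.1.2 => //; exact: H12.
    by exists H1 => //; apply: (goodF H1 x F1 H1x).1.1.2 => //; exact: H21.
  - by move=> d [H1 F1 H1d]; exact: (goodF H1 _ F1 H1d).1.2.
have [hH GH] : hom_graph H /\ G `<=` H.
  case: goodH => // H0; exfalso; apply: (maxH G); last by right; split.
  rewrite H0; split; first by move=> ?.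
  by move=> /(_ (0, 0) sG.1).
have [sH H0] := hH.
have total x : exists d, H (x, d).
  apply: contrapT => nx; have [d hd] := hom_graph_step x hH.
  pose H' := [set p : X * D | exists q k, H q /\ p = (q.1 + x *~ k, q.2 + d *~ k)].
  apply: (maxH H').
    split; first by move=> q Hq; exists q, 0; rewrite !mulr0z !addr0; case: q Hq.
    move=> /(_ (x, d)) h; apply: nx; exists d; apply: h.
    by exists (0, 0), 1; split; [exact: sH.1|rewrite /= !add0r !mulr1z].
  right; split; last first.
    by move=> q /GH Hq; exists q, 0; rewrite !mulr0z !addr0; case: q Hq.
  split; first split.
  - by exists (0, 0), 0; split; [exact: sH.1|rewrite /= !mulr0z !addr0].
  - move=> _ _ [q [k [Hq ->]]] [q' [k' [Hq' ->]]].
    exists (q - q'), (k - k'); split; first exact: sH.2.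
    by rewrite !mulrzBr /=; congr (_, _) => /=; rewrite opprD addrACA.
  - move=> y [q [k [Hq [e1 ->]]]].
    have := subgroupN sH Hq; case: q Hq e1 => a b /= Hq e1.
    have -> : - (a, b) = (x *~ k, - b).
      by congr (_, _); apply/eqP; rewrite eq_sym -addr_eq0 addrC -e1.
    by move=> /hd <-; rewrite subrr.
have /choice[h hP] : forall x, exists d, H (x, d) by exact: total.
have hB : zmod_morphism h.
  by move=> x y; apply: (hom_graph_fun hH (hP (x - y))); exact: (sH.2 _ _ (hP x) (hP y)).
pose hom : {additive X -> D} := HB.pack h (GRing.isZmodMorphism.Build X D h hB).
exists hom => x d /GH xd.
exact: (hom_graph_fun hH (hP x) xd).
Qed.

Lemma hom_extend1 (P : set X) (h : {additive X -> D}) x0 n d : subgroup P ->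
  (forall k : int, P (x0 *~ k) -> exists q : int, k = n%:Z * q) -> d *+ n = h (x0 *+ n) ->
  exists h' : {additive X -> D}, (forall x, P x -> h' x = h x) /\ h' x0 = d.
Proof.
move=> sP ord dn.
pose G := [set p : X * D | exists x k, P x /\ p = (x + x0 *~ k, h x + d *~ k)].
have hG : hom_graph G.
  split; first split.
  - by exists 0, 0; split; [exact: sP.1|rewrite /= !mulr0z !addr0 raddf0].
  - move=> _ _ [q [k [Hq ->]]] [q' [k' [Hq' ->]]].
    exists (q - q'), (k - k'); split; first exact: sP.2.
    by rewrite !mulrzBr raddfB; congr (_, _) => /=; rewrite opprD addrACA.
  - move=> y [x [k [Px [e1 ->]]]].
    have xE : x0 *~ k = - x by apply/eqP; rewrite -addr_eq0 addrC -e1.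
    have [|q kq] := ord k; first by rewrite xE; exact: subgroupN.
    have -> : d *~ k = h (x0 *~ k) by rewrite kq !mulrzA -!pmulrn dn -raddfMz.
    by rewrite xE raddfN subrr.
have [h' hh] := hom_extension hG; exists h'; split.
- move=> x Px; apply: hh; exists x, 0; split=> //; by rewrite !mulr0z !addr0.
- by apply: hh; exists 0, 1; split; [exact: sP.1|rewrite !mulr1z raddf0 !add0r].
Qed.

End Extension.

Section SmallExtension.
Variables (R : realType) (X : zmodType).
Local Notation TT := (circle R).

Lemma circle_divisible (u : TT) n : (0 < n)%N -> exists v, v *+ n = u.
Proof.
move=> n0; have [t ->] := expi_surj u; exists (expi (t / n%:R)).
by rewrite -raddfMn -(mulr_natr (t / n%:R)) divfK// pnatr_eq0 -lt0n.
Qed.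

(** The elements of [s] are adjoined one at a time. The control data [s'] and [d] do not depend on
    [h], so they serve all members of a sequence of homomorphisms. *)
Lemma small_extension (P : set X) (s : seq X) (e : R) : subgroup P -> 0 < e ->
  exists (s' : seq X) (d : R), [/\ 0 < d, forall x, x \in s' -> P x &
    forall h : {additive X -> TT}, (forall x, x \in s' -> small d (h x)) ->
    exists h' : {additive X -> TT}, (forall x, P x -> h' x = h x) /\
      forall x, x \in s -> small e (h' x)].
Proof.
move=> + e0; elim: s P => [|f s ih] P sP.
  by exists [::], 1; split=> // h _; exists h.
pose P1 := [set x | exists y k, P y /\ x = y + f *~ k].
have sP1 : subgroup P1.
  split; first by exists 0, 0; split; [exact: sP.1|rewrite mulr0z addr0].
  move=> _ _ [q [k [Hq ->]]] [q' [k' [Hq' ->]]].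
  exists (q - q'), (k - k'); split; first exact: sP.2.
  by rewrite mulrzBr opprD addrACA.
have PP1 x : P x -> P1 x by move=> Px; exists x, 0; rewrite mulr0z addr0.
have P1f : P1 f by exists 0, 1; split; [exact: sP.1|rewrite mulr1z add0r].
have [s1 [d1 [d10 s1P hs1]]] := ih _ sP1.
have /choice[dec decP] : forall x, exists p : X * int, P1 x -> P p.1 /\ x = p.1 + f *~ p.2.
  move=> x; have [[y [k [Py xE]]]|nP] := pselect (P1 x); first by exists (y, k).
  by exists (0, 0) => /nP.
(* [K] bounds the coefficient of [f] in each element of [s1]; with [eta] at most [d1 / 2 / K], half
   of [d1] is left for the component in [P]. *)
pose K : R := 1 + \sum_(x <- s1) `|(dec x).2|%:~R.
have K0 : 0 < K by rewrite ltr_wpDr// sumr_ge0.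
have KP x : x \in s1 -> `|(dec x).2|%:~R <= K.
  move=> xs; rewrite /K (big_rem x xs)/= addrCA lerDl addr_ge0// sumr_ge0//.
pose eta := Num.min e (d1 / 2 / K).
have eta0 : 0 < eta by rewrite lt_min e0 !divr_gt0.
pose d := Num.min eta (d1 / 2).
have d0 : 0 < d by rewrite lt_min eta0 divr_gt0.
have [n [Pn ord]] := subgroup_order sP f.
exists ((f *+ n) :: [seq (dec x).1 | x <- s1]), d; split=> //.
  move=> x; rewrite inE => /orP[/eqP ->//|/mapP[y ys ->]].
  by have [] := decP y (s1P y ys).
move=> h hsmall.
(* The real lift of [h (f *+ n)] is divided by [n], which keeps it small; for infinite order the
   value is 0. *)
have [v [vn vsmall]] : exists v, v *+ n = h (f *+ n) /\ small eta v.
  have [t td ht] := hsmall _ (mem_head _ _).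
  case: n Pn ord hsmall ht => [|n] _ _ _ ht.
    by exists 0; split; [rewrite !mulr0n raddf0|apply: small0; exact: ltW].
  exists (expi (t / n.+1%:R)); split.
    by rewrite ht -raddfMn -(mulr_natr (t / n.+1%:R)) divfK// pnatr_eq0.
  exists (t / n.+1%:R) => //; rewrite normrM normfV [`|n.+1%:R|]ger0_norm// ler_pdivrMr//.
  have de : d <= eta by rewrite ge_min lexx.
  by rewrite (le_trans td)// (le_trans de)// ler_peMr ?ler1n// ltW.
have [h1 [h1P h1f]] := hom_extend1 circle_divisible sP ord vn.
have [|h' [h'P h's]] := hs1 h1.
  move=> x xs; have [Py xE] := decP x (s1P x xs).
  rewrite xE raddfD h1P// raddfMz h1f [d1]splitr; apply: smallD.
    apply: (@small_le _ d); first by rewrite ge_min lexx orbT.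
    by apply: hsmall; rewrite inE; apply/orP; right; apply/mapP; exists x.
  apply: (@small_le _ (`|(dec x).2|%:~R * eta)); last exact: smallMz.
  apply: (@le_trans _ _ (K * eta)); first by rewrite ler_wpM2r ?KP// ltW.
  by rewrite mulrC -ler_pdivlMr// ge_min lexx orbT.
exists h'; split; first by move=> x Px; rewrite h'P ?h1P//; exact: PP1.
move=> x; rewrite inE => /orP[/eqP ->|/h's//].
by rewrite h'P// h1f; apply: small_le vsmall; rewrite ge_min lexx.
Qed.

End SmallExtension.

(** * Relative shadowing and extensions *)

Section Orbits.
Variables (R : realType) (X : zmodType) (T : {additive X -> X}).
Local Notation hom := {additive X -> circle R}.
Implicit Types (z y : hom) (e : nat -> hom) (P Q : set X).

Fixpoint orb z e n : hom :=
  if n is n'.+1 then ((orb z e n' \o T) \+ e n' : hom) else z.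

Lemma orbS z e n x : orb z e n.+1 x = orb z e n (T x) + e n x.
Proof. by []. Qed.

Lemma orbD z e n k x : orb z e (n + k) x =
  orb z e n (iter k T x) + \sum_(l < k) e (n + l)%N (iter (k - l.+1) T x).
Proof.
elim: k x => [|k ih] x; first by rewrite big_ord0 addr0 addn0.
rewrite addnS orbS ih -iterSr big_ord_recr/= subnn -addrA; congr (_ + (_ + _)).
apply: eq_bigr => l _; rewrite -iterSr subSn//.
Qed.

(** The relative form: homomorphisms vanishing on [P] are those of the quotient by [P], and the
    orbit is tested on finite subsets of [Q]. The error control is chosen before the errors. *)
Definition shadow P Q := forall (s : seq X) (eps : R), (forall x, x \in s -> Q x) -> 0 < eps ->
  exists (s' : seq X) (d : R), 0 < d /\
    forall e, (forall n x, P x -> e n x = 0) -> (forall n x, x \in s' -> small d (e n x)) ->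
    exists z, (forall x, P x -> z x = 0) /\
      forall n x, x \in s -> small eps (orb z e n x).

Lemma shadow_union P Q :
  (forall s : seq X, (forall x, x \in s -> Q x) ->
     exists Q', (forall x, x \in s -> Q' x) /\ shadow P Q') -> shadow P Q.
Proof. by move=> h s eps sQ; have [Q' [sQ']] := h s sQ; apply. Qed.

(** The first solution has a small orbit on [Q]; each term is restricted to [Q] and extended to a
    small [y n] on the whole group. The error that [y] leaves over vanishes on [Q], so the second
    property applies to it. *)
Lemma shadow_trans P Q S : subgroup Q -> (forall x, Q x -> Q (T x)) ->
  P `<=` Q -> shadow P Q -> shadow Q S -> shadow P S.
Proof.
move=> sQ QT PQ PQs QSs s eps sS eps0.
have e2 : 0 < eps / 2 by rewrite divr_gt0.
have [s2 [d2 [d20 h2]]] := QSs s _ sS e2.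
(* Thirds of [d2] for the three terms of the corrected error: [e n], [y n.+1] and [y n] after
   [T]. *)
pose d := Num.min (eps / 2) (d2 / 3).
have d0 : 0 < d by rewrite lt_min e2 divr_gt0.
have [s1 [d1 [d10 s1Q h1]]] := small_extension (s ++ s2 ++ [seq T x | x <- s2]) sQ d0.
have [s0 [d00 [d000 h0]]] := PQs s1 _ s1Q d10.
exists (s0 ++ s2), (Num.min d00 (d2 / 3)); split; first by rewrite lt_min d000 divr_gt0.
move=> e eP esmall.
have [z1 [z1P z1small]] : exists z, (forall x, P x -> z x = 0) /\
      forall n x, x \in s1 -> small d1 (orb z e n x).
  apply: h0 => // n x xs; apply: (@small_le _ (Num.min d00 (d2 / 3))).
    by rewrite ge_min lexx.
  by apply: esmall; rewrite mem_cat xs.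
have /choice[y yP] : forall n, exists y : hom, (forall x, Q x -> y x = orb z1 e n x) /\
    forall x, x \in s ++ s2 ++ [seq T x | x <- s2] -> small d (y x).
  by move=> n; apply: h1 => x xs; exact: z1small.
(* On [Q], where [y] agrees with the orbit of [z1], the subtracted coboundary is exactly [e n]. *)
pose e' n : hom := (e n \- (y n.+1 \- (y n \o T)) : hom).
have e'E n x : e' n x = e n x - (y n.+1 x - y n (T x)) by [].
have e'Q n x : Q x -> e' n x = 0.
  move=> Qx; rewrite e'E (yP n.+1).1// (yP n).1; last exact: QT.
  by rewrite orbS addrAC subrr add0r subrr.
have e'small n x : x \in s2 -> small d2 (e' n x).
  move=> xs; rewrite e'E.
  have -> : d2 = d2 / 3 + (d2 / 3 + d2 / 3) by field.
  have dd : d <= d2 / 3 by rewrite ge_min lexx orbT.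
  apply: smallB.
    apply: (@small_le _ (Num.min d00 (d2 / 3))); first by rewrite ge_min lexx orbT.
    by apply: esmall; rewrite mem_cat xs orbT.
  apply: smallB; apply: (small_le dd).
    by apply: (yP n.+1).2; rewrite !mem_cat xs orbT.
  by apply: (yP n).2; rewrite !mem_cat map_f ?orbT.
have [z2 [z2Q z2small]] := h2 e' e'Q e'small.
pose z : hom := (y 0%N \+ z2 : hom).
exists z; split.
  move=> x Px; have Qx := PQ _ Px.
  by rewrite /z /= (yP 0%N).1//= z1P// z2Q// addr0.
have orbE n x : orb z e n x = y n x + orb z2 e' n x.
  elim: n x => [//|n ih] x; rewrite !orbS ih e'E.
  have -> : e n x - (y n.+1 x - y n (T x)) = y n (T x) + e n x - y n.+1 x.
    by rewrite opprB addrCA addrA.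
  rewrite [orb z2 e' n (T x) + _]addrA [y n.+1 x + _]addrC subrK addrA.
  by rewrite [orb _ _ _ _ + y _ _]addrC.
move=> n x xs; rewrite orbE [eps]splitr; apply: smallD; last exact: z2small.
apply: (@small_le _ d); first by rewrite ge_min lexx.
by apply: (yP n).2; rewrite mem_cat xs.
Qed.

End Orbits.

(** * Bounded solutions of linear recurrences *)

Section Recurrence.
Variable R : realType.
Local Notation C := R[i].
Local Notation normc := (@ComplexField.Normc.normc R).

Definition poly_shift (K : nzRingType) (p : {poly K}) (a : nat -> K) n :=
  \sum_(i < size p) p`_i * a (n + i)%N.

Lemma poly_shiftE (K : nzRingType) (p : {poly K}) a n m : (size p <= m)%N ->
  poly_shift p a n = \sum_(i < m) p`_i * a (n + i)%N.
Proof.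
move=> pm; rewrite /poly_shift (big_ord_widen _ (fun i => p`_i * a (n + i)%N) pm).
rewrite big_mkcond; apply: eq_bigr => i _; case: ltnP => // h.
by rewrite nth_default// mul0r.
Qed.

Lemma poly_shiftD (K : nzRingType) (p q : {poly K}) a n :
  poly_shift (p + q) a n = poly_shift p a n + poly_shift q a n.
Proof.
pose m := maxn (size p) (size q).
rewrite (@poly_shiftE _ _ _ _ m) ?size_polyD// (@poly_shiftE _ p _ _ m) ?leq_maxl//.
rewrite (@poly_shiftE _ q _ _ m) ?leq_maxr// -big_split; apply: eq_bigr => i _.
by rewrite coefD mulrDl.
Qed.

Lemma poly_shiftZ (K : nzRingType) c (p : {poly K}) a n :
  poly_shift (c *: p) a n = c * poly_shift p a n.
Proof.
rewrite (@poly_shiftE _ _ _ _ (size p)) ?size_scale_leq// mulr_sumr.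
by apply: eq_bigr => i _; rewrite coefZ mulrA.
Qed.

Lemma poly_shiftXn (K : nzRingType) (p : {poly K}) k a n :
  poly_shift (p * 'X^k) a n = poly_shift p a (n + k)%N.
Proof.
rewrite (@poly_shiftE _ _ _ _ (k + size p)); last first.
  by rewrite (leq_trans (size_polyMleq _ _))// size_polyXn addnS/= addnC.
rewrite big_split_ord/= big1 ?add0r; last by move=> i _; rewrite coefMXn ltn_ord mul0r.
apply: eq_bigr => i _; rewrite coefMXn ltnNge leq_addr/= addKn.
by rewrite addnA.
Qed.

Lemma poly_shiftM (K : comNzRingType) (p q : {poly K}) a n :
  poly_shift (p * q) a n = poly_shift p (poly_shift q a) n.
Proof.
rewrite -{1}[p]coefK poly_def mulr_suml.
rewrite {2}/poly_shift.
have sum0 (I : Type) (r : seq I) (F : I -> {poly K}) :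
    poly_shift (\sum_(i <- r) F i) a n = \sum_(i <- r) poly_shift (F i) a n.
  elim: r => [|i r ih]; first by rewrite !big_nil /poly_shift size_poly0 big_ord0.
  by rewrite !big_cons poly_shiftD ih.
rewrite sum0; apply: eq_bigr => i _.
by rewrite -scalerAl poly_shiftZ mulrC -['X^_ * q]commr_polyXn poly_shiftXn mulrC.
Qed.

(** With a factor [B] uniform in [g] the property passes to products, and so reduces to linear
    factors. *)
Definition bounded_solvable (p : {poly C}) := exists B : R, 0 <= B /\
  forall (g : nat -> C) d, (forall n, normc (g n) <= d) ->
  exists a, (forall n, normc (a n) <= B * d) /\ forall n, poly_shift p a n = g n.

Lemma bounded_solvableM p q : bounded_solvable p -> bounded_solvable q ->
  bounded_solvable (p * q).
Proof.
move=> [B [B0 hp]] [B' [B'0 hq]]; exists (B' * B); split; first exact: mulr_ge0.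
move=> g d gd; have [a [ab ag]] := hp g d gd; have [b [bb bg]] := hq a _ ab.
exists b; split; first by move=> n; rewrite -mulrA.
by move=> n; rewrite poly_shiftM -ag /poly_shift; apply: eq_bigr => i _; rewrite -bg.
Qed.

Lemma bounded_solvableC c : c != 0 -> bounded_solvable c%:P.
Proof.
move=> c0; exists (normc c^-1); split; first by rewrite -ler0c; exact: (normr_ge0 c^-1).
move=> g d gd; exists (fun n => c^-1 * g n); split.
  move=> n; rewrite ComplexField.Normc.normcM ler_wpM2l//.
  by rewrite -ler0c; exact: (normr_ge0 c^-1).
by move=> n; rewrite /poly_shift size_polyC c0 big_ord1 coefC eqxx addn0 mulrA mulfV// mul1r.
Qed.

Lemma poly_shiftXsubC (r : C) a n : poly_shift ('X - r%:P) a n = a n.+1 - r * a n.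
Proof.
rewrite /poly_shift size_XsubC !big_ord_recl big_ord0 addr0 !coefB !coefX !coefC/=.
by rewrite addn0 addn1 sub0r subr0 mul1r mulNr addrC.
Qed.

(** Forward iteration from 0; the bound is a geometric series. *)
Lemma bounded_solvable_contracting r : normc r < 1 -> bounded_solvable ('X - r%:P).
Proof.
move=> r1; have r0 : 0 <= normc r by rewrite -ler0c; exact: (normr_ge0 r).
have p0 : 0 < 1 - normc r by rewrite subr_gt0.
exists (1 - normc r)^-1; split; first by rewrite invr_ge0 ltW.
move=> g d gd; have d0 : 0 <= d.
  by apply: le_trans (gd 0%N); rewrite -ler0c; exact: (normr_ge0 (g 0%N)).
pose a := fix a n := if n is n'.+1 then r * a n' + g n' else 0.
exists a; split; last by move=> n; rewrite poly_shiftXsubC/= addrAC subrr add0r.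
elim=> [|n ih] /=; first by rewrite expr0n/= addr0 sqrtr0 mulr_ge0 ?invr_ge0// ltW.
rewrite (le_trans (le_normcD _ _))// ComplexField.Normc.normcM.
have -> : (1 - normc r)^-1 * d = normc r * ((1 - normc r)^-1 * d) + d.
  by field; exact: lt0r_neq0.
by rewrite lerD// ler_wpM2l.
Qed.

(** An expanding factor is solved backwards from infinity: solutions vanishing at time [N] are
    bounded independently of [N], and their ultralimit in [N] is a solution. *)
Lemma bounded_solvable_expanding r : 1 < normc r -> bounded_solvable ('X - r%:P).
Proof.
move=> r1; have p0 : 0 < normc r - 1 by rewrite subr_gt0.
have rp : 0 < normc r by exact: lt_trans r1.
have r0 : r != 0 by apply: contraTneq rp => ->; rewrite ComplexField.Normc.normc0 ltxx.
(* The factor 2 pays for bounding the ultralimits of real and imaginary parts separately. *)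
exists (2 * (normc r - 1)^-1); split; first by rewrite mulr_ge0// invr_ge0 ltW.
move=> g d gd; have d0 : 0 <= d.
  by apply: le_trans (gd 0%N); rewrite -ler0c; exact: (normr_ge0 (g 0%N)).
(* [back m n] is the value at time [n] of the solution that vanishes at time [n + m]. *)
pose back := fix back m n := if m is m'.+1 then r^-1 * (back m' n.+1 - g n) else 0 : C.
have back_le m n : normc (back m n) <= (normc r - 1)^-1 * d.
  elim: m n => [|m ih] n /=.
    by rewrite expr0n/= addr0 sqrtr0 mulr_ge0 ?invr_ge0// ltW.
  rewrite ComplexField.Normc.normcM ComplexField.Normc.normcV mulrC ler_pdivrMr//.
  rewrite (le_trans (le_normcD _ _))// normcN.
  have -> : (normc r - 1)^-1 * d * normc r = (normc r - 1)^-1 * d + d.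
    by field; exact: lt0r_neq0.
  by rewrite lerD.
have [L [PL LM Lle]] := ultralimit_exists R (@eventually_filter : ProperFilter \oo).
have ReIm (w : C) B : normc w <= B -> `|complex.Re w| <= B /\ `|complex.Im w| <= B.
  move=> wB; split; apply: le_trans wB; case: w => x y /=; rewrite -sqrtr_sqr ler_wsqrtr//.
    by rewrite lerDl sqr_ge0.
  by rewrite lerDr sqr_ge0.
(* The terminal time [N] is now the variable; truncated subtraction makes the value 0 for
   [N <= n]. *)
pose re n N := complex.Re (back (N - n)%N n).
pose im n N := complex.Im (back (N - n)%N n).
have bre n : bounded_fct (re n) by exists ((normc r - 1)^-1 * d) => N; exact: (ReIm _ _ (back_le _ _)).1.
have bim n : bounded_fct (im n) by exists ((normc r - 1)^-1 * d) => N; exact: (ReIm _ _ (back_le _ _)).2.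
have Leq f f' : bounded_fct f -> bounded_fct f' -> (\forall N \near \oo, f N = f' N) -> L f = L f'.
  move=> bf bf' ff'; apply/eqP; rewrite eq_le; apply/andP; split; apply: Lle => //;
    by apply: filterS ff' => N /= ->.
pose a n := L (re n) +i* L (im n) : C.
exists a; split.
  move=> n; rewrite /a -mulrA mulr2n mulrDl mul1r.
  have h1 : `|L (re n)| <= (normc r - 1)^-1 * d.
    by apply: (pf_norm PL) => N; exact: (ReIm _ _ (back_le _ _)).1.
  have h2 : `|L (im n)| <= (normc r - 1)^-1 * d.
    by apply: (pf_norm PL) => N; exact: (ReIm _ _ (back_le _ _)).2.
  have -> : L (re n) +i* L (im n) = (L (re n) +i* 0) + (0 +i* L (im n)).
    by apply/eqP; rewrite eq_complex/= addr0 add0r !eqxx.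
  rewrite (le_trans (le_normcD _ _))// lerD//=.
    by rewrite expr0n addr0 sqrtr_sqr.
  by rewrite expr0n add0r sqrtr_sqr.
move=> n; rewrite poly_shiftXsubC.
have step : \forall N \near \oo, r * back (N - n)%N n = back (N - n.+1)%N n.+1 - g n.
  exists n.+1 => // N /= nN; rewrite -(subnSK nN) /= mulrA mulfV// mul1r.
  by rewrite subnS.
have Ldec c1 c2 f f' : bounded_fct f -> bounded_fct f' ->
    L (fun N => c1 * f N + c2 * f' N) = c1 * L f + c2 * L f'.
  move=> bf bf'; rewrite (pfD PL) ?(pfZ PL)//; apply: boundedM => //; exact: bounded_cst.
have bl c f : bounded_fct f -> bounded_fct (fun N : nat => c * f N).
  by move=> bf; apply: boundedM => //; exact: bounded_cst.
have eqre : complex.Re r * L (re n) + (- complex.Im r) * L (im n) = L (re n.+1) - complex.Re (g n).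
  rewrite -Ldec// -[complex.Re (g n)](pf_cst PL) -(pfB PL)//; last exact: bounded_cst.
  apply: Leq; [by apply: boundedD; exact: bl|by apply: boundedB => //; exact: bounded_cst|].
  apply: filterS step => N /(congr1 (@complex.Re R)) /=.
  rewrite /re /im; case: (back (N - n)%N n) => x y; case: (back _ _) => x' y' /=.
  by case: (r) => ? ?; case: (g n) => ? ? /= <-; rewrite mulNr.
have eqim : complex.Im r * L (re n) + complex.Re r * L (im n) = L (im n.+1) - complex.Im (g n).
  rewrite -Ldec// -[complex.Im (g n)](pf_cst PL) -(pfB PL)//; last exact: bounded_cst.
  apply: Leq; [by apply: boundedD; exact: bl|by apply: boundedB => //; exact: bounded_cst|].
  apply: filterS step => N /(congr1 (@complex.Im R)) /=.
  rewrite /re /im; case: (back (N - n)%N n) => x y; case: (back _ _) => x' y' /=.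
  by case: (r) => ? ?; case: (g n) => ? ? /= <-; rewrite addrC.
rewrite /a; move: eqre eqim; case: (r) (g n) => [r' r''] [g' g''] /= e1 e2.
apply/eqP; rewrite eq_complex/=; apply/andP; split; apply/eqP; lra.
Qed.

Lemma hyperbolic_bounded_solvable (p : {poly C}) : p != 0 ->
  (forall z, `|z| = 1 -> p.[z] != 0) -> bounded_solvable p.
Proof.
move=> p0 hp; have [s ps] := closed_field_poly_normal p.
have rs r : r \in s -> `|r| != 1.
  move=> rs; apply/eqP => r1; have := hp _ r1; apply/negP; rewrite negbK.
  by rewrite ps hornerZ horner_prod mulf_eq0 (big_rem r rs)/= hornerXsubC subrr mul0r eqxx orbT.
rewrite ps -mul_polyC; apply: bounded_solvableM.
  by apply: bounded_solvableC; rewrite lead_coef_eq0.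
elim: s rs {ps} => [|r s ih] rs.
  by rewrite big_nil -[1]/(1%:P); apply: bounded_solvableC; exact: oner_neq0.
rewrite big_cons; apply: bounded_solvableM; last first.
  by apply: ih => t ts; apply: rs; rewrite inE ts orbT.
have := rs r (mem_head _ _); have [r1|r1|r1] := ltgtP (normc r) 1.
- by move=> _; exact: bounded_solvable_contracting.
- by move=> _; exact: bounded_solvable_expanding.
- by rewrite -[`|r|]/((normc r)%:C) r1 eqxx.
Qed.

(** The coefficients are real, so the real part of a complex solution solves the real recurrence. *)
Lemma hyperbolic_recurrence (p : {poly int}) : p != 0 ->
  (forall z : C, `|z| = 1 -> (map_poly intr p).[z] != 0) ->
  exists B : R, 0 <= B /\ forall (g : nat -> R) d, (forall n, `|g n| <= d) ->
    exists a : nat -> R, (forall n, `|a n| <= B * d) /\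
      forall n, \sum_(i < size p) a (n + i)%N *~ p`_i = g n.
Proof.
move=> p0 hp.
have inj : injective (intr : int -> C) by exact: intr_inj.
have mp0 : map_poly (intr : int -> C) p != 0 by rewrite map_poly_eq0_id0 ?intr_eq0 ?lead_coef_eq0.
have [B [B0 hB]] := hyperbolic_bounded_solvable mp0 hp.
exists B; split=> // g d gd.
have [|a [ab ag]] := hB (fun n => (g n)%:C) d.
  by move=> n; rewrite /= expr0n addr0 sqrtr_sqr.
exists (fun n => complex.Re (a n)); split.
  move=> n; apply: le_trans (ab n); case: (a n) => x y /=.
  by rewrite -sqrtr_sqr ler_wsqrtr// lerDl sqr_ge0.
move=> n; have := congr1 (@complex.Re R) (ag n).
rewrite /poly_shift size_map_inj_poly ?rmorph0//= => <-.
have ReD (x y : C) : complex.Re (x + y) = complex.Re x + complex.Re y.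
  by case: x y => ? ? [].
rewrite (big_morph _ ReD (erefl : complex.Re (0 : C) = 0)); apply: eq_bigr => i _.
rewrite coef_map/= -(rmorph_int (real_complex R)) -mulrzl.
by case: (a (n + i)%N) => x y /=; rewrite mul0r subr0.
Qed.

End Recurrence.

Section IntegerAction.
Variables (X : zmodType) (T : {additive X -> X}).

Definition zact (q : {poly int}) (x : X) : X := \sum_(i < size q) iter i T x *~ q`_i.

Lemma zactE (q : {poly int}) x m : (size q <= m)%N -> zact q x = \sum_(i < m) iter i T x *~ q`_i.
Proof.
move=> qm; rewrite /zact (big_ord_widen _ (fun i => iter i T x *~ q`_i) qm).
rewrite big_mkcond; apply: eq_bigr => i _; case: ltnP => // h.
by rewrite nth_default// mulr0z.
Qed.

Lemma zactB p q x : zact (p - q) x = zact p x - zact q x.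
Proof.
pose m := maxn (size p) (size q).
rewrite (@zactE _ _ m); last first.
  by rewrite (leq_trans (size_polyD _ _))// size_polyN.
rewrite (@zactE p _ m) ?leq_maxl// (@zactE q _ m) ?leq_maxr// -sumrB.
by apply: eq_bigr => i _; rewrite coefB mulrzBr.
Qed.

Lemma iter_raddfMz n x z : iter n T (x *~ z) = iter n T x *~ z.
Proof. by elim: n => //= n ->; rewrite raddfMz. Qed.

Lemma iter_raddf_sum n (I : Type) (r : seq I) (F : I -> X) :
  iter n T (\sum_(i <- r) F i) = \sum_(i <- r) iter n T (F i).
Proof. by elim: n => //= n ->; rewrite raddf_sum. Qed.

Lemma iter_zact n q x : iter n T (zact q x) = zact q (iter n T x).
Proof.
rewrite /zact iter_raddf_sum; apply: eq_bigr => i _.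
by rewrite iter_raddfMz -!iterD addnC.
Qed.

End IntegerAction.

(** * Cyclic modules over integral polynomials *)

Section CyclicShadow.
Variables (R : realType) (X : zmodType) (T : {additive X -> X}).
Local Notation hom := {additive X -> circle R}.
Variables (P : set X) (u : X) (p : {poly int}).
Hypotheses (sP : subgroup P) (PT : forall x, P x -> P (T x)).
Hypothesis annp : forall q, P (zact T q u) <-> exists r, q = p * r.
Hypothesis hyp : p = 0 \/ forall z : R[i], `|z| = 1 -> (map_poly intr p).[z] != 0.

Let iterP n x : P x -> P (iter n T x).
Proof. by move=> Px; elim: n => //= n; exact: PT. Qed.

(* [sigma s] is the functional with value [s k] on [T ^ k u]. *)
Let sigma (s : nat -> circle R) (q : {poly int}) := \sum_(i < size q) s i *~ q`_i.

Let sigmaE s (q : {poly int}) m : (size q <= m)%N -> sigma s q = \sum_(i < m) s i *~ q`_i.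
Proof.
move=> qm; rewrite /sigma (big_ord_widen _ (fun i => s i *~ q`_i) qm).
rewrite big_mkcond; apply: eq_bigr => i _; case: ltnP => // h.
by rewrite nth_default// mulr0z.
Qed.

Let sigmaB s q r : sigma s (q - r) = sigma s q - sigma s r.
Proof.
pose m := maxn (size q) (size r).
rewrite (@sigmaE _ _ m); last first.
  by rewrite (leq_trans (size_polyD _ _))// size_polyN.
rewrite (@sigmaE _ q m) ?leq_maxl// (@sigmaE _ r m) ?leq_maxr// -sumrB.
by apply: eq_bigr => i _; rewrite coefB mulrzBr.
Qed.

Let sigma0 s : sigma s 0 = 0.
Proof. by rewrite /sigma size_poly0 big_ord0. Qed.

Let sigmaD s q r : sigma s (q + r) = sigma s q + sigma s r.
Proof.
have N : sigma s (- r) = - sigma s r by rewrite -[- r]sub0r sigmaB sigma0 sub0r.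
by rewrite -[r in LHS]opprK sigmaB N opprK.
Qed.

Let sigmaM s q r : (forall n, sigma s (q * 'X^n) = 0) -> sigma s (q * r) = 0.
Proof.
move=> h; rewrite -[r]coefK poly_def mulr_sumr.
apply: (big_ind (fun t => sigma s t = 0)) => [|t t' e e'|i _].
- exact: sigma0.
- by rewrite sigmaD e e' addr0.
- rewrite -scalerAr -mul_polyC; move: (r`_i) => c.
  have n0 n : sigma s (n%:R%:P * (q * 'X^i)) = 0.
    elim: n => [|n ih]; first by rewrite mulr0n polyC0 mul0r sigma0.
    by rewrite mulrS polyCD mulrDl polyC1 mul1r sigmaD h ih addr0.
  case: c => n; first by have := n0 n; rewrite natz.
  by rewrite NegzE polyCN mulNr -sub0r sigmaB sigma0 sub0r; have := n0 n.+1; rewrite natz => ->; rewrite oppr0.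
Qed.

(** By [orbD] the prescribed orbit at [u] forces the value [s k] of [z] at the [k]-th iterate of
    [u]. These values are consistent once [sigma s] kills all [p * 'X^n], which follows from the
    recurrence for [a]; divisibility of the circle extends [z] to [X]. *)
Lemma cyclic_orbit_exists (e : nat -> hom) (a : nat -> circle R) :
  (forall n x, P x -> e n x = 0) ->
  (forall n, \sum_(i < size p) a (n + i)%N *~ p`_i =
     \sum_(i < size p) (\sum_(l < i) e (n + l)%N (iter (i - l.+1) T u)) *~ p`_i) ->
  exists z : hom, (forall x, P x -> z x = 0) /\ forall n, orb T z e n u = a n.
Proof.
move=> eP aE.
pose s k := a k - \sum_(l < k) e l (iter (k - l.+1) T u).
have s0 n : sigma s (p * 'X^n) = 0.
  rewrite (@sigmaE _ _ (n + size p)); last first.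
    by rewrite (leq_trans (size_polyMleq _ _))// size_polyXn addnS/= addnC.
  rewrite big_split_ord/= big1 ?add0r; last by move=> i _; rewrite coefMXn ltn_ord mulr0z.
  under eq_bigr do rewrite coefMXn ltnNge leq_addr/= addKn.
  rewrite /s; under eq_bigr do rewrite mulrzBl.
  rewrite sumrB aE -sumrB.
  (* What remains are errors at iterates of [zact T p u], which lies in [P], where errors vanish. *)
  transitivity (- \sum_(l < n) e l (iter (n - l.+1) T (zact T p u))); last first.
    by rewrite big1 ?oppr0// => l _; rewrite eP//; apply: iterP; apply/annp; exists 1; rewrite mulr1.
  under [in RHS]eq_bigr do rewrite iter_zact /zact raddf_sum.
  rewrite exchange_big -sumrN; apply: eq_bigr => i _ /=.
  rewrite big_split_ord/= mulrzDl opprD addrCA.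
  have -> : \sum_(l < i) e (n + l)%N (iter (n + i - (n + l).+1) T u) =
            \sum_(l < i) e (n + l)%N (iter (i - l.+1) T u).
    by apply: eq_bigr => l _; rewrite -addnS subnDl.
  rewrite subrr addr0; congr (- _).
  rewrite mulrz_suml; apply: eq_bigr => l _.
  by rewrite -raddfMz -iterD addnC addnBA// [(n + i)%N]addnC.
pose G := [set t : X * circle R | exists x q, P x /\ t = (x + zact T q u, sigma s q)].
have hG : hom_graph G.
  split; first split.
  - exists 0, 0; split; first exact: sP.1.
    by rewrite sigma0 /zact size_poly0 big_ord0 addr0.
  - move=> _ _ [x [q [Px ->]]] [x' [q' [Px' ->]]].
    exists (x - x'), (q - q'); split; first exact: sP.2.
    by rewrite zactB sigmaB; congr (_, _) => /=; rewrite opprD addrACA.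
  - move=> d [x [q [Px [/esym/eqP + ->]]]]; rewrite addr_eq0 => /eqP xq.
    have /annp[r ->] : P (zact T q u).
      by rewrite -[zact _ _ _]opprK -xq; exact: subgroupN.
    exact: sigmaM.
have [z zG] := hom_extension (@circle_divisible R) hG.
exists z; split.
  move=> x Px; apply: zG; exists x, 0; split=> //.
  by rewrite sigma0 /zact size_poly0 big_ord0 addr0.
move=> n; rewrite -[n]add0n orbD add0n/=.
have -> : z (iter n T u) = s n.
  apply: zG; exists 0, 'X^n; split; first exact: sP.1.
  rewrite /zact /sigma size_polyXn !big_ord_recr/= !big1 ?coefXn ?eqxx ?mulr1z ?add0r//.
    by move=> i _; rewrite coefXn ltn_eqF// mulr0z.
  by move=> i _; rewrite coefXn ltn_eqF// mulr0z.
rewrite /s; under [X in _ + X]eq_bigr do rewrite add0n.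
by rewrite subrK.
Qed.

Lemma cyclic_shadow (s : seq X) (eps : R) : 0 < eps ->
  (forall x, x \in s -> exists v q, P v /\ x = v + zact T q u) ->
  exists (s' : seq X) (d : R), 0 < d /\
    forall e : nat -> hom, (forall n x, P x -> e n x = 0) ->
      (forall n x, x \in s' -> small d (e n x)) ->
    exists z : hom, (forall x, P x -> z x = 0) /\
      forall n x, x \in s -> small eps (orb T z e n x).
Proof.
move=> eps0 sPu.
have /choice[qf qfP] : forall x, exists q : {poly int}, x \in s -> exists v, P v /\ x = v + zact T q u.
  move=> x; have [xs|nxs] := boolP (x \in s); last by exists 0.
  by have [v [q h]] := sPu x xs; exists q => _; exists v.
pose K := \max_(x <- s) size (qf x).
pose W : R := 1 + \sum_(x <- s) \sum_(i < size (qf x)) `|(qf x)`_i|%:~R.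
have W0 : 0 < W by rewrite ltr_wpDr// sumr_ge0// => x _; rewrite sumr_ge0.
(* It suffices to be [eps / W]-small on the [iter k T u] with [k < K]. *)
suff [s' [d [d0 h]]] : exists (s' : seq X) (d : R), 0 < d /\
    forall e : nat -> hom, (forall n x, P x -> e n x = 0) ->
      (forall n x, x \in s' -> small d (e n x)) ->
    exists z : hom, (forall x, P x -> z x = 0) /\
      forall n k, (k < K)%N -> small (eps / W) (orb T z e n (iter k T u)).
  exists s', d; split=> // e eP es; have [z [zP zs]] := h e eP es; exists z; split=> // n x xs.
  have orbP m v : P v -> orb T z e m v = 0.
    elim: m v => [|m ih] v Pv; first exact: zP.
    by rewrite orbS ih ?eP ?addr0//; exact: PT.
  have [v [Pv ->]] := qfP x xs; rewrite raddfD orbP// add0r /zact raddf_sum.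
  apply: (@small_le _ (\sum_(i < size (qf x)) `|(qf x)`_i|%:~R * (eps / W))).
    rewrite -mulr_suml mulrCA ger_pMr// ler_pdivrMr// mul1r /W.
    rewrite (big_rem x xs)/= addrCA lerDl addr_ge0// sumr_ge0// => y _.
    by rewrite sumr_ge0.
  apply: small_sum => i; rewrite raddfMz; apply: smallMz; apply: zs.
  rewrite (leq_trans (ltn_ord i))//; apply: (@leq_bigmax_seq _ s xpredT (fun x => size (qf x))) => //.
set eta := eps / W; have eta0 : 0 < eta by rewrite divr_gt0.
(* By [orbD], the orbit at the [k]-th iterate of [u] is the orbit at [u] taken [k] steps later, up
   to fewer than [K] errors. Hence it is enough to control the orbit at [u]. *)
have smallK (z : hom) (e : nat -> hom) : (forall n, small (eta / 2) (orb T z e n u)) ->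
    (forall n k, (k < K)%N -> small (eta / 2 / K.+1%:R) (e n (iter k T u))) ->
    forall n k, (k < K)%N -> small eta (orb T z e n (iter k T u)).
  move=> zs es n k kK.
  have -> : orb T z e n (iter k T u) =
      orb T z e (n + k) u - \sum_(l < k) e (n + l)%N (iter (k - l.+1) T u).
    by rewrite orbD addrK.
  rewrite [eta]splitr; apply: smallB => //.
  apply: (@small_le _ (\sum_(l < k) eta / 2 / K.+1%:R)).
    rewrite sumr_const card_ord -(mulr_natr (eta / 2 / K.+1%:R)) -mulrA ger_pMr ?divr_gt0//.
    by rewrite ler_pdivrMl// mulr1 ler_nat ltnW// (ltn_trans kK).
  apply: small_sum => l; apply: es.
  by rewrite (leq_ltn_trans _ kK)// leq_subr.
(* Without a relation the orbit at [u] can be prescribed freely, as 0. *)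
have [p0|p0] := eqVneq p 0.
  exists [seq iter k T u | k <- iota 0 K], (eta / 2 / K.+1%:R); split; first by rewrite !divr_gt0.
  move=> e eP es; have [|z [zP zo]] := @cyclic_orbit_exists e (fun=> 0) eP.
    by move=> n; rewrite p0 size_poly0 !big_ord0.
  exists z; split=> //; apply: smallK.
    by move=> n; rewrite zo; apply: small0; rewrite divr_ge0// ltW.
  by move=> n k kK; apply: es; apply/mapP; exists k; rewrite // mem_iota.
have [B [B0 hB]] : exists B : R, 0 <= B /\ forall (g : nat -> R) d, (forall n, `|g n| <= d) ->
    exists a : nat -> R, (forall n, `|a n| <= B * d) /\
      forall n, \sum_(i < size p) a (n + i)%N *~ p`_i = g n.
  by apply: hyperbolic_recurrence => //; case: hyp => // pz; rewrite pz eqxx in p0.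
(* Errors are controlled on iterates of order below [K] for [smallK] and below [size p] for the
   recurrence. *)
pose N := (K + size p)%N.
pose G : R := \sum_(i < size p) (\sum_(l < i) 1) *~ `|p`_i|.
have G0 : 0 <= G.
  rewrite sumr_ge0// => i _; rewrite mulrz_ge0//.
  by rewrite sumr_ge0.
pose d := Num.min (eta / 2 / K.+1%:R) (eta / 2 / (B * G + 1)).
have BG0 : 0 < B * G + 1 by rewrite ltr_wpDl// mulr_ge0.
have d0 : 0 < d by rewrite lt_min !divr_gt0.
exists [seq iter k T u | k <- iota 0 N], d; split=> // e eP es.
have esk n k : (k < N)%N -> small d (e n (iter k T u)).
  by move=> kN; apply: es; apply/mapP; exists k; rewrite // mem_iota.
(* Real lifts of the errors, with dummy value 0 outside the controlled range; [g] below is the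
   right-hand side of the recurrence lifted to the reals. *)
have /choice[t tP] : forall nk : nat * nat, exists t : R, (nk.2 < N)%N ->
    `|t| <= d /\ e nk.1 (iter nk.2 T u) = expi t.
  move=> [n k] /=; have [kN|_] := boolP (k < N)%N; last by exists 0.
  by have [t td et] := esk n k kN; exists t.
pose g n := \sum_(i < size p) (\sum_(l < i) t ((n + l)%N, (i - l.+1)%N)) *~ p`_i.
have iN (i : 'I_(size p)) (l : 'I_i) : (i - l.+1 < N)%N.
  rewrite (leq_ltn_trans (leq_subr _ _))// (leq_trans (ltn_ord i))//.
  by rewrite /N leq_addl.
have gd n : `|g n| <= G * d.
  rewrite (le_trans (ler_norm_sum _ _ _))// /G mulr_suml ler_sum// => i _.
  rewrite -mulrzr normrM -[_ *~ `|_|]mulrzr mulrAC intr_norm ler_wpM2r//.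
  rewrite (le_trans (ler_norm_sum _ _ _))// mulr_suml ler_sum// => l _.
  by rewrite mul1r; have [] := tP ((n + l)%N, (i - l.+1)%N) (iN i l).
have [a [ab ag]] := hB g _ gd.
have [|z [zP zo]] := @cyclic_orbit_exists e (fun n => expi (a n)) eP.
  move=> n; transitivity (expi (g n)).
    by rewrite -ag raddf_sum; apply: eq_bigr => i _; rewrite raddfMz.
  rewrite raddf_sum; apply: eq_bigr => i _; rewrite raddfMz raddf_sum; congr (_ *~ _).
  by apply: eq_bigr => l _; have [_ ->] := tP ((n + l)%N, (i - l.+1)%N) (iN i l).
exists z; split=> //; apply: smallK.
  move=> n; rewrite zo; exists (a n) => //; apply: le_trans (ab n) _.
  rewrite mulrA (@le_trans _ _ (B * G * (eta / 2 / (B * G + 1))))//.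
    by rewrite ler_wpM2l ?mulr_ge0// ge_min lexx orbT.
  rewrite mulrCA ger_pMr ?divr_gt0// ler_pdivrMr// mul1r lerDl//.
move=> n k kK; apply: (@small_le _ d); first by rewrite ge_min lexx.
by apply: esk; rewrite (leq_trans kK)// leq_addr.
Qed.

End CyclicShadow.

(** * Polynomial action of an endomorphism *)

Section PolynomialAction.
Variables (K : comNzRingType) (V : lmodType K) (T : {linear V -> V}).
Implicit Types (p q : {poly K}) (v w : V).

Definition act p v : V := \sum_(i < size p) p`_i *: iter i T v.

Lemma actE p v m : (size p <= m)%N -> act p v = \sum_(i < m) p`_i *: iter i T v.
Proof.
move=> pm; rewrite /act (big_ord_widen _ (fun i => p`_i *: iter i T v) pm).
rewrite big_mkcond; apply: eq_bigr => i _; case: ltnP => // h.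
by rewrite nth_default// scale0r.
Qed.

Lemma actD p q v : act (p + q) v = act p v + act q v.
Proof.
pose m := maxn (size p) (size q).
rewrite (@actE _ _ m) ?size_polyD// (@actE p _ m) ?leq_maxl// (@actE q _ m) ?leq_maxr//.
by rewrite -big_split; apply: eq_bigr => i _; rewrite coefD scalerDl.
Qed.

Lemma actZ c p v : act (c *: p) v = c *: act p v.
Proof.
rewrite (@actE _ _ (size p)) ?size_scale_leq// scaler_sumr.
by apply: eq_bigr => i _; rewrite coefZ scalerA.
Qed.

Lemma actN p v : act (- p) v = - act p v.
Proof. by rewrite -[- p]scaleN1r actZ scaleN1r. Qed.

Lemma actB p q v : act (p - q) v = act p v - act q v.
Proof. by rewrite actD actN. Qed.

Lemma act0 v : act 0 v = 0.
Proof. by rewrite /act size_poly0 big_ord0. Qed.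

Lemma actC c v : act c%:P v = c *: v.
Proof. by rewrite (@actE _ _ 1) ?size_polyC_leq1// big_ord1 coefC. Qed.

Lemma act1 v : act 1 v = v.
Proof. by rewrite -polyC1 actC scale1r. Qed.

Lemma iter_linearP n a v w : iter n T (a *: v + w) = a *: iter n T v + iter n T w.
Proof. by elim: n => //= n ->; rewrite linearP. Qed.

Lemma act_is_linear p : linear (act p).
Proof.
move=> a v w; rewrite /act scaler_sumr -big_split; apply: eq_bigr => i _ /=.
by rewrite iter_linearP scalerDr !scalerA mulrC.
Qed.
HB.instance Definition _ p := GRing.isLinear.Build K V V _ (act p) (act_is_linear p).

Lemma act_subr p v w : act p (v - w) = act p v - act p w.
Proof. exact: (linearB (act p)). Qed.

Lemma act_0r p : act p 0 = 0.
Proof. exact: (linear0 (act p)). Qed.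

Lemma act_mulX p v : act (p * 'X) v = act p (T v).
Proof.
rewrite (@actE _ _ (size p).+1); last first.
  by rewrite (leq_trans (size_polyMleq _ _))// size_polyX addn2.
rewrite big_ord_recl coefMX/= scale0r add0r; apply: eq_bigr => i _.
by rewrite coefMX/= -iterSr.
Qed.

Lemma actT p v : act p (T v) = T (act p v).
Proof.
rewrite /act linear_sum; apply: eq_bigr => i _.
by rewrite linearZ -iterSr.
Qed.

Lemma actM p q v : act (p * q) v = act p (act q v).
Proof.
elim/poly_ind: p => [|p c ih] in v *; first by rewrite mul0r !act0.
rewrite mulrDl mulrAC !actD !act_mulX mul_polyC actZ actC -mulrC.
by rewrite [q * p]mulrC ih actT.
Qed.

Lemma act_eigen p z v : T v = z *: v -> act p v = p.[z] *: v.
Proof.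
move=> Tv; elim/poly_ind: p => [|p c ih]; first by rewrite act0 horner0 scale0r.
by rewrite actD act_mulX actC Tv linearZ/= ih scalerA hornerMXaddC scalerDl mulrC.
Qed.

(** Submodules over the polynomial ring, with the variable acting by [T], as plain sets so that they
    can be arguments of [shadow]. *)
Definition invariant_sub (P : set V) := [/\ P 0, forall v w, P v -> P w -> P (v - w),
  forall c v, P v -> P (c *: v) & forall v, P v -> P (T v)].

Section InvariantSub.
Variable P : set V.
Hypothesis iP : invariant_sub P.

Lemma invariant_subgroup : subgroup P.
Proof. by case: iP. Qed.

Lemma invariant_subT v : P v -> P (T v).
Proof. by case: iP => _ _ _; exact. Qed.

Lemma invariant_subZ c v : P v -> P (c *: v).
Proof. by case: iP => _ _ h _; exact: h. Qed.

Lemma invariant_subD v w : P v -> P w -> P (v + w).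
Proof. exact: subgroupD invariant_subgroup _ _. Qed.

Lemma invariant_subB v w : P v -> P w -> P (v - w).
Proof. by case: iP => _ h _ _; exact: h. Qed.

Lemma invariant_sub_act p v : P v -> P (act p v).
Proof.
move=> Pv; apply: big_ind => [||i _]; first by case: iP.
  exact: invariant_subD.
by apply: invariant_subZ; elim: (nat_of_ord i) => //= n; exact: invariant_subT.
Qed.

End InvariantSub.

Lemma invariant_sub0 : invariant_sub [set 0].
Proof.
split=> //= [v w -> ->|c v ->|v ->]; [by rewrite subrr|by rewrite scaler0|by rewrite linear0].
Qed.

End PolynomialAction.

Section AnnihilatorIdeal.
Variables (K : fieldType) (V : lmodType K) (T : {linear V -> V}).

(** [m] generates the annihilator of [u] modulo [P]; [m = 0] means that [u] is free modulo [P]. *)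
Definition annihilator (P : set V) (u : V) (m : {poly K}) :=
  forall q, P (act T q u) <-> (m %| q)%R.

Lemma annihilator_exists (P : set V) u : invariant_sub T P -> exists m, annihilator P u m.
Proof.
move=> iP.
have [[q0 [q00 Pq0]]|nq] := pselect (exists q, q != 0 /\ P (act T q u)); last first.
  exists 0 => q; rewrite dvd0p; split=> [Pq|/eqP ->].
    by apply: contrapT => /negP q0; apply: nq; exists q.
  by rewrite act0; case: iP.
have ex : exists n, `[< exists q : {poly K}, [/\ q != 0, P (act T q u) & size q = n] >].
  by exists (size q0); apply/asboolP; exists q0.
case: (ex_minnP ex) => n /asboolP[m [m0 Pm mn]] minn.
exists m => q; split=> [Pq|/dvdpP[r ->]]; last first.
  by rewrite actM; exact: invariant_sub_act.
apply: contrapT => /negP; rewrite /dvdp => r0.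
have Pr : P (act T (q %% m) u).
  have -> : q %% m = q - (q %/ m) * m by rewrite {2}(divp_eq q m) addrAC subrr add0r.
  by rewrite actB actM; apply: (invariant_subB iP) => //; exact: invariant_sub_act.
have := minn (size (q %% m)); rewrite leqNgt -mn ltn_modp m0 => /(_ _)/negP; case => //.
by apply/asboolP; exists (q %% m).
Qed.

End AnnihilatorIdeal.

(** * Filtration of rational modules *)

Section RationalShadow.
Variables (R : realType) (V : lmodType rat) (T : {linear V -> V}).

Definition no_unit_root (m : {poly rat}) :=
  forall z : R[i], `|z| = 1 -> (map_poly ratr m).[z] != 0.

Lemma no_unit_root_dvd m q : (m %| q)%R -> no_unit_root q -> no_unit_root m.
Proof.
move=> /dvdpP[r ->] h z z1; have := h z z1.
by rewrite rmorphM/= hornerM mulf_eq0 => /norP[].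
Qed.

Lemma no_unit_root1 : no_unit_root 1.
Proof. by move=> z _; rewrite rmorph1 hornerC oner_eq0. Qed.

Lemma zact_act (q : {poly int}) v : zact T q v = act T (map_poly intr q) v.
Proof.
rewrite /act size_map_inj_poly ?rmorph0//; last exact: intr_inj.
by apply: eq_bigr => i _; rewrite coef_map scaler_int.
Qed.

(** Only finite lists are tested, so it is enough that each of them lies in some cyclic extension of
    [P]. After clearing denominators, Gauss's lemma identifies the integral annihilator as the ideal
    of the primitive part of [m]. *)
Lemma cyclic_shadow_rat (P Q : set V) : invariant_sub T P ->
  (forall s : seq V, (forall x, x \in s -> Q x) -> exists u m,
    [/\ annihilator T P u m, m = 0 \/ no_unit_root m &
    forall x, x \in s -> exists v q, P v /\ x = v + act T q u]) ->
  shadow R T P Q.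
Proof.
move=> iP hQ s eps sQ eps0; have [u [m [annm hm sE]]] := hQ s sQ.
have /choice[f fP] : forall x, exists t : {poly int} * int, t.2 != 0 /\
    (x \in s -> exists v, P v /\ x = v + act T (t.2%:~R^-1 *: map_poly intr t.1) u).
  move=> x; have [xs|nxs] := boolP (x \in s); last by exists (0, 1).
  have [v [q [Pv xE]]] := sE x xs; have [q' [a a0 qE]] := rat_poly_scale q.
  by exists (q', a); split=> // _; exists v; rewrite -qE.
have [p0 [a a0 mE]] := rat_poly_scale m.
pose N : int := \prod_(x <- s) (f x).2.
have N0 : N%:~R != 0 :> rat.
  rewrite intr_eq0 prodf_seq_neq0; apply/allP => x _; exact: (fP x).1.
(* Dividing [u] by a common denominator makes all coefficients of [s] integral; [P] is a rational
   subspace, so the annihilator is unchanged. *)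
pose u' : V := N%:~R^-1 *: u.
have a0' : a%:~R != 0 :> rat by rewrite intr_eq0.
have sP := invariant_subgroup iP.
have PT : forall x, P x -> P (T x) := invariant_subT iP.
apply: (@cyclic_shadow R V T P u' (zprimitive p0)) => //.
- move=> q; rewrite zact_act linearZ/=.
  transitivity (P (act T (map_poly intr q) u)).
    split; last exact: (invariant_subZ iP).
    by move=> /(invariant_subZ iP N%:~R); rewrite scalerA mulfV// scale1r.
  rewrite (annm _) mE dvdpZl ?invr_eq0// dvdp_rat_int.
  split=> [/dvdpP_int[r ->]|[r ->]]; first by exists r.
  have p0E : map_poly intr p0 = (zcontents p0)%:~R *: map_poly intr (zprimitive p0) :> {poly rat}.
    by rewrite {1}(zpolyEprim p0) map_polyZ.
  rewrite -dvdp_rat_int p0E; case: (eqVneq (zcontents p0) 0) => [/eqP|c0].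
    by rewrite zcontents_eq0 => /eqP ->; rewrite zprimitive0 mul0r map_poly0 dvdp0.
  by rewrite [map_poly _ (_ * r)]rmorphM dvdpZl ?intr_eq0// dvdp_mulIl.
- case: hm => [m0|hm].
    left; have : p0 = 0.
      apply: (@map_inj_poly int rat intr) => //; first exact: intr_inj.
      move/eqP: m0; rewrite mE scaler_eq0 invr_eq0 (negbTE a0') => /eqP ->.
      by rewrite rmorph0.
    by move=> ->; rewrite zprimitive0.
  right => z z1; have := hm z z1.
  rewrite mE {1}(zpolyEprim p0) !linearZ/= -map_poly_comp.
  have -> : map_poly (intr : int -> R[i]) (zprimitive p0) =
      map_poly (ratr \o intr) (zprimitive p0).
    by apply: eq_map_poly => x /=; rewrite ratr_int.
  by rewrite !hornerZ !mulf_eq0 !negb_or => /and3P[].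
- move=> x xs; have [_ /(_ xs)[v [Pv xE]]] := fP x.
  pose b : int := \prod_(y <- rem x s) (f y).2.
  exists v, (b *: (f x).1); split=> //; rewrite [LHS]xE; congr (_ + _).
  have NE : N = (f x).2 * b by rewrite /N (big_rem x xs).
  have fx0 : (f x).2%:~R != 0 :> rat by rewrite intr_eq0; exact: (fP x).1.
  have b0 : b%:~R != 0 :> rat by move: N0; rewrite NE intrM mulf_eq0 => /norP[].
  rewrite zact_act map_polyZ !actZ linearZ/= scalerA; congr (_ *: _).
  by rewrite NE intrM invfM mulrCA mulrV ?mulr1// unitfE.
Qed.

Lemma shadow_refl P : invariant_sub T P -> shadow R T P P.
Proof.
move=> iP; apply: cyclic_shadow_rat => // s sP; exists 0, 1; split.
- by move=> q; rewrite dvd1p linear0; split=> // _; case: iP.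
- by right; exact: no_unit_root1.
- by move=> x xs; exists x, 0; rewrite act0 addr0; split=> //; exact: sP.
Qed.

Hypothesis hypV : forall u m, annihilator T [set 0] u m -> m != 0 -> no_unit_root m.

Definition torsion (v : V) := exists q : {poly rat}, q != 0 /\ act T q v = 0.

Lemma torsion_invariant : invariant_sub T torsion.
Proof.
split.
- by exists 1; rewrite oner_neq0 linear0.
- move=> v w [p [p0 pv]] [q [q0 qw]]; exists (p * q); rewrite mulf_neq0//; split=> //.
  by rewrite act_subr {1}[p * q]mulrC !actM pv qw !act_0r subrr.
- by move=> c v [p [p0 pv]]; exists p; rewrite linearZ/= pv scaler0.
- by move=> v [p [p0 pv]]; exists p; rewrite actT pv linear0.
Qed.

Lemma cyclic_extension_invariant P u : invariant_sub T P ->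
  invariant_sub T [set x | exists v q, P v /\ x = v + act T q u].
Proof.
move=> iP; split.
- by exists 0, 0; rewrite act0 addr0; split=> //; case: iP.
- move=> _ _ [v [q [Pv ->]]] [v' [q' [Pv' ->]]]; exists (v - v'), (q - q').
  by split; [exact: (invariant_subB iP)|rewrite actB opprD addrACA].
- move=> c _ [v [q [Pv ->]]]; exists (c *: v), (c *: q).
  by split; [exact: (invariant_subZ iP)|rewrite actZ scalerDr].
- move=> _ [v [q [Pv ->]]]; exists (T v), (q * 'X).
  by split; [exact: invariant_subT|rewrite act_mulX actT linearD].
Qed.

(** Generators are adjoined one at a time; the annihilator of [u] modulo [P] divides its annihilator
    in [V] and inherits the absence of unit roots. *)
Lemma torsion_shadow_fin (s : seq V) : (forall x, x \in s -> torsion x) ->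
  exists P, [/\ invariant_sub T P, forall x, x \in s -> P x & shadow R T [set 0] P].
Proof.
elim: s => [|u s ih] sT.
  exists [set 0]; split=> //; first exact: invariant_sub0.
  exact/shadow_refl/invariant_sub0.
have [|P [iP sP shP]] := ih; first by move=> x xs; apply: sT; rewrite inE xs orbT.
have iP' := cyclic_extension_invariant u iP.
have PP' : P `<=` [set x | exists v q, P v /\ x = v + act T q u].
  by move=> v Pv; exists v, 0; rewrite act0 addr0.
exists [set x | exists v q, P v /\ x = v + act T q u]; split=> //.
  move=> x; rewrite inE => /orP[/eqP ->|/sP/PP'//].
  by exists 0, 1; rewrite act1 add0r; split=> //; case: iP.
apply: (shadow_trans (invariant_subgroup iP)) shP _.
- exact: invariant_subT.
- by move=> _ ->; case: iP.
apply: cyclic_shadow_rat => // t tP'.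
have [m annm] := annihilator_exists u iP; exists u, m; split=> //.
right; have [q [q0 qu]] := sT u (mem_head _ _).
have [m0 annm0] := annihilator_exists u (invariant_sub0 T).
have m00 : m0 != 0.
  by apply: contraNneq q0 => m00; have /annm0 := qu; rewrite m00 dvd0p.
apply: no_unit_root_dvd (hypV annm0 m00); apply/annm.
have /annm0 -> : (m0 %| m0)%R by exact: dvdpp.
by case: iP.
Qed.

(** Equivalently, the quotient by [P] is torsion-free over the polynomial ring. *)
Definition pure (P : set V) := forall q v, q != 0 -> P (act T q v) -> P v.

Lemma torsion_pure : pure torsion.
Proof.
move=> q v q0 [p [p0 pqv]]; exists (p * q); rewrite mulf_neq0//; split=> //.
by rewrite actM.
Qed.

Section PureClosure.
Variables (P : set V) (u : V).
Hypotheses (iP : invariant_sub T P) (pP : pure P).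

(** The elements that depend on [u] modulo [P] over the polynomial ring: a step of rank at most
    one. *)
Definition pure_closure (v : V) := exists q r, q != 0 /\ P (act T q v - act T r u).

Lemma pure_closure_sub : P `<=` pure_closure.
Proof. by move=> v Pv; exists 1, 0; rewrite oner_neq0 act1 act0 subr0. Qed.

Lemma pure_closure_mem : pure_closure u.
Proof. by exists 1, 1; rewrite oner_neq0 subrr; split=> //; case: iP. Qed.

Lemma pure_closure_invariant : invariant_sub T pure_closure.
Proof.
split.
- by apply: pure_closure_sub; case: iP.
- move=> v w [q [r [q0 h]]] [q' [r' [q'0 h']]]; exists (q * q'), (q' * r - q * r').
  rewrite mulf_neq0//; split=> //.
  have -> : act T (q * q') (v - w) - act T (q' * r - q * r') u =
     act T q' (act T q v - act T r u) - act T q (act T q' w - act T r' u).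
    by rewrite actB !act_subr -!actM [q' * q]mulrC !opprB addrACA [RHS]addrACA;
       congr (_ + _); exact: addrC.
  by apply: (invariant_subB iP) => //; exact: invariant_sub_act.
- move=> c v [q [r [q0 h]]]; exists q, (c *: r); split=> //.
  by rewrite linearZ/= actZ -scalerBr; exact: (invariant_subZ iP).
- move=> v [q [r [q0 h]]]; exists q, (r * 'X); split=> //.
  by rewrite act_mulX !actT -linearB; exact: invariant_subT.
Qed.

Lemma pure_closure_pure : pure pure_closure.
Proof.
move=> q v q0 [p [r [p0 h]]]; exists (p * q), r; rewrite mulf_neq0//; split=> //.
by rewrite actM.
Qed.

(** In a torsion-free module of rank one over a principal ideal domain two elements generate a
    cyclic submodule. From [A f = B g] modulo [P], purity allows division by the gcd, and Bezout's
    [x A' + y B' = 1] yields the generator [y f + x g]. *)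
Lemma pure_closure_pair f g : pure_closure f -> pure_closure g ->
  exists w a b, [/\ pure_closure w, P (f - act T b w) & P (g - act T a w)].
Proof.
move=> cf cg; have [af [r [a0 hf]]] := cf; have [bg [s [b0 hg]]] := cg.
pose A := s * af; pose B := r * bg.
have AB : P (act T A f - act T B g).
  have -> : act T A f - act T B g =
      act T s (act T af f - act T r u) - act T r (act T bg g - act T s u).
    by rewrite !act_subr -!actM [s * r]mulrC opprB addrA subrK.
  by apply: (invariant_subB iP) => //; exact: invariant_sub_act.
(* In this degenerate case [g] lies in [P] and [f] serves as generator. *)
have [A0|A0] := eqVneq A 0.
  have s0 : s = 0 by move/eqP: A0; rewrite mulf_eq0 (negbTE a0) orbF => /eqP.
  have Pg : P g by apply: pP b0 _; move: hg; rewrite s0 act0 subr0.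
  by exists f, 0, 1; split=> //; rewrite ?act1 ?act0 ?subrr ?subr0//; case: iP.
pose d := gcdp A B.
have d0 : d != 0 by rewrite gcdp_eq0 negb_and A0.
have [A' AE] : exists A', A = A' * d by apply/dvdpP; exact: dvdp_gcdl.
have [B' BE] : exists B', B = B' * d by apply/dvdpP; exact: dvdp_gcdr.
have [[u1 u2] /= /eqpP[[c1 c2] /= /andP[c10 c20] cE]] := Bezoutp A B.
have {}cE : (c2^-1 * c1) *: (u1 * A' + u2 * B') = 1.
  apply: (mulIf d0); rewrite mul1r -scalerAl mulrDl -!mulrA -AE -BE -scalerA cE.
  by rewrite scalerA mulVf// scale1r.
pose x := (c2^-1 * c1) *: u1; pose y := (c2^-1 * c1) *: u2.
have xy v : v = act T x (act T A' v) + act T y (act T B' v).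
  by rewrite -!actM -actD /x /y -!scalerAl -scalerDr cE act1.
have PAB : P (act T A' f - act T B' g).
  apply: pP d0 _; rewrite act_subr -!actM.
  by rewrite [d * A']mulrC [d * B']mulrC -AE -BE.
exists (act T y f + act T x g), A', B'; split.
- have iC := pure_closure_invariant.
  by apply: (invariant_subD iC); exact: (invariant_sub_act iC).
- have -> : f - act T B' (act T y f + act T x g) = act T x (act T A' f - act T B' g).
    rewrite {1}(xy f) linearD/= act_subr -!actM [B' * y]mulrC [B' * x]mulrC.
    by rewrite opprD addrA addrK.
  exact: invariant_sub_act.
- have -> : g - act T A' (act T y f + act T x g) = - act T y (act T A' f - act T B' g).
    rewrite {1}(xy g) linearD/= act_subr -!actM [A' * y]mulrC [A' * x]mulrC opprB.
    by rewrite [X in X - _ = _]addrC opprD addrACA subrr addr0.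
  by apply: (subgroupN (invariant_subgroup iP)); exact: invariant_sub_act.
Qed.

Lemma pure_closure_generator (s : seq V) : (forall x, x \in s -> pure_closure x) ->
  exists w, pure_closure w /\ forall x, x \in s -> exists v q, P v /\ x = v + act T q w.
Proof.
have iC := pure_closure_invariant.
elim: s => [|f s ih] sC; first by exists 0; split=> //; case: iC.
have [|w [Cw sw]] := ih; first by move=> x xs; apply: sC; rewrite inE xs orbT.
have [w' [a [b [Cw' Pf Pw]]]] := pure_closure_pair (sC f (mem_head _ _)) Cw.
exists w'; split=> // x; rewrite inE => /orP[/eqP ->|/sw[v [q [Pv ->]]]].
  by exists (f - act T b w'), b; rewrite subrK.
exists (v + act T q (w - act T a w')), (q * a); split.
  by apply: (invariant_subD iP) => //; exact: invariant_sub_act.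
by rewrite actM -addrA -linearD/= subrK.
Qed.

(** Modulo a pure [P] a generator is either free or zero, so its annihilator is 0 or the unit
    ideal. *)
Lemma pure_closure_shadow : shadow R T P pure_closure.
Proof.
apply: cyclic_shadow_rat => // s /pure_closure_generator[w [Cw sw]].
have [m annm] := annihilator_exists w iP; exists w, m; split=> //.
have [m0|m0] := eqVneq m 0; [by left|right].
apply: (@no_unit_root_dvd _ 1); last exact: no_unit_root1.
apply/annm; rewrite act1; apply: pP m0 _; apply/annm; exact: dvdpp.
Qed.

End PureClosure.

Theorem hyperbolic_shadow : shadow R T [set 0] setT.
Proof.
apply: shadow_union => s _.
suff [P [iP pP sP shP]] : exists P, [/\ invariant_sub T P, pure P,
    forall x, x \in s -> P x & shadow R T [set 0] P] by exists P.
(* The torsion submodule is the base; above it each element of [s] costs one pure step. *)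
elim: s => [|u s [P [iP pP sP shP]]].
  exists torsion; split=> //.
  - exact: torsion_invariant.
  - exact: torsion_pure.
  - by apply: shadow_union => s /torsion_shadow_fin[P [iP sP shP]]; exists P.
have PC := @pure_closure_sub P u.
exists (pure_closure P u); split.
- exact: pure_closure_invariant.
- exact: pure_closure_pure.
- by move=> x; rewrite inE => /orP[/eqP ->|/sP/PC//]; exact: pure_closure_mem.
- apply: (shadow_trans (invariant_subgroup iP)) shP _.
  + exact: invariant_subT.
  + by move=> _ ->; case: iP.
  + exact: pure_closure_shadow.
Qed.

End RationalShadow.

(** Errors on [X] are extended to [V] with controlled smallness, the problem is solved there, and
    the solution is restricted along [i]. *)
Lemma shadow_restrict (R : realType) (X V : zmodType) (TX : {additive X -> X})
    (TV : {additive V -> V}) (i : {additive X -> V}) :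
  injective i -> (forall x, i (TX x) = TV (i x)) ->
  shadow R TV [set 0] setT -> shadow R TX [set 0] setT.
Proof.
move=> injI iT sh s eps _ eps0.
have [s1 [d1 [d10 h1]]] := sh (map i s) eps (fun _ _ => I) eps0.
pose P := [set v | exists x, v = i x].
have sP : subgroup P.
  split; first by exists 0; rewrite raddf0.
  by move=> _ _ [x ->] [y ->]; exists (x - y); rewrite raddfB.
have [s2 [d2 [d20 s2P h2]]] := small_extension s1 sP d10.
have /choice[pre preP] : forall v, exists x, P v -> v = i x.
  move=> v; have [[x ->]|nP] := pselect (P v); first by exists x.
  by exists 0 => /nP.
exists (map pre s2), d2; split=> // e _ es.
have /choice[e' e'P] : forall n, exists e' : {additive V -> circle R},
    (forall x, e' (i x) = e n x) /\ forall v, v \in s1 -> small d1 (e' v).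
  move=> n.
  have hG : hom_graph [set t : V * circle R | exists x, t = (i x, e n x)].
    split; first split.
    - by exists 0; rewrite !raddf0.
    - by move=> _ _ [x ->] [y ->]; exists (x - y); rewrite !raddfB.
    - move=> d [x [/esym/eqP + ->]]; rewrite -(raddf0 i) => /eqP/injI ->.
      by rewrite raddf0.
  have [g gP] := hom_extension (@circle_divisible R) hG.
  have gi x : g (i x) = e n x by apply: gP; exists x.
  have [|g' [g'P g's]] := h2 g.
    move=> v vs; rewrite (preP v (s2P v vs)) gi; apply: es; exact: map_f.
  by exists g'; split=> // x; rewrite g'P ?gi//; exists x.
have [||z [_ zs]] := h1 e'.
- by move=> n _ ->; rewrite raddf0.
- by move=> n v vs; exact: (e'P n).2.
pose zX : {additive X -> circle R} := (z \o i).
exists zX; split; first by move=> _ ->; rewrite raddf0.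
have orbE n x : orb TX zX e n x = orb TV z e' n (i x).
  by elim: n x => [//|n ih] x; rewrite !orbS ih iT (e'P n).1.
by move=> n x xs; rewrite orbE; apply: zs; exact: map_f.
Qed.

(** * The rational span of the dual *)

Section BaseChangeAction.
Variables (K S : comNzRingType) (f : {rmorphism K -> S}) (M : lmodType K) (L : {linear M -> M}).

Lemma tensor0l s : tensor f (0 : M) s = 0.
Proof. by apply: (addrI (tensor f 0 s)); rewrite -tensorDl !addr0. Qed.

Lemma tensorBl (m m' : M) s : tensor f (m - m') s = tensor f m s - tensor f m' s.
Proof. by apply: (addIr (tensor f m' s)); rewrite -tensorDl !subrK. Qed.

Lemma tensor_suml (I : Type) (r : seq I) (F : I -> M) s :
  tensor f (\sum_(i <- r) F i) s = \sum_(i <- r) tensor f (F i) s.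
Proof. by elim/big_rec2: _ => [|i y x _ <-]; rewrite ?tensor0l ?tensorDl. Qed.

Lemma iter_base_change_map n m s :
  iter n (base_change_map f L) (tensor f m s) = tensor f (iter n L m) s.
Proof. by elim: n => //= n ->; rewrite base_change_mapE. Qed.

Lemma act_base_change_map q m s :
  act (base_change_map f L) (map_poly f q) (tensor f m s) = tensor f (act L q m) s.
Proof.
rewrite (@actE _ _ _ _ _ (size q)) ?size_poly// tensor_suml; apply: eq_bigr => i _.
by rewrite coef_map iter_base_change_map tensorZr -tensorZl.
Qed.

End BaseChangeAction.

Lemma act_Xn (K : comNzRingType) (V : lmodType K) (T : {linear V -> V}) n v :
  act T 'X^n v = iter n T v.
Proof.
elim: n v => [|n ih] v; first by rewrite act1.
by rewrite exprSr act_mulX ih iterSr.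
Qed.

Section RationalSpan.
Variable X : lmodType int.
Local Notation tens := (tensor (intr : {rmorphism int -> rat}) (M := X)).

(** Multiplication by [N] followed by the integral action, meaningful when [N%:R * s] is an integer.
    No [N] suits all [s], so each null relation is checked with its own [N]. *)
Let phi (N : nat) (m : X) (s : rat) : X := numq (N%:R * s) *: m.

Let numq_intr (k : int) : numq (k%:~R) = k.
Proof. exact: numq_int. Qed.

Let integral_multiple (s : rat) : exists N : nat, (0 < N)%N /\
  forall M, exists k : int, (M * N)%:R * s = k%:~R.
Proof.
exists `|denq s|%N; split; first by rewrite absz_gt0 denq_neq0.
move=> M; exists (M%:Z * numq s); rewrite intrM natrM -mulrA; congr (_ * _).
rewrite numqE mulrC; congr (_ * _).
by rewrite -[RHS](congr1 intr (gez0_abs (ltW (denq_gt0 s)))) .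
Qed.

Let free_liftU N p : free_lift (phi N) << p >> = phi N p.1 p.2.
Proof. by rewrite /free_lift liftU scale1r. Qed.

(** Vanishing is claimed for all multiples of [N], so that relations with different denominators can
    be combined. *)
Let tensor_null_multiple x : tensor_null (intr : {rmorphism int -> rat}) x ->
  exists N : nat, (0 < N)%N /\ forall M, free_lift (phi (M * N)) x = 0.
Proof.
elim=> [|{}x y _ [N [N0 hN]] _ [N' [N'0 hN']]|m m' s|m s s'|k m s].
- by exists 1%N; split=> // M; rewrite raddf0.
- exists (N * N')%N; rewrite muln_gt0 N0 N'0; split=> // M.
  by rewrite raddfB/= mulnA hN' mulnAC hN subr0.
- by exists 1%N; split=> // M; rewrite 2!raddfB/= !free_liftU /phi/= scalerDr addrAC addrK subrr.
- have [N [N0 hN]] := integral_multiple s; have [N' [N'0 hN']] := integral_multiple s'.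
  exists (N * N')%N; rewrite muln_gt0 N0 N'0; split=> // M.
  rewrite 2!raddfB/= !free_liftU /phi/= mulrDr.
  have [k ->] : exists k : int, (M * (N * N'))%:R * s = k%:~R.
    by have [k hk] := hN (M * N')%N; exists k; rewrite -hk [(N * N')%N]mulnC mulnA.
  have [k' ->] : exists k : int, (M * (N * N'))%:R * s' = k%:~R.
    by have [k' hk] := hN' (M * N)%N; exists k'; rewrite -hk mulnA.
  by rewrite -intrD !numq_intr scalerDl addrAC addrK subrr.
- have [N [N0 hN]] := integral_multiple s; exists N; split=> // M.
  rewrite raddfB/= !free_liftU /phi/= mulrCA; have [j ->] := hN M.
  by rewrite -intrM !numq_intr scalerA mulrC subrr.
Qed.

Lemma tensor1_inj : (forall (x : X) n, (0 < n)%N -> x *+ n = 0 -> x = 0) ->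
  forall x, tens x 1 = 0 -> x = 0.
Proof.
move=> tf x; have -> : (0 : base_change (intr : {rmorphism int -> rat}) X) =
    tensor_class (intr : {rmorphism int -> rat}) 0 by rewrite raddf0.
move/tensor_class_eq; rewrite subr0 => /tensor_null_multiple[N [N0 /(_ 1%N)]].
rewrite mul1n free_liftU /phi/= mulr1 => h; apply: (tf x N N0); move: h.
by rewrite pmulrn numq_intr -(intz N) scaler_int -pmulrn.
Qed.

Lemma tensor_fraction (v : base_change (intr : {rmorphism int -> rat}) X) :
  exists (n : nat) x, (0 < n)%N /\ v = tens x n%:R^-1.
Proof.
have den (n : nat) : (0 < n)%N -> n%:R != 0 :> rat by move=> n0; rewrite pnatr_eq0 -lt0n.
elim/tensor_ind: v => [|_ _ [a [x [a0 ->]]] [b [y [b0 ->]]]|m s].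
- by exists 1%N, 0; split=> //; rewrite tensor0l.
- exists (a * b)%N, (b%:Z *: x - a%:Z *: y); rewrite muln_gt0 a0 b0; split=> //.
  rewrite tensorBl !tensorZl; congr (tens _ _ - tens _ _);
    by rewrite natrM; field; rewrite !den.
- exists `|denq s|%N, (numq s *: m); rewrite absz_gt0 denq_neq0; split=> //.
  rewrite tensorZl; congr (tens _ _).
  rewrite -[s in LHS]divq_num_den; congr (_ / _).
  by rewrite -[in LHS](gez0_abs (ltW (denq_gt0 s))).
Qed.

End RationalSpan.

Section CyclicSubspace.
Variables (K : fieldType) (V : lmodType K) (T : {linear V -> V}) (u : V).

Definition cyclic_pred : {pred V} := fun v => `[< exists q, v = act T q u >].

Lemma cyclic_submod_closed : submod_closed cyclic_pred.
Proof.
split=> [|c v w /asboolP[p ->] /asboolP[q ->]]; apply/asboolP.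
  by exists 0; rewrite act0.
by exists (c *: p + q); rewrite actD actZ.
Qed.
HB.instance Definition _ := GRing.isSubmodClosed.Build K V cyclic_pred cyclic_submod_closed.

Lemma cyclic_invariant : invariant_subspace (cyclic_pred : submodClosed V) T.
Proof.
move=> v /asboolP[q ->]; apply/asboolP; exists (q * 'X).
by rewrite act_mulX actT.
Qed.

End CyclicSubspace.

Section Restriction.
Variables (K : fieldType) (V : lmodType K) (T : {linear V -> V}).
Variables (W : submodClosed V) (TW : invariant_subspace W T).

Lemma val_act q (w : linear_subspace W) : val (act (restriction TW) q w) = act T q (val w).
Proof.
have viter n : val (iter n (restriction TW) w) = iter n T (val w) by elim: n => //= n <-.
rewrite /act (raddf_sum (val : linear_subspace W -> V)); apply: eq_bigr => i _.
by rewrite -viter.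
Qed.

End Restriction.

(** * Unit roots and eigenvectors of cyclic subspaces *)

Section HyperbolicCyclic.
Variables (R : realType) (V : lmodType rat) (T : {linear V -> V}).
Hypothesis hypT : forall (W : submodClosed V) (TW : invariant_subspace W T),
  finite_dimensional (linear_subspace W) -> hyperbolic R (restriction TW).

(** A root [z] of modulus 1 splits [m] as [qC * ('X - z%:P)] over the complex numbers. Then [qC]
    applied to the generator is an eigenvector for [z] in the complexified cyclic subspace, which
    has dimension the degree of [m]. *)
Lemma annihilator_no_unit_root u m : annihilator T [set 0] u m -> m != 0 ->
  no_unit_root R m.
Proof.
move=> annm m0 z z1; apply/negP => /eqP mz.
pose W : submodClosed V := cyclic_pred T u.
pose TW := cyclic_invariant (T := T) (u := u).
pose L := restriction TW.
have uW : u \in W by apply/asboolP; exists 1; rewrite act1.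
pose w0 : linear_subspace W := LinearSubspace uW.
have genW (w : linear_subspace W) : exists q, w = act L q w0.
  have /asboolP[q wq] := linear_subspace_valP w.
  by exists q; apply: val_inj; rewrite val_act.
have actW0 q : act L q w0 = 0 <-> (m %| q)%R.
  split=> [h|/annm h]; last by apply: val_inj; rewrite val_act.
  by apply/annm; have := congr1 val h; rewrite val_act.
pose d := (size m).-1.
have fd : finite_dimensional (linear_subspace W).
  exists [seq iter i L w0 | i <- iota 0 d] => w.
  have [q ->] := genW w; exists (fun i => (q %% m)`_i).
  have -> : act L q w0 = act L (q %% m) w0.
    apply/eqP; rewrite -subr_eq0 -actB; apply/eqP/actW0.
    by rewrite {1}(divp_eq q m) addrK dvdp_mulIr.
  rewrite (@actE _ _ _ _ _ d); last by rewrite -ltnS prednK ?size_poly_gt0// ltn_modp.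
  have sz : size [seq iter i L w0 | i <- iota 0 d] = d by rewrite size_map size_iota.
  rewrite -(big_mkord xpredT (fun i => (q %% m)`_i *: iter i L w0)).
  rewrite -(big_mkord xpredT (fun i => (q %% m)`_i *: [seq iter i L w0 | i <- iota 0 d]`_i)).
  rewrite sz; apply: eq_big_nat => i /andP[_ id]; congr (_ *: _).
  by rewrite (nth_map 0%N) ?size_iota// nth_iota.
have hyp := @hypT W TW fd z; suff : `|z| != 1 by rewrite z1 eqxx.
apply: hyp.
pose mC : {poly R[i]} := map_poly ratr m.
have [qC mCE] : exists qC, mC = qC * ('X - z%:P) by apply/factor_theorem/rootP.
have mC0 : mC != 0 by rewrite map_poly_eq0.
have qC0 : qC != 0 by apply: contraNneq mC0 => q0; rewrite mCE q0 mul0r.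
pose LC := base_change_map (ratr : {rmorphism rat -> R[i]}) L.
pose t0 := tensor (ratr : {rmorphism rat -> R[i]}) w0 1.
have szq : size qC = d.
  have := congr1 (fun p : {poly R[i]} => size p) mCE.
  by rewrite size_map_poly size_Mmonic ?monicXsubC// size_XsubC addn2/= /d => ->.
exists (act LC qC t0); last first.
  apply/eqP; rewrite -subr_eq0.
  have -> : LC (act LC qC t0) - z *: act LC qC t0 = act LC ('X - z%:P) (act LC qC t0).
    by rewrite actB actC -['X]mul1r act_mulX act1.
  rewrite -actM mulrC -mCE /mC act_base_change_map.
  by have /actW0 -> := dvdpp m; rewrite tensor0l.
have /choice[rep repP] := genW.
(* The coordinate of the top power of [L]. Its complex extension [lft] sends the candidate
   eigenvector to the leading coefficient of [qC], so that vector is not zero. *)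
pose lam (w : linear_subspace W) : rat := (rep w %% m)`_(d.-1).
have lamE q w : w = act L q w0 -> lam w = (q %% m)`_(d.-1).
  move=> wq; have e : rep w %% m = q %% m.
    apply/eqP; rewrite -subr_eq0 -modpN -modpD; apply/eqP/modp_eq0P/actW0.
    by rewrite actB -repP -wq subrr.
  by rewrite /lam e.
have lamD w w' : lam (w + w') = lam w + lam w'.
  rewrite (lamE (rep w + rep w')); last by rewrite actD -!repP.
  by rewrite modpD coefD.
have lamZ c w : lam (c *: w) = c * lam w.
  rewrite (lamE (c *: rep w)); last by rewrite actZ -repP.
  by rewrite modpZl coefZ.
pose phi (w : linear_subspace W) (s : R[i]) : R[i] := ratr (lam w) * s.
have phiDl w w' s : phi (w + w') s = phi w s + phi w' s.
  by rewrite /phi lamD rmorphD mulrDl.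
have phiDr w s s' : phi w (s + s') = phi w s + phi w s' by rewrite /phi mulrDr.
have phiZ c w s : phi (c *: w) s = phi w (ratr c * s).
  by rewrite /phi lamZ rmorphM -mulrA mulrCA.
have liftE := @tensor_liftE rat R[i] ratr (linear_subspace W) R[i] phi phiDl phiDr phiZ.
have liftB := @tensor_lift_is_additive rat R[i] ratr (linear_subspace W) R[i] phi phiDl phiDr phiZ.
pose lft := @tensor_lift rat R[i] ratr (linear_subspace W) R[i] phi.
have lftE w s : lft (tensor ratr w s) = phi w s by exact: liftE.
have lft0 : lft 0 = 0 by have := liftB 0 0; rewrite !subrr.
have liftD x y : lft (x + y) = lft x + lft y.
  rewrite -[y]opprK [LHS]liftB -[- y in RHS]sub0r [lft (- (0 - y))]/(lft _).
  have -> : - (0 - y) = y by rewrite sub0r opprK.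
  by have := liftB 0 y; rewrite sub0r -/lft lft0 sub0r => ->; rewrite opprK.
have d0 : (0 < size qC)%N by rewrite size_poly_gt0.
apply: contra qC0 => /eqP e0.
have : lft (act LC qC t0) = lead_coef qC.
  rewrite /act (big_morph _ liftD lft0).
  rewrite /lead_coef -(prednK d0) big_ord_recr/= big1 ?add0r.
    rewrite iter_base_change_map tensorZr mulr1 lftE /phi (lamE ('X^((size qC).-1) : {poly rat})); last first.
      by rewrite act_Xn.
    rewrite modp_small ?size_polyXn; last by rewrite prednK// szq /d prednK ?size_poly_gt0.
    by rewrite coefXn szq eqxx rmorph1 mul1r.
  move=> i _; rewrite iter_base_change_map tensorZr mulr1 lftE /phi (lamE ('X^i : {poly rat})); last first.
    by rewrite act_Xn.
  rewrite modp_small ?size_polyXn; last first.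
    rewrite -[size m]prednK ?size_poly_gt0// -/d -szq ltnS.
    by rewrite (leq_trans (ltn_ord i))// leq_pred.
  rewrite coefXn -szq gtn_eqF ?rmorph0 ?mul0r//.
by rewrite e0 lft0 => h; rewrite -lead_coef_eq0 -h.
Qed.

End HyperbolicCyclic.

(** * Resonance *)

(** Among [n.+1] iterates of [w] expressed through [n] spanning vectors there is a linear relation;
    the product of the relations for the spanning vectors kills [W]. *)
Lemma finite_dimensional_annihilator (K : fieldType) (W : lmodType K) (L : {linear W -> W}) :
  finite_dimensional W -> exists P : {poly K}, P != 0 /\ forall w, act L P w = 0.
Proof.
move=> [s sP]; pose n := size s.
have one (w : W) : exists P : {poly K}, P != 0 /\ act L P w = 0.
  have /choice[c cP] : forall k : nat, exists c : 'I_n -> K, iter k L w = \sum_i c i *: s`_i.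
    by move=> k; exact: sP.
  pose M : 'M[K]_(n.+1, n) := \matrix_(k, i) c k i.
  have : kermx M != 0.
    rewrite kermx_eq0; apply: contraL (ltnSn n) => /eqP rM.
    by rewrite -leqNgt -{1}rM rank_leq_col.
  move=> /rowV0Pn[v /sub_kermxP vM v0].
  exists (\poly_(k < n.+1) v 0 (inord k)); split.
    apply: contra v0 => /eqP P0; apply/eqP/rowP => k; rewrite mxE.
    have := congr1 (fun p : {poly K} => p`_k) P0.
    by rewrite coef_poly ltn_ord inord_val coef0.
  rewrite (@actE _ _ _ _ _ n.+1) ?size_poly//.
  transitivity (\sum_(i < n) (v *m M) 0 i *: s`_i); last first.
    by rewrite vM big1// => i _; rewrite mxE scale0r.
  under [RHS]eq_bigr do rewrite mxE scaler_suml.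
  rewrite exchange_big; apply: eq_bigr => k _ /=.
  rewrite coef_poly ltn_ord inord_val cP scaler_sumr.
  by apply: eq_bigr => i _; rewrite scalerA mxE.
have /choice[f fP] := one.
pose P := \prod_(w <- s) f w.
have P0 : P != 0 by rewrite prodf_seq_neq0; apply/allP => w _; exact: (fP w).1.
exists P; split=> // w; have [c ->] := sP w.
rewrite (linear_sum (act L P)) big1// => i _; rewrite linearZ/=.
have si : s`_i \in s by exact: mem_nth.
by rewrite /P (big_rem _ si)/= mulrC actM (fP _).2 act_0r scaler0.
Qed.

Section UnitEigenvalue.
Variable R : realType.

Definition minimal_rational_poly (z : R[i]) (p : {poly rat}) :=
  [/\ p != 0, (map_poly ratr p).[z] = 0 &
   forall q : {poly rat}, q != 0 -> (map_poly ratr q).[z] = 0 -> (size p <= size q)%N].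

Lemma minimal_rational_poly_dvd z p q : minimal_rational_poly z p ->
  (map_poly ratr q).[z] = 0 -> (p %| q)%R.
Proof.
move=> [p0 pz minp] qz; apply: contrapT => /negP; rewrite /dvdp => r0.
have rz : (map_poly ratr (q %% p)).[z] = 0.
  have -> : q %% p = q - (q %/ p) * p by rewrite {2}(divp_eq q p) addrAC subrr add0r.
  by rewrite rmorphB rmorphM/= hornerD hornerN hornerM qz pz mulr0 subrr.
by have := minp _ r0 rz; rewrite leqNgt ltn_modp p0.
Qed.

Lemma minimal_rational_poly_size z p : minimal_rational_poly z p -> (1 < size p)%N.
Proof.
move=> [p0 pz _]; rewrite ltnNge; apply/negP => /size1_polyC pE.
move: pz p0; rewrite pE map_polyC hornerC/= => /eqP.
by rewrite fmorph_eq0 polyC_eq0 => ->.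
Qed.

(** The minimal polynomial of [L] vanishes at [z], hence is [r * p]. Having smaller degree, [r] does
    not kill [W], and [p] kills the image of [r]. *)
Lemma unit_eigenvalue_annihilated (W : lmodType rat) (L : {linear W -> W}) z :
  finite_dimensional W ->
  is_eigenvalue (base_change_map (ratr : {rmorphism rat -> R[i]}) L) z ->
  exists p w, [/\ minimal_rational_poly z p, w != 0 & act L p w = 0].
Proof.
move=> fd [e e0 eE].
pose LC := base_change_map (ratr : {rmorphism rat -> R[i]}) L.
have root_z P : (forall w, act L P w = 0) -> (map_poly ratr P).[z] = 0.
  move=> PL; have z0 : act LC (map_poly ratr P) e = 0.
    elim/tensor_ind: e {e0 eE} => [|x y hx hy|m s].
    - exact: act_0r.
    - by rewrite act_subr hx hy subrr.
    - by rewrite act_base_change_map PL tensor0l.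
  have := act_eigen (map_poly ratr P) eE; rewrite -/LC z0 => /esym/eqP.
  by rewrite scaler_eq0 (negbTE e0) orbF => /eqP.
have [P0 [P00 P0L]] := finite_dimensional_annihilator L fd.
have exP : exists n, `[< exists P : {poly rat}, [/\ P != 0, forall w, act L P w = 0 & size P = n] >].
  by exists (size P0); apply/asboolP; exists P0.
have exp : exists n, `[< exists p : {poly rat}, [/\ p != 0, (map_poly ratr p).[z] = 0 & size p = n] >].
  by exists (size P0); apply/asboolP; exists P0; split=> //; exact: root_z.
case: (ex_minnP exP) => N /asboolP[P [Pn0 PL PN]] minP.
case: (ex_minnP exp) => n /asboolP[p [pn0 pz pn]] minp.
have mp : minimal_rational_poly z p.
  by split=> // q q0 qz; rewrite pn; apply: minp; apply/asboolP; exists q.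
have /dvdpP[r PE] := minimal_rational_poly_dvd mp (root_z P PL).
have r0 : r != 0 by apply: contraNneq Pn0 => r0; rewrite PE r0 mul0r.
have [w rw] : exists w, act L r w != 0.
  apply: contrapT => /forallNP h.
  have rL w : act L r w = 0 by have /negP := h w; rewrite negbK => /eqP.
  have /minP : `[< exists P : {poly rat}, [/\ P != 0, forall w, act L P w = 0 & size P = size r] >].
    by apply/asboolP; exists r.
  rewrite -PN PE size_mul// leqNgt => /negP; apply.
  have := minimal_rational_poly_size mp; case: (size p) => [|[|k]]// _.
  by rewrite !addnS/= ltnS leq_addr.
exists p, (act L r w); split=> //.
by rewrite -actM mulrC -PE PL.
Qed.

End UnitEigenvalue.

Section Resonance.
Variables (R : realType) (X : lmodType int) (T : {linear X -> X}).
Hypothesis torsion_free : forall (x : X) n, (0 < n)%N -> x *+ n = 0 -> x = 0.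
Variables (x : X) (z : R[i]) (p : {poly int}).
Hypotheses (x0 : x != 0) (z1 : `|z| = 1) (px : act T p x = 0).
Hypothesis minp : minimal_rational_poly z (map_poly intr p).
Local Notation C := R[i].
Local Notation normc := (@ComplexField.Normc.normc R).

Let horner_ratr (q : {poly int}) : (map_poly ratr (map_poly intr q : {poly rat})).[z] = (map_poly intr q).[z].
Proof.
rewrite -map_poly_comp; congr (_.[z]); apply: eq_map_poly => k /=.
by rewrite ratr_int.
Qed.

Let scale_eq0 (k : int) : k != 0 -> k *: x <> 0.
Proof.
move=> k0 kx; move/eqP: x0; apply; apply: (@torsion_free _ `|k|%N); first by rewrite absz_gt0.
have kE : k *: x = x *~ k by rewrite -scaler_int intz.
move: kx; rewrite kE; case: (k) => n; rewrite ?NegzE ?mulrNz ?abszN -?pmulrn// => /eqP.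
by rewrite oppr_eq0 => /eqP.
Qed.

(** Otherwise [q] is coprime to the minimal polynomial of [z], and a Bezout identity with cleared
    denominators gives [k *: x = 0] for a nonzero integer [k], against torsion-freeness. *)
Lemma annihilated_root (q : {poly int}) : act T q x = 0 -> (map_poly intr q : {poly C}).[z] = 0.
Proof.
move=> qx; apply/eqP/negPn/negP => qz.
pose P : {poly rat} := map_poly intr p; pose Q : {poly rat} := map_poly intr q.
have [P0 Pz minP] := minp.
have cop : size (gcdp P Q) = 1%N.
  have /dvdpP[h PE] := dvdp_gcdl P Q.
  have gz : (map_poly ratr (gcdp P Q)).[z] != 0.
    have /dvdpP[k QE] := dvdp_gcdr P Q.
    apply: contra qz => /eqP gz; rewrite -horner_ratr -/Q {1}QE rmorphM/= hornerM gz mulr0.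
    exact: eqxx.
  have hz : (map_poly ratr h).[z] = 0.
    move/eqP: Pz; rewrite -/P PE rmorphM/= hornerM mulf_eq0 (negbTE gz) orbF.
    by move=> /eqP.
  have h0 : h != 0 by apply: contraNneq P0 => h0; rewrite -/P PE h0 mul0r.
  have g0 : gcdp P Q != 0 by apply: contraNneq P0 => g0; rewrite -/P PE g0 mulr0.
  have := minP h h0 hz; rewrite -/P {1}PE size_mul//.
  have := g0; rewrite -size_poly_gt0; case: (size (gcdp P Q)) => [//|[//|k]] _.
  rewrite !addnS/= ltnNge leq_addr.
  by [].
have [[u v] /= /eqpP[[c1 c2] /= /andP[c10 c20] cE]] := Bezoutp P Q.
have /size_poly1P[c c0 gE] : size (gcdp P Q) == 1%N by rewrite cop.
have [U [a a0 uE]] := rat_poly_scale u; have [W [b b0 vE]] := rat_poly_scale v.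
have [k [k0 [U' [W' kE]]]] : exists k : int, k != 0 /\ exists U' W' : {poly int}, U' * p + W' * q = k%:P.
  (* Bezout's identity holds up to the units [c1] and [c2]; [t] is the resulting value of
     [u * P + v * Q]. *)
  pose t := c2 * c / c1.
  have t0 : t != 0 by rewrite !mulf_neq0 ?invr_neq0.
  have [N NE] : {N : int | N = a * b * numq t} by exists (a * b * numq t).
  exists N; split; first by rewrite NE !mulf_neq0// numq_eq0.
  exists ((b * denq t) *: U), ((a * denq t) *: W).
  apply: (@map_inj_poly int rat intr) => //; first exact: intr_inj.
  rewrite rmorphD !rmorphM/= !map_polyZ map_polyC/= -/P -/Q.
  have aR : a%:~R != 0 :> rat by rewrite intr_eq0.
  have bR : b%:~R != 0 :> rat by rewrite intr_eq0.
  pose K : int := a * b * denq t.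
  have uv : u * P + v * Q = t%:P.
    apply: (scalerI c10); rewrite cE gE -!mul_polyC -!polyCM; congr (_%:P).
    by rewrite /t; field.
  have -> : (b * denq t)%:~R *: map_poly intr U = (K%:~R)%:P * u :> {poly rat}.
    rewrite uE mul_polyC scalerA; congr (_ *: _).
    by rewrite /K !intrM; field.
  have -> : (a * denq t)%:~R *: map_poly intr W = (K%:~R)%:P * v :> {poly rat}.
    rewrite vE mul_polyC scalerA; congr (_ *: _).
    by rewrite /K !intrM; field.
  have tE : K%:~R * t = N%:~R.
    by rewrite /K NE !intrM -mulrA numqE [t * _]mulrC.
  by rewrite -[_ * u * _]mulrA -[_ * v * _]mulrA -mulrDr uv -polyCM tE.
apply: (scale_eq0 k0).
by rewrite -(actC T) -kE actD !actM px qx !act_0r addr0.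
Qed.

Lemma complex_divisible (w : C) n : (0 < n)%N -> exists w', w' *+ n = w.
Proof.
by move=> n0; exists (w / n%:R); rewrite -(mulr_natr (w / n%:R)) divfK// pnatr_eq0 -lt0n.
Qed.

(** Well defined on the cyclic module of [x] by [annihilated_root], then extended because the
    complex numbers are divisible. *)
Lemma evaluation_exists : exists E : {additive X -> C}, forall n, E (iter n T x) = z ^+ n.
Proof.
pose G := [set t : X * C | exists q : {poly int}, t = (act T q x, (map_poly intr q).[z])].
have hG : hom_graph G.
  split; first split.
  - by exists 0; rewrite act0 rmorph0 horner0.
  - move=> _ _ [q ->] [q' ->]; exists (q - q').
    by rewrite actB rmorphB hornerD hornerN.
  - by move=> d [q [/esym qx ->]]; exact: annihilated_root.
have [E EG] := hom_extension complex_divisible hG.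
exists E => n; apply: EG; exists 'X^n.
by rewrite act_Xn map_polyXn hornerXn.
Qed.

Let pC : {poly C} := map_poly intr p.
Let c := (pC^`()).[z].

(** The derivative is a nonzero rational polynomial of smaller degree than the minimal one. [c] is
    the amplitude with which errors proportional to [z ^+ n] enter the recurrence. *)
Lemma derivative_neq0 : c != 0.
Proof.
have [P0 Pz minP] := minp; pose P : {poly rat} := map_poly intr p.
have sP : (1 < size P)%N := minimal_rational_poly_size minp.
have szd : (size P^`() < size P)%N by rewrite lt_size_deriv.
have d0 : P^`() != 0.
  apply/eqP => /(congr1 (fun q : {poly rat} => q`_((size P).-2))).
  rewrite coef_deriv coef0; case E : (size P) sP => [|[|k]]// _ /=.
  move/eqP; rewrite -mulr_natr mulf_eq0 pnatr_eq0 orbF => /eqP Pk.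
  have := P0; rewrite -/P -lead_coef_eq0 /lead_coef E /= Pk eqxx.
  by [].
apply/eqP => c0; have := minP _ d0.
have -> : (map_poly ratr P^`()).[z] = c.
  rewrite /c /pC -deriv_map; congr ((_^`()).[z]).
  by rewrite -map_poly_comp; apply: eq_map_poly => k /=; rewrite ratr_int.
by rewrite c0 => /(_ erefl); rewrite leqNgt szd.
Qed.

Let cE : c = \sum_(i < size p) pC`_i * (z ^+ i.-1 *+ i).
Proof.
have spC : size pC = size p by rewrite size_map_inj_poly//; exact: intr_inj.
rewrite /c -[pC in LHS]coefK poly_def spC.
rewrite (raddf_sum (@deriv C)) horner_sum; apply: eq_bigr => i _.
transitivity ((pC`_i *: ('X^i)^`()).[z]); first by congr (_.[z]); exact: derivZ.
by rewrite derivXn hornerZ hornerMn hornerXn.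
Qed.

Let normcz n : normc (z ^+ n) = 1.
Proof.
elim: n => [|n ih]; first by rewrite expr0 ComplexField.Normc.normc1.
by rewrite exprS ComplexField.Normc.normcM ih mulr1; move: z1 => [].
Qed.

Let normc_ge0 (w : C) : 0 <= normc w.
Proof. by rewrite -ler0c; exact: (normr_ge0 w). Qed.

Let Re_le_normc (w : C) : `|complex.Re w| <= normc w.
Proof. by case: w => u v /=; rewrite -sqrtr_sqr ler_wsqrtr// lerDl sqr_ge0. Qed.

Let normcB (w w' : C) : normc (w - w') <= normc w + normc w'.
Proof. by rewrite (le_trans (le_normcD _ _))// normcN. Qed.

Let normc_sum (n : nat) (F : nat -> C) : normc (\sum_(i < n) F i) <= \sum_(i < n) normc (F i).
Proof.
elim: n => [|n ih]; first by rewrite !big_ord0 ComplexField.Normc.normc0.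
by rewrite !big_ord_recr/= (le_trans (le_normcD _ _))// lerD.
Qed.

Let archimedean_le0 (t D : R) : (forall N : nat, N%:R * t <= D) -> t <= 0.
Proof.
move=> h; rewrite leNgt; apply/negP => t0.
have D0 : 0 <= D by have := h 0%N; rewrite mul0r.
have := archi_boundP (divr_ge0 D0 (ltW t0)).
by rewrite ltr_pdivrMr// ltNge h.
Qed.

(* Summing z^-(n+1) (eta(n+1) - z eta(n)) telescopes, while the real part of z^n has
   a component along z^n that does not average out. *)
Lemma resonance_unbounded (gamma B : R) (eta : nat -> C) : 0 < gamma ->
  (forall n, normc (eta n) <= B) ->
  (forall n, eta n.+1 - z * eta n = (gamma * complex.Re (z ^+ n))%:C) -> False.
Proof.
move=> g0 etaB etaE; pose w := conjc z.
have zw : z * w = 1.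
  by have := sqr_normc z; rewrite z1 expr1n => <-.
have normcw n : normc (w ^+ n) = 1.
  have := congr1 normc (exprMn n z w); rewrite zw expr1n ComplexField.Normc.normc1.
  by rewrite ComplexField.Normc.normcM normcz mul1r.
pose theta n := eta n * w ^+ n.
pose v := w ^+ 2.
pose S N := \sum_(n < N) (1 + v ^+ n).
(* As [w] is the inverse of [z], twice the real part of [z ^+ n] is [z ^+ n + w ^+ n]: a resonant
   term, which contributes 1, and an oscillation [v ^+ n]. *)
have step n : 2 * (theta n.+1 - theta n) = gamma%:C * w * (1 + v ^+ n).
  have -> : theta n.+1 - theta n = w ^+ n.+1 * (eta n.+1 - z * eta n).
    rewrite /theta mulrBr mulrA exprSr -!mulrA [w * (z * _)]mulrA [w * z]mulrC zw mul1r.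
    by rewrite mulrC [w ^+ n * eta n]mulrC -mulrA.
  have re2 : 2 * (complex.Re (z ^+ n))%:C = z ^+ n + w ^+ n.
    rewrite /w -[conjc z ^+ n](rmorphXn (@conjc R : {rmorphism C -> C})).
    by rewrite addcJ.
  have zwn : w ^+ n.+1 * z ^+ n = w.
    by rewrite exprS -mulrA -exprMn [w * z]mulrC zw expr1n mulr1.
  have wwn : w ^+ n.+1 * w ^+ n = w * v ^+ n.
    by rewrite exprS -mulrA -exprD addnn -mul2n exprM.
  transitivity (gamma%:C * (w ^+ n.+1 * (2 * (complex.Re (z ^+ n))%:C))).
    by rewrite etaE rmorphM; ring.
  by rewrite re2 mulrDr zwn wwn; ring.
have SE N : gamma%:C * w * S N = 2 * (theta N - theta 0%N).
  rewrite /S mulr_sumr; under eq_bigr do rewrite -step.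
  rewrite -mulr_sumr; congr (_ * _).
  rewrite -(big_mkord xpredT (fun n => theta n.+1 - theta n)).
  by rewrite telescope_sumr.
have B0 : 0 <= B := le_trans (normc_ge0 _) (etaB 0%N).
pose D := 4 * B / gamma.
have normc2 : normc (2 : C) = 2.
  by rewrite -[2 : C](rmorph_nat (real_complex R)) /= expr0n addr0 sqrtr_sqr ger0_norm.
have normcR (t : R) : 0 <= t -> normc (t%:C) = t.
  by move=> t0; rewrite /= expr0n addr0 sqrtr_sqr ger0_norm.
have SD N : normc (S N) <= D.
  have := congr1 normc (SE N); rewrite !ComplexField.Normc.normcM normc2.
  rewrite (normcR gamma)//; last exact: ltW.
  have := normcw 1%N; rewrite expr1 => ->; rewrite mulr1 => h.
  rewrite /D ler_pdivlMr// mulrC h.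
  have -> : 4 * B = 2 * (B + B) by ring.
  rewrite ler_pM2l// (le_trans (normcB _ _))// /theta !ComplexField.Normc.normcM !normcw !mulr1.
  by rewrite lerD.
(* For [v != 1] the right side is unbounded although [S] is bounded; for [v = 1] the sum [S N] is
   [2 * N]. Either way [SD] fails. *)
have Srec N : S N.+1 - v * S N = N%:R * (1 - v) + 2.
  have Ssplit k : S k = k%:R + \sum_(n < k) v ^+ n.
    by rewrite /S big_split/= sumr_const card_ord.
  rewrite !Ssplit big_ord_recl/= mulrDr mulr_sumr.
  under [X in _ - (_ + X)]eq_bigr do rewrite -exprS.
  by rewrite -natr1 expr0; move: (\sum_(i < N) _) => t; ring.
have nv : normc v = 1 by exact: normcw.
have v1 : v = 1.
  apply/eqP; rewrite eq_sym -subr_eq0; apply/eqP/ComplexField.Normc.eq0_normc/eqP.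
  rewrite eq_le normc_ge0 andbT; apply: (@archimedean_le0 _ (2 * D + 2)) => N.
  rewrite -[N%:R](normcR N%:R)// -ComplexField.Normc.normcM rmorph_nat.
  have -> : N%:R * (1 - v) = S N.+1 - v * S N - 2 by rewrite Srec addrK.
  rewrite (le_trans (normcB _ _))// normc2 lerD2r (le_trans (normcB _ _))//.
  by rewrite ComplexField.Normc.normcM nv mul1r mulr2n mulrDl mul1r lerD.
have : (2 : R) <= 0.
  apply: (@archimedean_le0 _ D) => N; apply: le_trans (SD N).
  have -> : S N = (N%:R * 2)%:C.
    rewrite /S v1; under eq_bigr do rewrite expr1n.
    rewrite sumr_const card_ord rmorphM/= rmorph_nat -[(2)%:C]/((2%:R)%:C) rmorph_nat.
    by rewrite mulr_natl.
  by rewrite normcR ?mulr_ge0.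
by rewrite lern0.
Qed.

(** The errors are the circle images of the real parts of [delta * cb * z ^+ n * E]. As [p] kills
    [x], the lift [zeta] of a small orbit at [x] satisfies a recurrence with right side [gamma]
    times the real part of [z ^+ n], where [gamma] is [delta] times the squared modulus of [c]. *)
Theorem resonance_no_shadow : ~ shadow R T [set 0] setT.
Proof.
move=> sh; have [E EE] := evaluation_exists.
(* Lifts bounded by [(4 * G)^-1] keep the left side of the recurrence within 1/4; with
   [gamma <= 2^-1] the difference of both sides is in the range of [expi_eq0]. *)
pose G : R := 1 + \sum_(i < size p) `|p`_i|%:~R.
have G0 : 0 < G by rewrite ltr_wpDr// sumr_ge0.
have eps0 : 0 < (4 * G)^-1 by rewrite invr_gt0 mulr_gt0.
have [s [d [d0 hs]]] := sh [:: x] _ (fun _ _ => I) eps0.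
pose cb := conjc c.
pose Bd : R := 1 + normc (cb * c) + \sum_(y <- s) normc (cb * E y).
have sum0 : 0 <= \sum_(y <- s) normc (cb * E y) by rewrite sumr_ge0.
have Bd0 : 0 < Bd by rewrite ltr_wpDr// ltr_wpDr.
(* [d] keeps the errors small on [s], and 1/2 gives the bound on [gamma]; [Bd] dominates the
   corresponding amplitudes. *)
pose delta := Num.min d 2^-1 / Bd.
have delta0 : 0 < delta by rewrite divr_gt0// lt_min d0 invr_gt0 ltr0n.
have deltad y : y \in s -> delta * normc (cb * E y) <= d.
  move=> ys; rewrite /delta mulrAC ler_pdivrMr//; apply: ler_pM => //.
  - by rewrite le_min ltW//= invr_ge0.
  - by rewrite ge_min lexx.
  - rewrite /Bd (big_rem y ys)/= addrCA lerDl addr_ge0 ?addr_ge0//.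
    by rewrite sumr_ge0.
have delta2 : delta * normc (cb * c) <= 2^-1.
  rewrite /delta mulrAC ler_pdivrMr//; apply: ler_pM => //.
  - by rewrite le_min ltW//= invr_ge0.
  - by rewrite ge_min lexx orbT.
  - by rewrite /Bd -addrA addrCA lerDl addr_ge0.
pose rho n y : R := complex.Re (delta%:C * cb * z ^+ n * E y).
have rhoB n : zmod_morphism (rho n).
  move=> y y'; rewrite /rho raddfB mulrBr.
  by case: (_ * E y) => ? ?; case: (_ * E y').
pose rhoA n : {additive X -> R} := HB.pack (rho n) (GRing.isZmodMorphism.Build X R (rho n) (rhoB n)).
pose e n : {additive X -> circle R} := (@expi R \o rhoA n).
have normc_delta t : normc (delta%:C * t) = delta * normc t.
  by rewrite ComplexField.Normc.normcM /= expr0n addr0 sqrtr_sqr gtr0_norm.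
have [|n y ys|z0 [_ z0s]] := hs e.
- by move=> n _ ->; rewrite raddf0.
- exists (rho n y) => //; apply: le_trans (deltad y ys).
  apply: (le_trans (Re_le_normc _)).
  have -> : delta%:C * cb * z ^+ n * E y = delta%:C * (z ^+ n * (cb * E y)) by ring.
  by rewrite normc_delta ComplexField.Normc.normcM normcz mul1r.
have /choice[zeta zetaP] : forall n, exists t : R, `|t| <= (4 * G)^-1 /\ orb T z0 e n x = expi t.
  by move=> n; have [t t1 t2] := z0s n x (mem_head _ _); exists t.
pose gamma := delta * (complex.Re c ^+ 2 + complex.Im c ^+ 2).
have cc : cb * c = (complex.Re c ^+ 2 + complex.Im c ^+ 2)%:C.
  by rewrite mulrC -sqr_normc add_Re2_Im2.
have c20 : 0 < complex.Re c ^+ 2 + complex.Im c ^+ 2.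
  rewrite lt_def addr_ge0 ?sqr_ge0// andbT; apply: contra derivative_neq0 => /eqP c20.
  have := cc; rewrite c20 => /eqP; rewrite mulf_eq0 => /orP[|//].
  by rewrite conjc_eq0.
have gamma0 : 0 < gamma by rewrite mulr_gt0.
have gamma2 : gamma <= 2^-1.
  apply: le_trans delta2; rewrite cc /= expr0n addr0 sqrtr_sqr ger0_norm//.
  exact: ltW.
have recurrence n : \sum_(i < size p) zeta (n + i)%N *~ p`_i = gamma * complex.Re (z ^+ n).
  have orb0 : \sum_(i < size p) orb T z0 e n (iter i T x) *~ p`_i = 0.
    rewrite -[RHS](raddf0 (orb T z0 e n)) -px /act raddf_sum; apply: eq_bigr => i _.
    by rewrite -raddfMz -scaler_int intz.
  have h : \sum_(i < size p) orb T z0 e (n + i)%N x *~ p`_i = expi (gamma * complex.Re (z ^+ n)).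
    under eq_bigr do rewrite orbD mulrzDl.
    rewrite big_split/= orb0 add0r.
    transitivity (expi (\sum_(i < size p) (\sum_(l < i) rho (n + l)%N (iter (i - l.+1) T x)) *~ p`_i)).
      rewrite (raddf_sum (@expi R)); apply: eq_bigr => i _.
      by rewrite (raddfMz (@expi R)) (raddf_sum (@expi R)).
    congr expi.
    have ReD (u v : C) : complex.Re (u + v) = complex.Re u + complex.Re v by case: u v => ? ? [].
    have ReM (t : R) (u : C) : complex.Re (t%:C * u) = t * complex.Re u.
      by case: u => ? ? /=; rewrite mul0r subr0.
    have -> : gamma * complex.Re (z ^+ n) = complex.Re (delta%:C * cb * z ^+ n * c).
      have -> : delta%:C * cb * z ^+ n * c = gamma%:C * z ^+ n.
        have -> : gamma%:C = delta%:C * (cb * c) by rewrite cc -rmorphM.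
        by ring.
      by rewrite ReM.
    (* For each [i] the [i] inner terms all equal [z ^+ n * z ^+ i.-1] up to the common factor, so
       the double sum is that factor times the derivative of [p] at [z]; this is why the errors
       carry the conjugate [cb]. *)
    rewrite [in RHS]cE mulr_sumr (big_morph _ ReD (erefl : complex.Re (0 : C) = 0)).
    apply: eq_bigr => i _.
    rewrite (eq_bigr (fun=> complex.Re (delta%:C * cb * z ^+ n * z ^+ i.-1))); last first.
      move=> l _; rewrite /rho EE; congr (complex.Re _).
      rewrite exprD -!mulrA; congr (_ * (_ * (_ * _))); rewrite -exprD; congr (_ ^+ _).
      by case: l => l /= li; rewrite subnS -subn1 addnBA ?subn_gt0// subnKC 1?ltnW// subn1.
    rewrite sumr_const card_ord coef_map/=.
    rewrite -mulrzl -(rmorph_int (real_complex R)) mulrCA ReM; congr (_ * _).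
    rewrite mulrnAr; move: (delta%:C * cb * z ^+ n * _) => t.
    by elim: (nat_of_ord i) => [|k ih]; rewrite ?mulr0n// !mulrS ReD ih.
  have h' : expi (\sum_(i < size p) zeta (n + i)%N *~ p`_i - gamma * complex.Re (z ^+ n)) = 0.
    rewrite (raddfB (@expi R)); apply/eqP; rewrite subr_eq0; apply/eqP; apply: etrans h.
    rewrite (raddf_sum (@expi R)).
    by apply: eq_bigr => i _; rewrite (raddfMz (@expi R)); have [_ ->] := zetaP (n + i)%N.
  apply/eqP; rewrite -subr_eq0; apply/eqP; apply: expi_eq0 h'.
  rewrite (le_trans (ler_normB _ _))//.
  have -> : 1 = 2^-1 + 2^-1 :> R by field.
  apply: lerD.
    rewrite (le_trans (ler_norm_sum _ _ _))//.
    apply: (@le_trans _ _ (\sum_(i < size p) `|p`_i|%:~R * (4 * G)^-1)).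
      apply: ler_sum => i _; rewrite -mulrzl normrM intr_norm ler_wpM2l//.
      by have [] := zetaP (n + i)%N.
    rewrite -mulr_suml ler_pdivrMr ?mulr_gt0// (@le_trans _ _ G)//; first by rewrite /G lerDr.
    by lra.
  rewrite normrM gtr0_norm// -[leRHS]mulr1; apply: ler_pM => //; first exact: ltW.
  by rewrite -(normcz n); exact: Re_le_normc.
have [qC pCE] : exists qC, pC = qC * ('X - z%:P).
  apply/factor_theorem/rootP; have [_ Pz _] := minp.
  by rewrite /pC -horner_ratr.
(* [qC] absorbs the other roots of [p], leaving a bounded solution of the recurrence for the single
   factor ['X - z%:P]. *)
pose eta := poly_shift qC (fun n => (zeta n)%:C).
apply: (@resonance_unbounded gamma (\sum_(i < size qC) normc qC`_i * (4 * G)^-1) eta) => //.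
  move=> n; rewrite /eta /poly_shift.
  rewrite (le_trans (normc_sum _ (fun i => qC`_i * (zeta (n + i)%N)%:C)))// ler_sum// => i _.
  rewrite ComplexField.Normc.normcM ler_wpM2l// /= expr0n addr0 sqrtr_sqr.
  by have [] := zetaP (n + i)%N.
move=> n; rewrite -poly_shiftXsubC /eta -poly_shiftM mulrC -pCE.
have spC : size pC = size p by rewrite size_map_inj_poly//; exact: intr_inj.
rewrite /poly_shift spC -recurrence rmorph_sum; apply: eq_bigr => i _.
by rewrite coef_map/= (raddfMz (real_complex R)) mulrzl.
Qed.

End Resonance.

(** * Shadowing and the dual group *)

Section DualShadowing.
Variables (R : realType) (A : topologicalZmodType).
Implicit Types chi : pontryagin_dual R A.

Lemma small_evs_near (s : seq (pontryagin_dual R A)) (e : R) : 0 < e ->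
  \forall a \near (0 : A), forall chi, chi \in s -> small e (ev chi a).
Proof.
move=> e0; elim: s => [|chi s ih]; first by near=> a.
have h := small_ev_near chi e0.
near=> a => psi; rewrite inE => /predU1P[->|]; first by near: a.
by move: psi; near: a.
Unshelve. all: by end_near.
Qed.

(** The values of [chi] are [n]-torsion, and 0 is the only such element with a lift of size at most
    1/n. So [chi] is locally constant and its kernel is open and closed. *)
Lemma connected_dual_torsion_free : connected [set: A] ->
  forall chi n, (0 < n)%N -> chi *+ n = 0 -> chi = 0.
Proof.
move=> conA chi n n0 chin.
have nR : 0 < n%:R^-1 :> R by rewrite invr_gt0 ltr0n.
have evn a : ev chi a *+ n = 0.
  by have := congr1 (eval a) chin; rewrite raddfMn raddf0.
have loc a : \forall b \near a, ev chi b = ev chi a.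
  have := near_subr a (small_ev_near chi nR); apply: filterS => b [t t1 bt].
  have evt : ev chi b - ev chi a = expi t by rewrite -bt raddfB.
  apply: subr0_eq; rewrite evt.
  suff -> : t = 0 by rewrite raddf0.
  have tn : t *+ n = 0.
    apply: expi_eq0.
      by rewrite normrMn -(mulr_natr `|t|) -ler_pdivlMr ?ltr0n// div1r.
    by transitivity (ev chi (b - a) *+ n); [rewrite bt; exact: (raddfMn (@expi R))|exact: evn].
  by move/eqP: tn; rewrite mulrn_eq0 -leqn0 leqNgt n0 => /eqP.
pose B := [set a | ev chi a = 0].
have oB (S : set (circle R)) : open [set a | S (ev chi a)].
  by rewrite openE => a /= Sa; apply: filterS (loc a) => b /= ->.
have BT : B = setT.
  apply: conA.
  - by exists 0; rewrite /B/= raddf0.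
  - by exists B; rewrite ?setTI//; exact: (oB [set 0]).
  - exists B; rewrite ?setTI//.
    by rewrite -[B]setCK; apply: open_closedC; exact: (oB (~` [set 0])).
by apply: ev_eq0 => a; have : B a by rewrite BT.
Qed.

Hypotheses (compactA : compact [set: A]) (hausdorffA : hausdorff_space A).
Variables (M : (A -> R) -> R).
Hypothesis MM : is_mean M.
Variables (beta : {additive A -> A}) (cbeta : continuous beta).
Local Notation T := (@dual_map R A A beta cbeta).

Lemma ev_dual_map chi a : ev (T chi) a = ev chi (beta a).
Proof. exact: val_inj. Qed.

Lemma orb_ev (z : {additive pontryagin_dual R A -> circle R})
    (e : nat -> {additive pontryagin_dual R A -> circle R}) (y : nat -> A) :
  (forall chi, z chi = ev chi (y 0%N)) ->
  (forall n chi, e n chi = ev chi (y n.+1 - beta (y n))) ->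
  forall n chi, orb T z e n chi = ev chi (y n).
Proof.
move=> zy ey; elim=> [|n ih] chi; first exact: zy.
by rewrite orbS ih ey ev_dual_map raddfB addrC subrK.
Qed.

Lemma shadowing_error (x : nat -> A) c n :
  (- iter n.+1 beta c + x n.+1) - beta (- iter n beta c + x n) =
  - beta (x n) + x n.+1.
Proof.
by rewrite raddfD raddfN/= opprD opprK addrACA addNr add0r addrC.
Qed.

(** The deviations of a pseudo-orbit from a true orbit obey the same recursion with the same errors,
    so their evaluations form an [orb]. Surjectivity of evaluation turns sequences of homomorphisms
    into pseudo-orbits, and [nbhs0_characters] matches neighbourhoods with finite sets of
    characters. *)
Lemma has_shadowing_dual : has_shadowing beta <-> shadow R T [set 0] setT.
Proof.
split=> [sh s eps _ eps0|sh U U0].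
  have [V V0 VU] := sh _ (small_evs_near s eps0).
  have [s' [d [d0 sV]]] := nbhs0_characters compactA hausdorffA MM V0.
  exists s', d; split=> // e e0 es.
  have /choice[a aP] := fun n => eval_surjective compactA MM (e n).
  pose x := fix x n := if n is n'.+1 then beta (x n') + a n' else 0.
  have xa n : - beta (x n) + x n.+1 = a n by rewrite /= addKr.
  have [n|b bU] := VU x.
    by rewrite /= addKr; apply: sV => chi cs; rewrite aP; exact: es.
  exists (eval (- b)); split=> [chi ->|n chi cs]; first by rewrite raddf0.
  rewrite (@orb_ev _ _ (fun n => - iter n beta b + x n)); first exact: bU.
    by move=> psi; rewrite /= addr0.
  by move=> k psi; rewrite shadowing_error xa aP.
have [s [eps [eps0 sU]]] := nbhs0_characters compactA hausdorffA MM U0.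
have [s' [d [d0 hs]]] := sh s eps (fun _ _ => I) eps0.
exists [set a | forall chi, chi \in s' -> small d (ev chi a)]; first exact: small_evs_near.
move=> x xV.
have [n chi ->|n chi cs|z [_ zs]] := hs (fun n => eval (- beta (x n) + x n.+1)).
- by rewrite raddf0.
- exact: xV.
have [b bz] := eval_surjective compactA MM z.
exists (x 0%N - b) => n; apply: sU => chi cs.
rewrite -(@orb_ev z (fun n => eval (- beta (x n) + x n.+1))
  (fun n => - iter n beta (x 0%N - b) + x n)); first exact: zs.
- by move=> psi; rewrite /= opprB subrK bz.
- by move=> k psi; rewrite shadowing_error.
Qed.

End DualShadowing.

(** * Passage between the dual group and its rational span *)

Section RationalDual.
Variables (R : realType) (X : lmodType int) (T : {linear X -> X}).
Hypothesis torsion_free : forall (x : X) n, (0 < n)%N -> x *+ n = 0 -> x = 0.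
Local Notation V := (base_change (intr : {rmorphism int -> rat}) X).
Local Notation TQ := (base_change_map (intr : {rmorphism int -> rat}) T).
Local Notation tens := (tensor (intr : {rmorphism int -> rat}) (M := X)).

Let i (x : X) : V := tens x 1.

Let i_is_additive : zmod_morphism i. Proof. by move=> x y; exact: tensorBl. Qed.
HB.instance Definition _ := GRing.isZmodMorphism.Build X V i i_is_additive.

Lemma shadow_base_change : shadow R TQ [set 0] setT -> shadow R T [set 0] setT.
Proof.
apply: (@shadow_restrict R X V T TQ i).
  by move=> x y xy; apply: subr0_eq; apply: (tensor1_inj torsion_free);
    rewrite -/(i _) raddfB xy subrr.
by move=> x; rewrite /= base_change_mapE.
Qed.

(** The polynomial and the vector annihilated by it are rational; clearing denominators in both
    brings them to an integral polynomial and a nonzero element of [X], where resonance applies. *)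
Lemma shadow_hyperbolic : shadow R T [set 0] setT ->
  forall (W : submodClosed V) (TQW : invariant_subspace W TQ),
  finite_dimensional (linear_subspace W) -> hyperbolic R (restriction TQW).
Proof.
move=> sh W TQW fd z eig; apply/negP => /eqP z1.
have [p [w [minp w0 pw]]] := unit_eigenvalue_annihilated fd eig.
have [q [a a0 pE]] := rat_poly_scale p.
have aR : a%:~R != 0 :> rat by rewrite intr_eq0.
have qE : map_poly intr q = a%:~R *: p :> {poly rat} by rewrite pE scalerA divff// scale1r.
have minq : minimal_rational_poly z (map_poly intr q).
  have [p0 pz minp'] := minp; rewrite qE; split.
  - by rewrite scaler_eq0 negb_or aR.
  - by rewrite map_polyZ hornerZ pz mulr0.
  - by move=> r r0 rz; rewrite size_scale//; exact: minp'.
have [n [x [n0 xw]]] := tensor_fraction (val w).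
have nR : n%:R != 0 :> rat by rewrite pnatr_eq0 -lt0n.
have x0 : x != 0.
  by apply: contra w0 => /eqP x0; apply/eqP; apply: val_inj; rewrite xw x0 tensor0l.
have qx : act T q x = 0.
  apply: (tensor1_inj torsion_free); rewrite -(mulfV nR) -tensorZr.
  rewrite -act_base_change_map -xw qE actZ.
  by rewrite -val_act pw !scaler0.
exact: resonance_no_shadow torsion_free _ _ _ x0 z1 qx minq sh.
Qed.

End RationalDual.

Theorem theoremB (R : realType) (A : topologicalZmodType)
    (hausdorffA : hausdorff_space A) (compactA : compact [set: A])
    (connectedA : connected [set: A])
    (beta : {additive A -> A}) (cbeta : continuous beta) :
  let T : {linear pontryagin_dual R A -> pontryagin_dual R A} :=
    @dual_map R A A beta cbeta in
  let V : lmodType rat :=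
    base_change (intr : {rmorphism int -> rat}) (pontryagin_dual R A) in
  let TQ : {linear V -> V} :=
    base_change_map (intr : {rmorphism int -> rat}) T in
  has_shadowing beta <->
  (forall (W : submodClosed V) (TQW : invariant_subspace W TQ),
     finite_dimensional (linear_subspace W) -> hyperbolic R (restriction TQW)).
Proof.
move=> T V TQ; have [M MM] := mean_exists R A.
have tf := @connected_dual_torsion_free R A connectedA.
have [sh1 sh2] := has_shadowing_dual compactA hausdorffA MM cbeta.
split=> [/sh1 sh|hyp]; first exact: shadow_hyperbolic tf sh.
apply: sh2; apply: (shadow_base_change tf); apply: hyperbolic_shadow.
exact: annihilator_no_unit_root.
Qed.
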